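(* There exist a compact three-dimensional Riemannian manifold $M$, a codimension one $\mathcal C^\infty$ regular foliation $\mathcal F$ on $M$, and a continuous function $\varphi:M\to\mathbb R$ such that the length average of $\varphi$ for $\mathcal F$ does not exist at any point of some non-empty open subset of $M$.
   Context: Length average: for a foliation $\mathcal F$ on a compact Riemannian manifold $M$, a continuous function $\varphi:M\to\mathbb R$ and a point $x\in M$, the length average of $\varphi$ at $x$ for $\mathcal F$ is $$\lim_{r\to\infty}\frac{1}{|B_r^{\mathcal F}(x)|}\int_{B_r^{\mathcal F}(x)}\varphi(y)\,dy,$$ where $B_r^{\mathcal F}(x)$ is the ball of radius $r>0$ centered at $x$ in the leaf $\mathcal F(x)$ through $x$, with respect to the Riemannian metric induced on the leaf, and $|\cdot|$ and $dy$ refer to the induced Riemannian volume on the leaf. The length average does not exist at $x$ if this limit does not exist. A regular foliation is a foliation without singularities (all leaves have the same dimension, locally a product structure). *)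

(* Defs.v *)
(* MathComp-Analysis; R is an arbitrary realType. *)
From HB Require Import structures.
From mathcomp Require Import all_boot all_order all_algebra.
From mathcomp Require Import all_classical all_reals all_analysis.
Set Implicit Arguments.
Unset Strict Implicit.
Unset Printing Implicit Defensive.
Import Order.TTheory GRing.Theory Num.Theory.
Import numFieldNormedType.Exports.
Local Open Scope classical_set_scope.
Local Open Scope ring_scope.

(* C^k on an open set U: all iterated partial derivatives of order <= k exist
   and are continuous on U. *)
Fixpoint Ck_on (R : realType) (n k : nat) (U : set 'rV[R]_n)
    (f : 'rV[R]_n -> R) : Prop :=
  (forall z, U z -> {for z, continuous f}) /\
  match k with
  | 0%N => True
  | k'.+1 => forall i : 'I_n,
      (forall z, U z -> derivable f z (delta_mx 0 i)) /\
      Ck_on k' U ('D_(delta_mx 0 i) f)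
  end.

Definition smooth_on (R : realType) (n : nat) (U : set 'rV[R]_n)
    (f : 'rV[R]_n -> R) : Prop :=
  forall k, Ck_on k U f.

(* The values of cfun outside cdom, and of cinv outside cfun @` cdom, are
   irrelevant. *)
Record chart (R : realType) (T : topologicalType) (n : nat) := Chart {
  cdom : set T;
  cfun : T -> 'rV[R]_n;
  cinv : 'rV[R]_n -> T;
  cdom_open : open cdom;
  cimg_open : open (cfun @` cdom);
  cfunK : forall x, cdom x -> cinv (cfun x) = x;
  cfun_continuous : {within cdom, continuous cfun};
  cinv_continuous : {within cfun @` cdom, continuous cinv} }.

Definition cimg (R : realType) (T : topologicalType) (n : nat)
  (c : chart R T n) : set 'rV[R]_n := cfun c @` cdom c.

Definition transition (R : realType) (T : topologicalType) (n : nat)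
  (c d : chart R T n) : 'rV[R]_n -> 'rV[R]_n := cfun d \o cinv c.

Definition smooth_transition (R : realType) (T : topologicalType) (n : nat)
    (c d : chart R T n) : Prop :=
  forall i, smooth_on (cfun c @` (cdom c `&` cdom d))
                      (fun z => transition c d z 0 i).

Record manifold (R : realType) (n : nat) := Manifold {
  mcarrier :> ptopologicalType;
  manifold_hausdorff : hausdorff_space mcarrier;
  manifold_second_countable : @second_countable mcarrier;
  atlas : set (chart R mcarrier n);
  atlas_cover : forall x, exists2 c, atlas c & cdom c x;
  atlas_smooth : forall c d, atlas c -> atlas d -> smooth_transition c d }.

(* The charts of the maximal atlas. *)
Definition smooth_chart (R : realType) (n : nat) (M : manifold R n)
    (c : chart R M n) : Prop :=
  forall d, atlas d -> smooth_transition c d /\ smooth_transition d c.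

(* A metric is given by its Gram matrices in the smooth charts.  Tangent
   vectors are row vectors, so that a coordinate change maps v to v *m J. *)
Record riemannian_metric (R : realType) (n : nat) (M : manifold R n) :=
  RiemannianMetric {
  gram :> chart R M n -> 'rV[R]_n -> 'M[R]_n;
  gram_smooth : forall c i j, smooth_chart c ->
    smooth_on (cimg c) (fun z => gram c z i j);
  gram_sym : forall c z, smooth_chart c -> cimg c z ->
    (gram c z)^T = gram c z;
  gram_pos : forall c z (v : 'rV[R]_n), smooth_chart c -> cimg c z ->
    v != 0 -> 0 < (v *m gram c z *m v^T) 0 0;
  gram_transition : forall c d x, smooth_chart c -> smooth_chart d ->
    cdom c x -> cdom d x ->
    let J := jacobian (transition c d) (cfun c x) in
    gram c (cfun c x) = J *m gram d (cfun d x) *m J^T }.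

(* In a foliated chart the plaques are the connected components of the level
   sets of the last coordinate. *)
Definition transverse (R : realType) (T : topologicalType) (n : nat)
  (c : chart R T n.+1) (x : T) : R := cfun c x 0 ord_max.

(* fcharts_plaque: near each point the coordinate changes have the form
   (u, t) |-> (h1 (u, t), h2 t). *)
Record foliation1 (R : realType) (n : nat) (M : manifold R n.+1) :=
  Foliation1 {
  fcharts : set (chart R M n.+1);
  fcharts_smooth : forall c, fcharts c -> smooth_chart c;
  fcharts_cover : forall x, exists2 c, fcharts c & cdom c x;
  fcharts_plaque : forall c d x, fcharts c -> fcharts d ->
    cdom c x -> cdom d x ->
    exists2 V : set M, nbhs x V &
      forall y z, V y -> V z ->
        transverse c y = transverse c z -> transverse d y = transverse d z }.

Section Leaves.
Context (R : realType) (n : nat) (M : manifold R n.+1).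
Context (F : foliation1 M) (g : riemannian_metric M).

Definition C1_curve (gamma : R -> 'rV[R]_n.+1) : Prop :=
  (forall s, derivable gamma s 1) /\ continuous (derive1 gamma).

(* [leaf_arc x y l]: a C^1 arc of length l from x to y in a plaque of one
   foliated chart.  A C^1 curve on [0, 1] extends to R; only its restriction
   to [0, 1] is used. *)
Definition leaf_arc (x y : M) (l : R) : Prop :=
  exists (c : chart R M n.+1) (gamma : R -> 'rV[R]_n.+1),
    [/\ fcharts F c /\ C1_curve gamma,
        forall s, `[0, 1]%classic s ->
          cimg c (gamma s) /\ gamma s 0 ord_max = gamma 0 0 ord_max,
        x = cinv c (gamma 0),
        y = cinv c (gamma 1) &
        l = \int[lebesgue_measure]_(s in `[0, 1])
              Num.sqrt
                ((derive1 gamma s *m g c (gamma s) *m (derive1 gamma s)^T) 0 0)].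

(* Piecewise C^1 curves in a leaf, with their lengths. *)
Inductive leaf_path : M -> M -> R -> Prop :=
| leaf_path_nil x : leaf_path x x 0
| leaf_path_cons x y z l l' :
    leaf_arc x y l -> leaf_path y z l' -> leaf_path x z (l + l').

Definition leaf (x : M) : set M := [set y | exists l, leaf_path x y l].

(* Distance of the metric induced on the leaf; +oo between distinct leaves. *)
Definition leaf_dist (x y : M) : \bar R :=
  ereal_inf [set l%:E | l in [set l | leaf_path x y l]].

Definition leaf_ball (x : M) (r : R) : set M :=
  [set y | (leaf_dist x y < r%:E)%E].

End Leaves.

Notation borel T := (g_sigma_algebraType (@open T)).

Section LengthAverage.
Context (R : realType) (M : manifold R 3).
Context (F : foliation1 M) (g : riemannian_metric M).

Definition coord3 (u : R * R) (t : R) : 'rV[R]_3 :=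
  \row_i [:: u.1; u.2; t]`_i.

(* Density of the induced Riemannian area: the induced metric on a plaque is
   the upper left 2 x 2 block of the Gram matrix. *)
Definition leaf_density (c : chart R M 3) (z : 'rV[R]_3) : R :=
  Num.sqrt (\det (row' ord_max (col' ord_max (g c z)))).

(* The Riemannian volume of the leaf through x, as a Borel measure on M carried
   by that leaf.  The leaf meets a foliated chart in countably many plaques,
   hence the sum over the transverse coordinate t.  Since countably many
   foliated charts cover M, these identities determine mu. *)
Definition is_leaf_volume (x : M) (mu : {measure set (borel M) -> \bar R}) :
    Prop :=
  forall (c : chart R M 3) (A : set (borel M)), fcharts F c -> measurable A ->
    A `<=` cdom c ->
    mu A = \esum_(t in [set: R])
      (\int[(lebesgue_measure \x lebesgue_measure)%E]_(u in
          [set u | cimg c (coord3 u t) /\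
                   (A `&` leaf F g x) (cinv c (coord3 u t))])
        (leaf_density c (coord3 u t))%:E)%E.

Definition ball_average (mu : {measure set (borel M) -> \bar R})
    (phi : M -> R) (x : M) (r : R) : R :=
  (\int[mu]_(y in leaf_ball F g x r) phi y) / fine (mu (leaf_ball F g x r)).

Definition length_average (mu : {measure set (borel M) -> \bar R})
    (phi : M -> R) (x : M) (l : R) : Prop :=
  ball_average mu phi x r @[r --> +oo] --> l.

End LengthAverage.

(* Main.v *)
Require Import Defs.
From HB Require Import structures.
From mathcomp Require Import all_boot all_order all_algebra.
From mathcomp Require Import all_classical all_reals all_analysis.
From mathcomp Require Import measurable_realfun.
From mathcomp Require Import ring lra zify.

(** The manifold is a Sol manifold. Let [lam] be a large quadratic unit with
    conjugate [lam^-1]. On the half space of the points [(x, w, y)] with [w > 0],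
    the maps [(x, w, y) |-> (lam^k x + a, lam^-k w, lam^-k y + b)], where [a] and
    [b] are the two conjugates of an element of the ring generated by [lam], form
    a group which acts freely, properly discontinuously and with compact quotient
    ([sol_compact], [sol_hausdorff]). It preserves the planes [y = t], which gives
    the foliation, and the metric [w^2 dx^2 + w^-2 (dw^2 + dy^2)]. On each plane
    this metric is the hyperbolic metric [w^2 dx^2 + w^-2 dw^2], with area
    element [dx dw].

    The ball of radius [r] around [(x0, w0)] in a plane reaches the height
    [w0 e^r], up to a constant factor, and contains a rectangle of area
    [e^r / 4] at heights comparable with this; the part of the ball below the
    fraction [c] of that height has an area of the order of [sqrt c e^r]. Hence on
    most of the ball [ln w] is equal to [r + ln w0] up to a constant that depends
    neither on the point nor on [lam] ([leaf_ball_window]).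

    The function [cos (2 pi ln w / ln lam)] is invariant under the group, hence a
    continuous function on the quotient. If [lam] is large, the constant above is a
    small part of the period [ln lam], and the average over the ball has the sign
    of [cos (2 pi (r + ln w0) / ln lam)] when this is [1] or [-1]: it is at least
    [1 / 8] for arbitrarily large radii and at most [- 1 / 8] for others
    ([average_ge], [average_le]). So there is no limit at any point of the
    manifold.

    A leaf in the quotient is a plane or a quotient of it. Its volume is the sum of
    the areas of the parts of the planes [y = t] that lie over it in a fundamental
    domain, and it does not depend on the fundamental domain ([sliced_area_le]).
    The inclusion of the leaf ball in a hyperbolic ball is proved without
    geodesics: [ln cosh] of the hyperbolic distance does not increase faster than
    the length of a curve ([ln_hcosh_curve]). Horizontal and vertical paths give
    all the points of the leaf ball that are needed ([leaf_path_exists]). *)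

Set Implicit Arguments.
Unset Strict Implicit.
Unset Printing Implicit Defensive.
Import Order.TTheory GRing.Theory Num.Theory.
Import numFieldNormedType.Exports.
Local Open Scope classical_set_scope.
Local Open Scope ring_scope.

(** * Continuously differentiable functions of several variables *)

Section PartialDerivatives.
Context {R : realType}.

Lemma derivable_line n (f : 'rV[R]_n -> R) (z v : 'rV[R]_n) (s : R) :
  derivable f (s *: v + z) v ->
  is_derive s 1 (fun h => f (h *: v + z)) ('D_v f (s *: v + z)).
Proof.
move=> df.
have E : (fun h : R => h^-1 *: (f ((h *: 1 + s) *: v + z) - f (s *: v + z))) =
         (fun h => h^-1 *: (f (h *: v + (s *: v + z)) - f (s *: v + z))).
  by apply/funext => h; rewrite [h *: 1]mulr1 scalerDl addrA.
by split; [rewrite /derivable /= E | rewrite /derive /= E].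
Qed.

Lemma mean_value_line n (f : 'rV[R]_n -> R) (z v : 'rV[R]_n) (t : R) :
  (forall s, `|s| <= `|t| -> derivable f (s *: v + z) v) ->
  exists2 c, `|c| <= `|t| & f (t *: v + z) - f z = 'D_v f (c *: v + z) * t.
Proof.
move=> df; pose F h := f (h *: v + z).
have F0 : F 0 = f z by rewrite /F scale0r add0r.
have dF (s : R) : `|s| <= `|t| -> is_derive s (1 : R) (F : R -> R) ('D_v f (s *: v + z)).
  by move=> st; apply/derivable_line/df.
have cF (a b : R) : (forall s, s \in `[a, b] -> `|s| <= `|t|) ->
    {within `[a, b], continuous F}.
  by move=> ab; apply: derivable_within_continuous => s /ab/dF [].
have [t0|t0] := leP 0 t.
- have A s : s \in `[0, t] -> `|s| <= `|t|.
    by rewrite in_itv/= => /andP[? ?]; rewrite !ger0_norm.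
  have [||c c0 E] := @MVT_segment _ F (fun s => 'D_v f (s *: v + z)) 0 t t0.
  + by move=> s s0; apply/dF/A/subset_itv_oo_cc.
  + exact: cF.
  by exists c; [exact: A|rewrite -F0 -/(F t) E subr0].
- have A s : s \in `[t, 0] -> `|s| <= `|t|.
    by rewrite in_itv/= => /andP[? ?]; rewrite !ler0_norm ?lerN2 // ltW.
  have [||c c0 E] := @MVT_segment _ F (fun s => 'D_v f (s *: v + z)) t 0 (ltW t0).
  + by move=> s s0; apply/dF/A/subset_itv_oo_cc.
  + exact: cF.
  by exists c; [exact: A|rewrite -F0 -/(F t) -opprB E sub0r mulrN opprK].
Qed.

Lemma entry_le_norm n (h : 'rV[R]_n) i : `|h 0 i| <= `|h|.
Proof.
by rewrite [in leRHS]/Num.Def.normr/= mx_normrE (le_bigmax _ (fun x => `|h x.1 x.2|) (0, i)).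
Qed.

Lemma norm_le_entry n (h : 'rV[R]_n) e : 0 <= e ->
  (forall i, `|h 0 i| <= e) -> `|h| <= e.
Proof.
move=> e0 he; rewrite /Num.Def.normr/= mx_normrE.
by rewrite (bigmax_le _ e0)//= => -[i j] _ /=; rewrite (ord1 i).
Qed.

(** Interpolates between [0] and [h], changing one coordinate at a time. *)
Let trunc n (h : 'rV[R]_n) (k : nat) : 'rV[R]_n :=
  \row_j (if (j < k)%N then h 0 j else 0).

Let truncS n (h : 'rV[R]_n) (k : 'I_n) :
  trunc h k.+1 = h 0 k *: delta_mx 0 k + trunc h k.
Proof.
apply/rowP => j; rewrite !mxE eqxx/= ltnS leq_eqVlt.
by case: eqVneq => [/val_inj->|ne]; [rewrite eqxx ltnn mulr1 addr0
  | rewrite -val_eqE (negbTE ne) mulr0 add0r].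
Qed.

(** The increment from [z] to [z + h] is telescoped along the points
    [z + trunc h k]. Each step is parallel to a coordinate axis, where the mean
    value theorem and the continuity of the partial derivative at [z] leave an
    error that is small compared with [h]. *)
Lemma C1_differentiable n (f : 'rV[R]_n -> R) (z : 'rV[R]_n) :
  (forall i, \forall y \near z, derivable f y (delta_mx 0 i)) ->
  (forall i, {for z, continuous ('D_(delta_mx 0 i) f)}) ->
  differentiable f z.
Proof.
move=> df cf.
pose L := (fun h : 'rV[R]_n => \sum_i h 0 i *: 'D_(delta_mx 0 i) f z : R).
have linL : linear L.
  move=> a u v; rewrite /L scaler_sumr -big_split; apply: eq_bigr => i _ /=.
  by rewrite !mxE scalerDl scalerA.
pose LL := HB.pack_for {linear 'rV[R]_n -> R} L
  (GRing.isLinear.Build R 'rV[R]_n R *:%R L linL).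
have contL : continuous LL.
  move=> u; rewrite /LL/= /L; apply: differentiable_continuous.
  have -> : (fun h : 'rV[R]_n => \sum_i h 0 i *: 'D_(delta_mx 0 i) f z : R) =
    \sum_i (fun h : 'rV[R]_n => h 0 i *: 'D_(delta_mx 0 i) f z : R).
    by apply/funext => h; rewrite fct_sumE.
  apply: differentiable_sum => i.
  exact/differentiableZl/differentiable_coord.
pose W : normedModType R := R.
have LLE : (f \o shift z : 'rV[R]_n -> W) = (cst (f z) + LL : 'rV[R]_n -> W)
    +o_ (0 : 'rV[R]_n) (id : 'rV[R]_n -> 'rV[R]_n).
  apply/eqaddoP => _/posnumP[e].
  (* the error allowed to each of the [n] steps; [n] may be 0 *)
  have n0 : 0 < n.+1%:R :> R by rewrite ltr0n.
  have : \forall y \near z, forall i,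
      derivable f y (delta_mx 0 i) /\
      `|'D_(delta_mx 0 i) f z - 'D_(delta_mx 0 i) f y| < e%:num / n.+1%:R.
    apply: (@filter_forall _ 'I_n (fun i y => derivable f y (delta_mx 0 i) /\
      `|'D_(delta_mx 0 i) f z - 'D_(delta_mx 0 i) f y| < e%:num / n.+1%:R) (nbhs z) _) => i.
    apply: (filterI (df i)).
    by have /cvgrPdist_lt := cf i; apply; rewrite divr_gt0.
  rewrite near_nbhs => /nbhs_ballP[d /= d0 dP].
  near=> h.
  have hd : `|h| < d by near: h; apply: (@nbhs0_lt _ 'rV[R]_n).
  have near_z y : `|y| <= `|h| -> ball z d (y + z).
    move=> yh; rewrite mx_norm_ball /ball_ /= opprD addrCA subrr addr0 normrN.
    exact: le_lt_trans yh hd.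
  have incr (k : 'I_n) : `|f (trunc h k.+1 + z) - f (trunc h k + z)
      - h 0 k * 'D_(delta_mx 0 k) f z| <= `|h| * (e%:num / n.+1%:R).
    have hk s : `|s| <= `|h 0 k| -> `|s *: delta_mx 0 k + trunc h k| <= `|h|.
      move=> sk; apply: norm_le_entry => // i; rewrite !mxE eqxx/=.
      case: eqVneq => [->|ik]; first by rewrite ltnn mulr1 addr0 (le_trans sk) ?entry_le_norm.
      by rewrite mulr0 add0r; case: ifP => _; rewrite ?normr0 ?entry_le_norm.
    have [|c ck E] := @mean_value_line n f (trunc h k + z) (delta_mx 0 k) (h 0 k).
      by move=> s /hk sk; rewrite addrA; apply: (dP _ (near_z _ sk) k).1.
    rewrite truncS -(addrA (h 0 k *: _)) E addrA [X in `|X - _|]mulrC -mulrBr normrM ler_pM//.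
      exact: entry_le_norm.
    by rewrite distrC; apply/ltW/(dP _ (near_z _ (hk _ ck)) k).2.
  have tr0 : trunc h 0 = 0 by apply/rowP => j; rewrite !mxE.
  have trn : trunc h n = h by apply/rowP => j; rewrite !mxE ltn_ord.
  have E : f (h + z) - (f z + L h) =
     \sum_(k < n) (f (trunc h k.+1 + z) - f (trunc h k + z)
        - h 0 k * 'D_(delta_mx 0 k) f z).
    rewrite big_split /= sumrN -(big_mkord xpredT (fun k => f (trunc h k.+1 + z) - f (trunc h k + z))).
    by rewrite telescope_sumr// tr0 trn add0r -addrA -opprD.
  rewrite -[X in `|X| <= _]/(f (h + z) - (f z + L h)) E.
  apply: le_trans (ler_norm_sum _ _ _) _.
  apply: (@le_trans _ _ (\sum_(k < n) `|h| * (e%:num / n.+1%:R))).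
    by apply: ler_sum => k _; exact: incr.
  rewrite sumr_const card_ord -[_ *+ n]mulr_natr -mulrA [leRHS]mulrC ler_wpM2l//.
  rewrite -mulrA -[leRHS]mulr1 ler_wpM2l// mulrC ler_pdivrMr// mul1r ler_nat.
  exact: leqnSn.
have dE := diff_unique contL LLE.
by apply/diff_locallyP; rewrite dE; split.
Unshelve. all: by end_near. Qed.

Lemma differentiable_rowP n m (f : 'rV[R]_n -> 'rV[R]_m) (z : 'rV[R]_n) :
  (forall j, differentiable (fun y => f y 0 j) z) -> differentiable f z.
Proof.
move=> df.
have -> : f = \sum_j (fun y => f y 0 j *: (delta_mx 0 j : 'rV[R]_m)).
  by apply/funext => y; rewrite fct_sumE [LHS]row_sum_delta.
by apply: differentiable_sum => j; exact: differentiableZl.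
Qed.

Lemma jacobianE n m (f : 'rV[R]_n -> 'rV[R]_m) (z : 'rV[R]_n) i j :
  differentiable f z -> jacobian f z i j = 'D_(delta_mx 0 i) (fun y => f y 0 j) z.
Proof.
move=> df; have := deriveEjacobian (delta_mx 0 i) df.
rewrite derive_mx; last exact: diff_derivable.
move=> /(congr1 (fun M : 'rV_m => M 0 j)); rewrite mxE => ->.
by rewrite -rowE [RHS]mxE.
Qed.

Lemma derive_chain n m (f : 'rV[R]_n -> 'rV[R]_m) (h : 'rV[R]_m -> R) z (v : 'rV[R]_n) :
  differentiable f z -> differentiable h (f z) ->
  'D_v (h \o f) z =
  \sum_j 'D_v (fun y => f y 0 j) z * 'D_(delta_mx 0 j) h (f z).
Proof.
move=> df dh.
have E : 'd f z v = \row_j 'D_v (fun y => f y 0 j) z.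
  rewrite -deriveE// derive_mx; last exact: diff_derivable.
  by apply/rowP => j; rewrite !mxE.
rewrite deriveE; last exact: differentiable_comp.
rewrite diff_comp//= E [X in 'd h _ X]row_sum_delta linear_sum.
by apply: eq_bigr => j _ /=; rewrite linearZ mxE /= -deriveE.
Qed.

End PartialDerivatives.

(** * Calculus of C^k functions *)

Section SmoothFunctions.
Context {R : realType} {n : nat}.
Implicit Types (U W : set 'rV[R]_n) (f g : 'rV[R]_n -> R).

Lemma Ck_onS k U f : Ck_on k.+1 U f -> Ck_on k U f.
Proof.
elim: k f => [|k IH] f; first by case.
move=> [cf df]; split => // i; have [d1 d2] := df i.
by split => //; exact: IH.
Qed.

Lemma near_eq_continuous (f g : 'rV[R]_n -> R) z : (\forall y \near z, f y = g y) ->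
  {for z, continuous g} -> {for z, continuous f}.
Proof.
move=> fg cg; have E : f z = g z by exact: (nbhs_singleton fg).
have gf : \forall y \near z, g y = f y by apply: filterS fg => y ->.
have H : f y @[y --> z] --> g z.
  by apply: cvg_trans cg; exact: (near_eq_cvg gf).
by move: H; rewrite -E.
Qed.

(** Continuity and derivatives at a point depend only on the germ of the
    function. This reduces the smoothness of changes of charts, which are only
    locally given by formulas, to that of explicit maps. *)
Lemma Ck_on_local k U f :
  (forall z, U z -> exists W g, [/\ open W, W z, Ck_on k W g &
     forall y, W y -> f y = g y]) -> Ck_on k U f.
Proof.
elim: k U f => [|k IH] U f loc.
  split=> // z Uz; have [W [g [oW Wz [cg _] fg]]] := loc z Uz.
  apply: near_eq_continuous (cg z Wz).
  by apply: filterS (open_nbhs_nbhs (conj oW Wz)) => y /fg.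
split=> [z Uz|i].
  have [W [g [oW Wz [cg _] fg]]] := loc z Uz.
  apply: near_eq_continuous (cg z Wz).
  by apply: filterS (open_nbhs_nbhs (conj oW Wz)) => y /fg.
split=> [z Uz|].
  have [W [g [oW Wz [_ dg] fg]]] := loc z Uz.
  apply: near_eq_derivable ((dg i).1 z Wz).
  by apply: filterS (open_nbhs_nbhs (conj oW Wz)) => y /fg.
apply: IH => z Uz; have [W [g [oW Wz [_ dg] fg]]] := loc z Uz.
exists W, ('D_(delta_mx 0 i) g); split => //; first exact: (dg i).2.
move=> y Wy; apply: near_eq_derive.
by apply: filterS (open_nbhs_nbhs (conj oW Wy)) => y' /fg.
Qed.

Lemma Ck_on_eq k U f g : open U -> (forall y, U y -> f y = g y) ->
  Ck_on k U g -> Ck_on k U f.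
Proof. by move=> oU fg cg; apply: Ck_on_local => z Uz; exists U, g; split. Qed.

Lemma Ck_on_cst k U (c : R) : Ck_on k U (fun=> c).
Proof.
elim: k c => [|k IH] c; split => //; try by move=> z _; exact: cst_continuous.
move=> i; split; first by move=> z _; have [] := is_derive_cst c z (delta_mx 0 i).
have -> : 'D_(delta_mx 0 i) (fun=> c) = (fun=> 0) :> ('rV[R]_n -> R).
  by apply/funext => z; exact: derive_cst.
exact: IH.
Qed.

Lemma is_derive_coord (z v : 'rV[R]_n) i : is_derive z v (fun y => y 0 i) (v 0 i).
Proof.
have D : differentiable (fun y : 'rV[R]_n => y 0 i) z by exact: differentiable_coord.
split; first exact: diff_derivable.
rewrite /derive; apply: cvg_lim => //.
apply: (@cvg_trans _ ((fun h : R => v 0 i) @ 0^')); last exact: cvg_cst.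
apply: near_eq_cvg; near=> h; rewrite /= !mxE addrK.
rewrite [RHS]mulrA mulVf ?mul1r//; near: h; exact: nbhs_dnbhs_neq.
Unshelve. all: by end_near. Qed.

Lemma is_derive_affine (a c : R) i (z v : 'rV[R]_n) :
  is_derive z v (fun y : 'rV[R]_n => a * y 0 i + c) (a * v 0 i).
Proof.
have [dc Ec] := is_derive_coord z v i.
have dac : derivable (a \*: (fun y : 'rV[R]_n => y 0 i)) z v by exact: derivableZ.
have dk : derivable (cst c : 'rV[R]_n -> R) z v by have [] := is_derive_cst c z v.
have -> : (fun y : 'rV[R]_n => a * y 0 i + c) =
  (a \*: (fun y : 'rV[R]_n => y 0 i)) + cst c by [].
split; first exact: derivableD.
by rewrite deriveD// deriveZ// Ec derive_cst addr0.
Qed.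

Lemma Ck_on_affine k U (a c : R) i : Ck_on k U (fun y => a * y 0 i + c).
Proof.
have cA z : {for z, continuous (fun y : 'rV[R]_n => a * y 0 i + c)}.
  apply: continuousD; last exact: cst_continuous.
  by apply: continuousM; [exact: cst_continuous|exact: coord_continuous].
case: k => [|k]; split => //.
move=> j; split; first by move=> z _; have [] := is_derive_affine a c i z (delta_mx 0 j).
have -> : 'D_(delta_mx 0 j) (fun y : 'rV[R]_n => a * y 0 i + c) =
    (fun=> a * (delta_mx 0 j : 'rV[R]_n) 0 i).
  by apply/funext => z; have [] := is_derive_affine a c i z (delta_mx 0 j).
exact: Ck_on_cst.
Qed.

Lemma Ck_onD k U f g : open U -> Ck_on k U f -> Ck_on k U g ->
  Ck_on k U (f \+ g).
Proof.
move=> oU; elim: k f g => [|k IH] f g [cf df] [cg dg]; split => //;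
  try by move=> z Uz; apply: continuousD; [exact: cf|exact: cg].
move=> i; have [f1 f2] := df i; have [g1 g2] := dg i; split.
  by move=> z Uz; apply: derivableD; [exact: f1|exact: g1].
apply: Ck_on_eq (IH _ _ f2 g2) => // z Uz.
by rewrite deriveD//; [exact: f1|exact: g1].
Qed.

Lemma Ck_onM k U f g : open U -> Ck_on k U f -> Ck_on k U g ->
  Ck_on k U (f \* g).
Proof.
move=> oU; elim: k f g => [|k IH] f g cf' cg'; have [cf df] := cf'; have [cg dg] := cg';
  split => //; try by move=> z Uz; apply: continuousM; [exact: cf|exact: cg].
move=> i; have [f1 f2] := df i; have [g1 g2] := dg i; split.
  by move=> z Uz; apply: derivableM; [exact: f1|exact: g1].
have := Ck_onD oU (IH _ _ (Ck_onS cf') g2) (IH _ _ (Ck_onS cg') f2).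
apply: Ck_on_eq => // z Uz.
by rewrite deriveM//; [exact: f1|exact: g1].
Qed.

Lemma Ck_onV k U f : open U -> (forall z, U z -> f z != 0) -> Ck_on k U f ->
  Ck_on k U (fun z => (f z)^-1).
Proof.
move=> oU f0; elim: k => [|k IH] cf'; have [cf df] := cf';
  split => //; try by move=> z Uz; apply: continuousV; [exact: f0|exact: cf].
move=> i; have [f1 f2] := df i; split.
  by move=> z Uz; apply: derivableV; [exact: f0|exact: f1].
have I := IH (Ck_onS cf').
have := Ck_onM oU (Ck_on_cst k U (-1)) (Ck_onM oU (Ck_onM oU I I) f2).
apply: Ck_on_eq => // z Uz /=.
rewrite deriveV; [|exact: f0|exact: f1].
by rewrite mulN1r scaleNr; congr (- (_ * _)); rewrite -exprVn expr2.
Qed.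

Lemma Ck_on_sum k U m (F : 'I_m -> 'rV[R]_n -> R) : open U ->
  (forall j, Ck_on k U (F j)) -> Ck_on k U (fun z => \sum_j F j z).
Proof.
move=> oU; elim: m F => [|m IH] F cF.
  by apply: Ck_on_eq (Ck_on_cst k U 0) => // z _; rewrite big_ord0.
apply: Ck_on_eq (Ck_onD oU (cF ord0) (IH (fun j => F (lift ord0 j)) _)) => //.
by move=> z _; rewrite big_ord_recl.
Qed.

Lemma Ck_on_derive U f i : smooth_on U f -> smooth_on U ('D_(delta_mx 0 i) f).
Proof. by move=> sf k; have [_ df] := sf k.+1; exact: (df i).2. Qed.

Lemma smooth_on_differentiable U f z : open U -> U z -> smooth_on U f ->
  differentiable f z.
Proof.
move=> oU Uz sf; have [cf df] := sf 1; apply: C1_differentiable => i.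
  by apply: filterS (open_nbhs_nbhs (conj oU Uz)) => y Uy; exact: (df i).1.
by have [_ [cdf _]] := df i; exact: cdf.
Qed.

End SmoothFunctions.

(** * A quadratic unit and the deck group *)

Section QuadraticUnit.
Context {R : realType} (n : nat).

(** The trace of the unit. It is odd for the sake of the descent in
    [int_form_eq0], at least 5 so that [lam >= 4], and unbounded in [n] because the
    oscillating function needs a unit as large as desired. *)
Definition utrace : nat := (n.*2 + 5)%N.

Local Notation N := (utrace%:R : R).

Lemma utrace_ge5 : 5 <= N.
Proof. by rewrite /utrace ler_nat leq_addl. Qed.

Lemma lam_exists : {l : R | N - 1 <= l & l ^+ 2 = N * l - 1}.
Proof.
have N5 := utrace_ge5; exists ((N + Num.sqrt (N ^+ 2 - 4)) / 2).
  have H : N - 2 <= Num.sqrt (N ^+ 2 - 4).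
    rewrite -[leLHS]ger0_norm; last by lra.
    rewrite -sqrtr_sqr ler_wsqrtr// !expr2; nra.
  lra.
have H : Num.sqrt (N ^+ 2 - 4) ^+ 2 = N ^+ 2 - 4.
  by rewrite sqr_sqrtr// expr2; nra.
by move: H; set s := Num.sqrt _ => H; rewrite !expr2 in H *; lra.
Qed.

(** The larger root of [X^2 - utrace X + 1]; the other root is its inverse. *)
Definition lam : R := s2val lam_exists.

Lemma lam_geN : N - 1 <= lam.
Proof. exact: s2valP lam_exists. Qed.

Lemma lam_sqr : lam ^+ 2 = N * lam - 1.
Proof. exact: s2valP' lam_exists. Qed.

Lemma lam_ge4 : 4 <= lam.
Proof. by apply: le_trans lam_geN; have := utrace_ge5; lra. Qed.

Lemma lam_gt0 : 0 < lam.
Proof. by have := lam_ge4; lra. Qed.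

Lemma ln_lam_gt0 : 0 < ln lam.
Proof. by apply: ln_gt0; have := lam_ge4; lra. Qed.

Lemma ln_lamX (k : int) : ln (lam ^ k) = k%:~R * ln lam.
Proof.
case: k => m; first by rewrite -exprnP lnXn ?lam_gt0// -mulr_natl -pmulrn.
rewrite NegzE -invr_expz lnV ?posrE ?exprz_gt0 ?lam_gt0// -exprnP lnXn ?lam_gt0//.
by rewrite rmorphN/= mulNr -pmulrn mulr_natl.
Qed.

Lemma lam_neq0 : lam != 0.
Proof. exact: lt0r_neq0 lam_gt0. Qed.

Lemma lamV : lam^-1 = N - lam.
Proof.
apply: (mulfI lam_neq0); rewrite mulfV ?lam_neq0//.
by rewrite mulrBr -expr2 lam_sqr mulrC opprB addrCA subrr addr0.
Qed.

Lemma lamV_lt : lam^-1 < lam.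
Proof.
apply: (@lt_le_trans _ _ 1); last by have := lam_ge4; lra.
by rewrite invf_lt1 ?lam_gt0//; have := lam_ge4; lra.
Qed.

(** The triple [(k, m, m')] encodes the transformation
    [(x, w, y) |-> (lam^k x + a, lam^-k w, lam^-k y + b)], where [a] and [b] are
    the conjugates [m + m' lam] and [m + m' lam^-1]. The triples are only used
    through these maps, so that the group laws are stated as the existence of a
    triple with the required effect. *)
Definition deck : Type := (int * int * int)%type.

(** The two real embeddings of the ring generated by the unit. *)
Definition lat1 (p : int * int) : R := p.1%:~R + p.2%:~R * lam.
Definition lat2 (p : int * int) : R := p.1%:~R + p.2%:~R * lam^-1.

Definition dscale (g : deck) : R := lam ^ g.1.1.
Definition dvec (g : deck) : int * int := (g.1.2, g.2).

Lemma dscale_gt0 g : 0 < dscale g.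
Proof. exact/exprz_gt0/lam_gt0. Qed.

Lemma dscale_neq0 g : dscale g != 0.
Proof. exact/lt0r_neq0/dscale_gt0. Qed.

(** The ring is stable under multiplication by the unit and its inverse, whose
    conjugates are inverse to each other. *)
Lemma lat_unit (k : int) p : exists q,
  lat1 q = lam ^ k * lat1 p /\ lat2 q = (lam ^ k)^-1 * lat2 p.
Proof.
have l0 := lam_neq0; have l1 := lam_sqr; have l2 := lamV.
have mul_root (l a b : R) : l ^+ 2 = N * l - 1 ->
    - b + (a + N * b) * l = l * (a + b * l).
  by move=> H; rewrite mulrDr mulrCA -expr2 H; ring.
have root2 : lam^-1 ^+ 2 = N * lam^-1 - 1.
  by rewrite expr2 {1}l2 mulrBl mulfV.
have up p' : exists q, lat1 q = lam * lat1 p' /\ lat2 q = lam^-1 * lat2 p'.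
  exists (- p'.2, p'.1 + utrace%:Z * p'.2).
  rewrite /lat1 /lat2/= !rmorphN/= rmorphD rmorphM/= -pmulrn.
  by rewrite !mul_root.
have div_root (l l' a b : R) : l' = N - l -> l * l' = 1 ->
    N * a + b + - a * l = l' * (a + b * l).
  by move=> E H; rewrite mulrDr mulrCA [l' * l]mulrC H E; ring.
have down p' : exists q, lat1 q = lam^-1 * lat1 p' /\ lat2 q = lam * lat2 p'.
  exists (utrace%:Z * p'.1 + p'.2, - p'.1).
  rewrite /lat1 /lat2/= !rmorphN/= rmorphD rmorphM/= -pmulrn.
  split; apply: div_root; rewrite ?mulfV ?mulVf ?invr_eq0//.
  by rewrite lamV opprB addrCA subrr addr0.
have upn m p' : exists q, lat1 q = lam ^+ m * lat1 p' /\ lat2 q = (lam ^+ m)^-1 * lat2 p'.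
  elim: m => [|m [q [q1 q2]]]; first by exists p'; rewrite expr0 invr1 !mul1r.
  have [q' [E1 E2]] := up q; exists q'.
  by rewrite E1 E2 q1 q2 !mulrA exprS (invfM lam).
have downn m p' : exists q, lat1 q = (lam ^+ m)^-1 * lat1 p' /\ lat2 q = lam ^+ m * lat2 p'.
  elim: m => [|m [q [q1 q2]]]; first by exists p'; rewrite expr0 invr1 !mul1r.
  have [q' [E1 E2]] := down q; exists q'.
  by rewrite E1 E2 q1 q2 !mulrA exprS (invfM lam).
case: k => k; first exact: upn.
have [q [q1 q2]] := downn k.+1 p; exists q.
by rewrite q1 q2 /exprz invrK.
Qed.

Lemma dscale_eq1 g : lam^-1 < dscale g < lam -> g.1.1 = 0.
Proof.
move=> /andP[h1 h2]; have l1 : 1 < lam by have := lam_ge4; lra.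
have k1 : g.1.1 < 1 by move: h2; rewrite /dscale -{2}[lam]expr1z ltr_eXz2l.
have k2 : -1 < g.1.1 by move: h1; rewrite /dscale -[lam^-1]exprN1 ltr_eXz2l.
lia.
Qed.

(** The form is the norm of [a + b lam]. Modulo 2 it is [a^2 + ab + b^2], which
    vanishes only if [a] and [b] are even; halving them gives a descent. *)
Lemma int_form_eq0 (a b : int) :
  a * a + utrace%:Z * a * b + b * b = 0 -> a = 0 /\ b = 0.
Proof.
have -> : utrace%:Z = 2 * n%:Z + 5 by rewrite /utrace; lia.
have [k] := ubnP (absz a + absz b); elim: k a b => // k IH a b abk Q.
have [a' [r [Ea r01]]] : exists a' r : int, a = 2 * a' + r /\ (r = 0 \/ r = 1).
  by exists (a %/ 2)%Z, (a %% 2)%Z; lia.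
have [b' [t [Eb t01]]] : exists b' t : int, b = 2 * b' + t /\ (t = 0 \/ t = 1).
  by exists (b %/ 2)%Z, (b %% 2)%Z; lia.
have [r0 t0] : r = 0 /\ t = 0.
  by move: Q; rewrite Ea Eb; case: r01 => ->; case: t01 => ->; lia.
have Q' : a' * a' + (2 * n%:Z + 5) * a' * b' + b' * b' = 0.
  by move: Q; rewrite Ea Eb r0 t0; lia.
have [/eqP ab0|ab0] := eqVneq (absz a + absz b)%N 0; first lia.
by have [] := IH a' b' _ Q'; lia.
Qed.

(** The product of the conjugates is the norm, an integer which vanishes
    only at 0. *)
Lemma lat_norm_ge1 (p : int * int) : p != 0 -> 1 <= `|lat1 p * lat2 p|.
Proof.
move=> p0.
have -> : lat1 p * lat2 p = (p.1 * p.1 + utrace%:Z * p.1 * p.2 + p.2 * p.2)%:~R.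
  rewrite /lat1 /lat2 !rmorphD !rmorphM/= -pmulrn.
  have -> : N = lam + lam^-1 by rewrite lamV addrC subrK.
  transitivity (p.1%:~R * p.1%:~R + (lam + lam^-1) * p.1%:~R * p.2%:~R +
    p.2%:~R * p.2%:~R * (lam * lam^-1)); first by ring.
  by rewrite mulfV ?lam_neq0// mulr1.
rewrite -intr_norm -[leLHS]/(1%:~R) ler_int -gtz0_ge1 normr_gt0.
by apply: contra_neq p0 => /int_form_eq0; case: p => a b/= [-> ->].
Qed.

Lemma lat_eq0 p : lat1 p * lat2 p = 0 -> p = 0.
Proof.
move=> p0; apply/eqP; apply/negP => /negP/lat_norm_ge1.
by rewrite p0 normr0 ler10.
Qed.

(** No lattice vector but 0 fits in a rectangle of small area, however elongated.
    The injectivity of the projection on boxes, whatever their width, rests on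
    this. *)
Lemma lat_bounded p X : 0 < X -> `|lat1 p| < X -> `|lat2 p| <= X^-1 -> p = 0.
Proof.
move=> X0 p1 p2; apply/eqP; apply/negP => /negP/lat_norm_ge1.
apply/negP; rewrite -ltNge normrM.
have [E|p2_neq0] := eqVneq (lat2 p) 0; first by rewrite E normr0 mulr0.
apply: (@lt_le_trans _ _ (X * `|lat2 p|)); first by rewrite ltr_pM2r// normr_gt0.
by rewrite -[leRHS](@mulfV _ X) ?gt_eqF// ler_pM2l.
Qed.

(** The action on the coordinates [u = (x, w)] along the leaves and the action on
    the transverse coordinate [y] are kept apart: the leaves are the planes
    [y = t], and areas are computed one plane at a time. *)
Definition actu (g : deck) (u : R * R) : R * R :=
  (dscale g * u.1 + lat1 (dvec g), (dscale g)^-1 * u.2).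
Definition acty (g : deck) (t : R) : R := (dscale g)^-1 * t + lat2 (dvec g).

Lemma actu_gt0 g u : 0 < u.2 -> 0 < (actu g u).2.
Proof. by move=> u0; rewrite /actu/= mulr_gt0// invr_gt0 dscale_gt0. Qed.

Lemma deck_id : exists g, (forall u, actu g u = u) /\ (forall t, acty g t = t).
Proof.
exists (0, 0, 0); rewrite /actu /acty /dscale /lat1 /lat2/= expr0z invr1.
by split=> [[x w]|t]/=; rewrite !mul1r mul0r !addr0.
Qed.

Lemma deck_comp g h : exists k, (forall u, actu k u = actu g (actu h u)) /\
  (forall t, acty k t = acty g (acty h t)).
Proof.
have [q [q1 q2]] := lat_unit g.1.1 (dvec h).
pose k : deck := (g.1.1 + h.1.1, (dvec g).1 + q.1, (dvec g).2 + q.2).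
have Ek : dscale k = dscale g * dscale h by rewrite /dscale expfzDr ?lam_neq0.
have E1 : lat1 (dvec k) = lat1 (dvec g) + lat1 q by rewrite /lat1 !rmorphD/=; ring.
have E2 : lat2 (dvec k) = lat2 (dvec g) + lat2 q by rewrite /lat2 !rmorphD/=; ring.
exists k; rewrite /actu /acty/= Ek E1 E2 q1 q2 (invfM (dscale g)) -/(dscale g).
move: (dscale g) (dscale h) => m m'.
by split=> [u|t]; [congr pair|]; ring.
Qed.

Lemma deck_inv g : exists h, [/\ forall u, actu h (actu g u) = u,
  forall t, acty h (acty g t) = t, forall u, actu g (actu h u) = u &
  forall t, acty g (acty h t) = t].
Proof.
have [q [q1 q2]] := lat_unit (- g.1.1) (dvec g).
pose k : deck := (- g.1.1, - q.1, - q.2).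
have g0 := dscale_neq0 g.
have Ek : dscale k = (dscale g)^-1 by rewrite /dscale /= invr_expz.
have E1 : lat1 (dvec k) = - lat1 q by rewrite /lat1 /= !rmorphN/=; ring.
have E2 : lat2 (dvec k) = - lat2 q by rewrite /lat2 /= !rmorphN/=; ring.
have Eg : lam ^ (- g.1.1) = (dscale g)^-1 by rewrite -Ek.
exists k; rewrite /actu /acty/= Ek E1 E2 q1 q2 Eg invrK.
move: (dscale g) g0 => m m0.
by split=> [[x w]|t|[x w]|t]/=; [congr pair| |congr pair|]; field.
Qed.

(** The height [u.2 > 0] determines the power of the unit, and then the lattice
    vector is determined by one of its conjugates. *)
Lemma deck_free g h u t : 0 < u.2 -> actu g u = actu h u -> acty g t = acty h t -> g = h.
Proof.
rewrite /actu /acty => u0 [E1 E2] E3.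
have /invr_inj Es : (dscale g)^-1 = (dscale h)^-1 by apply: (mulIf (lt0r_neq0 u0)).
move: E1 E3; rewrite Es => /addrI E1 /addrI E3.
have E : g.1.1 = h.1.1.
  have l1 : 1 < lam by have := lam_ge4; lra.
  by apply: (@ieexprIz _ lam); rewrite ?lam_gt0 ?gt_eqF.
pose p := ((dvec g).1 - (dvec h).1, (dvec g).2 - (dvec h).2).
have /eqP : p = 0.
  apply: lat_eq0; rewrite (_ : lat1 p = 0) ?mul0r//.
  rewrite /lat1 /= !rmorphB/= mulrBl.
  by move: E1; rewrite /lat1; lra.
rewrite /p xpair_eqE !subr_eq0 => /andP[/eqP e1 /eqP e2].
by case: g h E e1 e2 {Es E1 E2 E3 p} => [[k a] b] [[k' a'] b'] /= -> -> ->.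
Qed.

End QuadraticUnit.

(** * The half space and a fundamental domain *)

Section HalfSpace.
Context {R : realType} (n : nat).
Local Notation lam := (@lam R n).
Local Notation V := 'rV[R]_3.

Definition leafc (z : V) : R * R := (z 0 0, z 0 1).
Definition ycoord (z : V) : R := z 0 ord_max.

Arguments ycoord : simpl never.

Lemma coord3K (z : V) : coord3 (leafc z) (ycoord z) = z.
Proof.
apply/rowP => i; rewrite mxE /leafc /ycoord.
by case: i => [[|[|[|i]]] Hi] //=; congr (z _ _); apply/val_inj.
Qed.

Lemma leafc_coord3 u t : leafc (coord3 u t) = u.
Proof. by case: u => x w; rewrite /leafc !mxE. Qed.

Lemma ycoord_coord3 u t : ycoord (coord3 u t) = t.
Proof. by rewrite /ycoord !mxE. Qed.

Definition half : set V := [set z : V | 0 < z 0 1].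

Definition act (g : deck) (z : V) : V :=
  coord3 (actu n g (leafc z)) (acty n g (ycoord z)).

Lemma leafc_act g z : leafc (act g z) = actu n g (leafc z).
Proof. exact: leafc_coord3. Qed.

Lemma act_x g z : act g z 0 0 = dscale n g * z 0 0 + lat1 n (dvec g).
Proof. by have /(congr1 fst) := leafc_act g z. Qed.

Lemma act_w g z : act g z 0 1 = (dscale n g)^-1 * z 0 1.
Proof. by have /(congr1 snd) := leafc_act g z. Qed.

Lemma ycoord_act g z : ycoord (act g z) = acty n g (ycoord z).
Proof. exact: ycoord_coord3. Qed.

Lemma act_half g z : half z -> half (act g z).
Proof. by move=> hz; rewrite /half/= act_w mulr_gt0// invr_gt0 dscale_gt0. Qed.

Lemma act_id : exists g, forall z, act g z = z.
Proof.
have [g [E1 E2]] := @deck_id R n; exists g => z.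
by rewrite /act E1 E2 coord3K.
Qed.

Lemma act_comp g h : exists k, forall z, act k z = act g (act h z).
Proof.
have [k [E1 E2]] := @deck_comp R n g h; exists k => z.
by rewrite /act E1 E2 leafc_coord3 ycoord_coord3.
Qed.

Lemma act_inv g : exists h, (forall z, act h (act g z) = z) /\
  (forall z, act g (act h z) = z).
Proof.
have [h [E1 E2 E3 E4]] := @deck_inv R n g; exists h.
by split=> z; rewrite /act leafc_coord3 ycoord_coord3 ?E1 ?E2 ?E3 ?E4 coord3K.
Qed.

Lemma act_free g h z : half z -> act g z = act h z -> g = h.
Proof.
move=> hz E; apply: (@deck_free R n g h (leafc z) (ycoord z)) => //.
  by rewrite -!leafc_act E.
by rewrite -!ycoord_act E.
Qed.

(** For [B] in the half space, this amounts to the injectivity on [B] of the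
    projection to the quotient. *)
Definition deck_injective (B : set V) :=
  forall g z, B z -> B (act g z) -> act g z = z.

(** The size is such that the projection is injective: two heights in the box
    differ by a factor less than 4, hence less than [lam], and the product of a
    difference in [x] and a difference in [y] is less than 1, the least norm of a
    lattice vector. The width [X] along the leaves is arbitrary. *)
Definition box (c : V) (X : R) : set V := [set z : V |
  [/\ `|z 0 0 - c 0 0| < X,
      c 0 1 / 2 < z 0 1 < c 0 1 * 2 &
      `|ycoord z - ycoord c| < (4 * X)^-1]].

Lemma box_half c X : half c -> box c X `<=` half.
Proof. by move=> hc z [_ /andP[+ _] _]; apply: lt_trans; rewrite divr_gt0. Qed.

Lemma box_center c X : half c -> 0 < X -> box c X c.
Proof.
move=> hc X0; split; rewrite ?subrr ?normr0//; last by rewrite invr_gt0 mulr_gt0.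
by move: hc; rewrite /half/= => hc; apply/andP; split; lra.
Qed.

Lemma deck_small g : lam^-1 < (dscale n g : R) < lam -> forall X : R, 0 < X ->
  `|lat1 n (dvec g) : R| < X -> `|lat2 n (dvec g) : R| <= X^-1 ->
  forall z, act g z = z.
Proof.
move=> gs X X0 h1 h2 z.
have g0 := @dscale_eq1 R n g gs; have g1 := lat_bounded X0 h1 h2.
have d1 : dscale n g = 1 :> R by rewrite /dscale g0 expr0z.
have e1 : lat1 n 0 = 0 :> R by rewrite /lat1 /= mul0r addr0.
have e2 : lat2 n 0 = 0 :> R by rewrite /lat2 /= mul0r addr0.
by rewrite -[RHS]coord3K /act /actu /acty d1 g1 e1 e2 invr1 !mul1r !addr0.
Qed.

Lemma box_deck_injective c X : half c -> 0 < X -> deck_injective (box c X).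
Proof.
move=> hc X0 g z [x1 /andP[w1 w2] y1] []; rewrite act_x act_w ycoord_act /acty/= => x2 /andP[w3 w4] y2.
have hz : 0 < z 0 1 by apply: lt_trans w1; rewrite divr_gt0.
have l4 := @lam_ge4 R n; have l0 := @lam_gt0 R n.
have d0 := @dscale_gt0 R n g; have dv0 : 0 < (dscale n g)^-1 :> R by rewrite invr_gt0.
move: hc; rewrite /half/= => hc.
have dv1 : (dscale n g)^-1 < 4 :> R.
  have : (dscale n g)^-1 * (c 0 1 / 2) < 4 * (c 0 1 / 2).
    apply: lt_trans (_ : _ < (dscale n g)^-1 * z 0 1) _; first by rewrite ltr_pM2l.
    lra.
  by rewrite ltr_pM2r// divr_gt0.
have dv2 : 4^-1 < (dscale n g)^-1 :> R.
  have : 4^-1 * (2 * c 0 1) < (dscale n g)^-1 * (2 * c 0 1).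
    apply: lt_trans (_ : _ < (dscale n g)^-1 * z 0 1) _; first by lra.
    rewrite ltr_pM2l//; lra.
  by rewrite ltr_pM2r// mulr_gt0.
have gs : lam^-1 < dscale n g < lam.
  apply/andP; split.
    by rewrite invf_plt ?posrE//; apply: lt_le_trans dv1 l4.
  by apply: lt_le_trans l4; rewrite -ltf_pV2 ?posrE.
have d1 : dscale n g = 1 :> R by rewrite /dscale (@dscale_eq1 R n g gs) expr0z.
move: x2 y2; rewrite d1 invr1 !mul1r => x2 y2.
apply: (deck_small gs (X := 2 * X)); first by rewrite mulr_gt0.
  by move: x1 x2; rewrite !ltr_norml => /andP[? ?] /andP[? ?]; apply/andP; split; lra.
have Y : (2 * X)^-1 = (4 * X)^-1 + (4 * X)^-1 by field; rewrite gt_eqF.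
rewrite Y; move: y1 y2; rewrite !ltr_norml ler_norml => /andP[? ?] /andP[? ?].
by apply/andP; split; lra.
Qed.

(** Coordinates in the basis [(1, 1), (lam, lam^-1)] of the lattice. *)
Definition latr (x y : R) := (x - y) / (lam - lam^-1).
Definition lats (x y : R) := x - latr x y * lam.

Definition fundom : set V := [set z : V | [/\ 1 <= z 0 1 < lam,
   0 <= latr (z 0 0) (ycoord z) < 1 & 0 <= lats (z 0 0) (ycoord z) < 1]].

Lemma lamBV_neq0 : lam - lam^-1 != 0.
Proof. by rewrite subr_eq0 gt_eqF// lamV_lt. Qed.

Lemma latr_lat x y p : latr (x + lat1 n p) (y + lat2 n p) = latr x y + p.2%:~R.
Proof. by have := lamBV_neq0; rewrite /latr /lat1 /lat2; move: (lam^-1) => l' H; field. Qed.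

Lemma lats_lat x y p : lats (x + lat1 n p) (y + lat2 n p) = lats x y + p.1%:~R.
Proof. by rewrite /lats latr_lat /lat1; ring. Qed.

Lemma small_int_eq0 (a : R) (k : int) : 0 <= a < 1 -> 0 <= a + k%:~R < 1 -> k = 0.
Proof.
move=> /andP[a0 a1] /andP[b0 b1].
have h1 : (-1)%:~R < k%:~R :> R by rewrite rmorphN/=; lra.
have h2 : k%:~R < 1%:~R :> R by lra.
by move: h1 h2; rewrite !ltr_int; lia.
Qed.

Lemma fundom_half : fundom `<=` half.
Proof. by move=> z [/andP[+ _] _ _]; apply: lt_le_trans. Qed.

Lemma fundom_deck_injective : deck_injective fundom.
Proof.
move=> g z [/andP[w1 w2] r1 s1] []; rewrite act_x act_w ycoord_act /acty/= => /andP[w3 w4] r2 s2.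
have l4 := @lam_ge4 R n; have l0 := @lam_gt0 R n.
have d0 := @dscale_gt0 R n g; have dv0 : 0 < (dscale n g)^-1 :> R by rewrite invr_gt0.
have dv1 : (dscale n g)^-1 < lam.
  by apply: le_lt_trans w4; rewrite ler_peMr// ltW.
have dv2 : lam^-1 < (dscale n g)^-1.
  rewrite invf_plt ?posrE// invrK; apply: le_lt_trans w2.
  by rewrite -(ler_pM2l dv0) mulVf ?dscale_neq0.
have gs : lam^-1 < dscale n g < lam.
  apply/andP; split; first by rewrite invf_plt ?posrE.
  by rewrite -ltf_pV2 ?posrE.
have g0 := @dscale_eq1 R n g gs.
have d1 : dscale n g = 1 :> R by rewrite /dscale g0 expr0z.
move: r2 s2; rewrite d1 invr1 !mul1r latr_lat lats_lat => r2 s2.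
have p2 := small_int_eq0 r1 r2; have p1 := small_int_eq0 s1 s2.
apply: (deck_small gs (X := 1)) => //;
  by rewrite /lat1 /lat2 p1 p2 mul0r addr0 normr0// ?invr1 ?ler01.
Qed.

(** A power of the unit normalises the height; then the integer parts of the two
    coordinates in the lattice are subtracted. *)
Lemma fundom_meets z : half z -> exists g, fundom (act g z).
Proof.
move=> hz; have z1_gt0 : 0 < z 0 1 := hz.
have l4 := @lam_ge4 R n; have l0 := @lam_gt0 R n.
have lnl : 0 < ln lam by exact: ln_lam_gt0.
pose k : int := Num.floor (ln (z 0 1) / ln lam).
pose g1 : deck := (k, 0, 0); set z1 := act g1 z.
have Ew : z1 0 1 = (lam ^ k)^-1 * z 0 1 by rewrite act_w.
have lk0 : 0 < lam ^ k by exact: exprz_gt0.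
have w1 : 1 <= z1 0 1 < lam.
  have /andP[k1 k2] : k%:~R <= ln (z 0 1) / ln lam < (k + 1)%:~R.
    exact: floor_itv.
  rewrite Ew; apply/andP; split.
    rewrite -(ler_pM2l lk0) mulVKf ?gt_eqF// mulr1 -ler_ln ?posrE// ln_lamX.
    by rewrite -ler_pdivlMr.
  rewrite -(ltr_pM2l lk0) mulVKf ?gt_eqF// -ltr_ln ?posrE ?mulr_gt0//.
  rewrite (lnM (x := lam ^ k)) ?posrE// ln_lamX -[X in _ + X]mul1r -mulrDl.
  by rewrite -ltr_pdivrMr//; move: k2; rewrite rmorphD/=.
pose r := latr (z1 0 0) (ycoord z1); pose s := lats (z1 0 0) (ycoord z1).
pose g2 : deck := (0, - Num.floor s, - Num.floor r).
have [g Eg] := @act_comp g2 g1; exists g; rewrite Eg -/z1.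
rewrite /fundom/= act_x act_w ycoord_act /acty /dscale/= expr0z invr1 !mul1r.
rewrite latr_lat lats_lat /= -/r -/s !rmorphN/=.
by split=> //; rewrite subr_ge0 floor_le ltrBlDr addrC; have := floorD1_gt s; have := floorD1_gt r; rewrite !rmorphD/=.
Qed.

End HalfSpace.

(** * Continuity and rational balls in coordinates *)

Section MatrixContinuity.
Context {R : realType}.
Local Notation V := 'rV[R]_3.

Lemma continuous_row (T : topologicalType) m (f : T -> 'rV[R]_m) (x : T) :
  (forall j, {for x, continuous (fun y => f y 0 j)}) -> {for x, continuous f}.
Proof.
move=> cf A [Q QA subA]; have : \forall y \near x, forall j, Q 0 j (f y 0 j).
  apply: (@filter_forall _ 'I_m (fun j y => Q 0 j (f y 0 j)) (nbhs x) _) => j.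
  exact: (cf j _ (QA 0 j)).
by apply: filterS => y Qy; apply: subA => i j; rewrite (ord1 i).
Qed.

Lemma continuous_coord3 (T : topologicalType) (f g h : T -> R) (x : T) :
  {for x, continuous f} -> {for x, continuous g} -> {for x, continuous h} ->
  {for x, continuous (fun y => coord3 (f y, g y) (h y))}.
Proof.
move=> cf cg ch; apply: continuous_row => -[[|[|[|i]]] Hi]//=.
- have -> // : (fun y => coord3 (f y, g y) (h y) 0 (Ordinal Hi)) = f.
  by apply/funext => y; rewrite mxE.
- have -> // : (fun y => coord3 (f y, g y) (h y) 0 (Ordinal Hi)) = g.
  by apply/funext => y; rewrite mxE.
- have -> // : (fun y => coord3 (f y, g y) (h y) 0 (Ordinal Hi)) = h.
  by apply/funext => y; rewrite mxE.
Qed.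

(** Codes for a countable family of balls with compact closure. *)
Definition rat_code : Type := (rat * rat * rat * rat)%type.
Definition rat_center (q : rat_code) : V :=
  coord3 (ratr q.1.1.1, ratr q.1.1.2) (ratr q.1.2).
Definition rat_ball (q : rat_code) : set V := ball (rat_center q) (ratr q.2).
Definition rat_cball (q : rat_code) : set V :=
  [set z | `|z - rat_center q| <= ratr q.2].

Lemma rat_ball_nbhs (A : set V) z : nbhs z A ->
  exists q, rat_ball q z /\ rat_cball q `<=` A.
Proof.
move=> /nbhs_ballP[e /= e0 eA].
have near_rat (x : R) : exists q : rat, `|x - ratr q| < e / 4.
  have [|q] := @rat_in_itvoo R (x - e / 4) (x + e / 4); first by lra.
  by rewrite in_itv/= => ?; exists q; rewrite ltr_norml; lra.
have [q0 h0] := near_rat (z 0 0); have [q1 h1] := near_rat (z 0 1).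
have [q2 h2] := near_rat (z 0 ord_max).
have [|r] := @rat_in_itvoo R (e / 4) (e / 2); first by lra.
rewrite in_itv/= => /andP[r1 r2].
pose q : rat_code := (q0, q1, q2, r).
have zq : `|z - rat_center q| <= e / 4.
  apply: norm_le_entry => [|i]; first by rewrite divr_ge0// ltW.
  rewrite mxE [X in _ + X]mxE /rat_center mxE.
  by case: i => [[|[|[|i]]] Hi]//=; apply/ltW; [move: h0|move: h1|move: h2];
    congr (`|_ - _| < _); congr (z _ _); apply/val_inj.
exists q; split.
  by rewrite /rat_ball mx_norm_ball /ball_/= distrC; apply: le_lt_trans zq _.
move=> y yq; apply: eA; rewrite mx_norm_ball /ball_/=.
rewrite -(subrKA (rat_center q)); apply: le_lt_trans (ler_normD _ _) _.
rewrite [X in _ + X]distrC; rewrite /rat_cball/= in yq; lra.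
Qed.

Lemma rat_ball_sub q : rat_ball q `<=` rat_cball q.
Proof. by move=> z; rewrite /rat_ball mx_norm_ball /ball_/= distrC => /ltW. Qed.

Lemma rat_cball_compact q : compact (rat_cball q).
Proof.
apply: bounded_closed_compact.
  exists (ratr q.2 + `|rat_center q|); split; first exact: num_real.
  move=> M qM z /= zq; apply: le_trans (ltW qM).
  by rewrite -[leLHS]/(`|z|) -[z in leLHS](subrK (rat_center q)) (le_trans (ler_normD _ _))// lerD2r.
rewrite (_ : rat_cball q = (fun z => `|z - rat_center q|) @^-1` [set x | x <= ratr q.2])//.
apply: closed_comp; last exact: closed_le.
by move=> z _; apply: continuous_comp; [apply: continuousB; [exact: cvg_id|exact: cst_continuous]|exact: norm_continuous].
Qed.

End MatrixContinuity.

(** * The Sol manifold as a topological space *)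

Section Solmanifold.
Context {R : realType} (n : nat).
Local Notation V := 'rV[R]_3.
Local Notation half := (@half R).
Local Notation act := (@act R n).

(** Extends the orbit relation of the half space to an equivalence relation on the
    whole space, without adding classes. *)
Definition clamp (z : V) : V := if 0 < z 0 1 then z else coord3 (0, 1) 0.

Lemma clamp_half z : half (clamp z).
Proof. by rewrite /clamp; case: ifPn => // _; rewrite /half/= mxE/=. Qed.

Lemma clamp_id z : half z -> clamp z = z.
Proof. by rewrite /half/= /clamp => ->. Qed.

Definition deck_rel (z z' : V) : bool := `[< exists g, act g (clamp z) = clamp z' >].

Lemma deck_rel_refl : reflexive deck_rel.
Proof. by move=> z; apply/asboolP; have [g Eg] := @act_id R n; exists g. Qed.

Lemma deck_rel_sym : symmetric deck_rel.
Proof.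
suff H z z' : deck_rel z z' -> deck_rel z' z by move=> z z'; apply/idP/idP; exact: H.
move=> /asboolP[g Eg]; have [h [E1 E2]] := @act_inv R n g.
by apply/asboolP; exists h; rewrite -Eg E1.
Qed.

Lemma deck_rel_trans : transitive deck_rel.
Proof.
move=> y x z /asboolP[g Eg] /asboolP[h Eh]; have [k Ek] := @act_comp R n h g.
by apply/asboolP; exists k; rewrite Ek Eg.
Qed.

Definition deck_equiv := EquivRel deck_rel deck_rel_refl deck_rel_sym deck_rel_trans.

Definition sol : Type := {eq_quot deck_equiv}%qT.
Definition solproj (z : V) : sol := \pi_({eq_quot deck_equiv})%qT z.
Local Notation P := solproj.

HB.instance Definition _ := Choice.on sol.
HB.instance Definition _ := isPointed.Build sol (P 0).

Lemma solproj_surj (p : sol) : exists2 z, half z & P z = p.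
Proof.
exists (clamp (repr p)); first exact: clamp_half.
rewrite /solproj -[RHS]reprK; apply/eqquotP/asboolP.
have [g Eg] := @act_id R n; exists g.
by rewrite Eg clamp_id//; exact: clamp_half.
Qed.

Lemma solproj_eq z z' : half z -> half z' -> P z = P z' <-> exists g, act g z = z'.
Proof.
move=> hz hz'; rewrite /solproj; split.
  by move=> /eqquotP/asboolP; rewrite !clamp_id.
by move=> e; apply/eqquotP/asboolP; rewrite !clamp_id.
Qed.

Lemma solproj_act g z : half z -> P (act g z) = P z.
Proof. by move=> hz; apply/esym/solproj_eq; [|exact: act_half|exists g]. Qed.

(** The quotient topology of the half space. *)
Definition sol_open : set (set sol) := [set A | open (half `&` P @^-1` A)].

Lemma half_open : open half.
Proof.
rewrite (_ : half = (fun z : V => z 0 1) @^-1` [set x | 0 < x])//.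
by apply: open_comp; [move=> z _; exact: coord_continuous|exact: open_gt].
Qed.

Let sol_openT : sol_open setT.
Proof. by rewrite /sol_open/= preimage_setT setIT; exact: half_open. Qed.

Let sol_openI : setI_closed sol_open.
Proof.
move=> A B oA oB; rewrite /sol_open/= preimage_setI.
rewrite (_ : _ `&` _ = (half `&` P @^-1` A) `&` (half `&` P @^-1` B)); first exact: openI.
by rewrite setIACA setIid.
Qed.

Let sol_open_bigU (I : Type) (f : I -> set sol) :
  (forall i, sol_open (f i)) -> sol_open (\bigcup_i f i).
Proof.
move=> fo; rewrite /sol_open/= preimage_bigcup setI_bigcupr.
by apply: bigcup_open => i _; exact: fo.
Qed.

HB.instance Definition _ :=
  isOpenTopological.Build sol sol_openT sol_openI sol_open_bigU.

Lemma sol_openE (A : set sol) : open A = open (half `&` P @^-1` A).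
Proof. by []. Qed.

Lemma solproj_continuous z : half z -> {for z, continuous P}.
Proof.
move=> hz A; rewrite nbhsE => -[B [oB Bz] BA].
apply: (filterS (P := half `&` P @^-1` B)); first by move=> y [_ /BA].
by apply: open_nbhs_nbhs; split.
Qed.

Lemma act_continuous g : continuous (act g).
Proof.
have cc (a c : R) i (z : V) : {for z, continuous (fun y : V => a * y 0 i + c)}.
  by apply: continuousD; [apply: continuousM; [exact: cst_continuous|
    exact: coord_continuous]|exact: cst_continuous].
move=> z; apply: (@continuous_coord3 _ _
  (fun y : V => dscale n g * y 0 0 + lat1 n (dvec g)) (fun y => (dscale n g)^-1 * y 0 1)
  (fun y => (dscale n g)^-1 * y 0 ord_max + lat2 n (dvec g)) z); try exact: cc.
by apply: continuousM; [exact: cst_continuous|exact: coord_continuous].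
Qed.

Lemma solproj_open (B : set V) : open B -> B `<=` half -> open (P @` B).
Proof.
move=> oB Bh; rewrite sol_openE.
rewrite (_ : _ `&` _ = \bigcup_g (half `&` act g @^-1` B)).
  apply: bigcup_open => g _; apply: openI; first exact: half_open.
  by apply: open_comp oB => z _; exact: act_continuous.
apply/seteqP; split=> [z [hz [y By Py]]|z [g _ [hz Bz]]].
  by have [g Eg] := (solproj_eq hz (Bh _ By)).1 (esym Py); exists g => //; split=> //=; rewrite Eg.
by split=> //; exists (act g z) => //; exact: solproj_act.
Qed.

Lemma solproj_nbhs (B : set V) z : half z -> nbhs z B -> nbhs (P z) (P @` (B `&` half)).
Proof.
move=> hz; rewrite nbhsE => -[C [oC Cz] CB].
apply: (filterS (P := P @` (C `&` half))).
  by apply: image_subset => y [/CB ? ?]; split.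
apply: open_nbhs_nbhs; split; last by exists z.
by apply: solproj_open; [exact: openI oC half_open|move=> y []].
Qed.

Lemma sol_second_countable : @second_countable sol.
Proof.
exists [set P @` (rat_ball q `&` half) | q in [set: rat_code]].
  apply: card_le_trans (card_image_le _ _) _; exact: countableP.
split; first by move=> _ [q _ <-]; apply: solproj_open => [|y []//];
  apply: openI half_open; exact: ball_open.
move=> p A; rewrite nbhsE => -[B [oB Bp] BA].
have [z hz Pz] := solproj_surj p.
have : nbhs z (half `&` P @^-1` B) by apply: open_nbhs_nbhs; split; rewrite ?sol_openE -?Pz//=; rewrite Pz.
move=> /rat_ball_nbhs[q [qz qB]].
exists (P @` (rat_ball q `&` half)); first by split; [exists q|exists z].
by apply: subset_trans BA => _ [y [/rat_ball_sub/qB [_ By] _] <-].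
Qed.

End Solmanifold.

(** * The quotient is compact and Hausdorff *)

Section SolTopology.
Context {R : realType} (n : nat).
Local Notation lam := (@lam R n).
Local Notation V := 'rV[R]_3.
Local Notation half := (@half R).
Local Notation act := (@act R n).
Local Notation sol := (@sol R n).
Local Notation P := (@solproj R n).

Lemma solproj_surj_fundom (p : sol) : exists2 z, fundom n z & P z = p.
Proof.
have [z hz <-] := solproj_surj p; have [g Fg] := @fundom_meets R n z hz.
by exists (act g z) => //; exact: solproj_act.
Qed.

Lemma sol_compact : compact [set: sol].
Proof.
have l4 := @lam_ge4 R n; have lV := @lamV_lt R n; have l0 := @lam_gt0 R n.
have lV0 : 0 < lam^-1 by rewrite invr_gt0.
(* a point of the fundamental domain has [x = s + r lam] and [y = s + r / lam]
   with [r] and [s] in [0, 1[ *)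
pose I (i : 'I_3) : set R :=
  if i == 1 then `[1, lam]%classic else `[- (1 + lam), 1 + lam]%classic.
have cI : compact [set v : V | forall i, I i (v ord0 i)].
  by apply: rV_compact => i; rewrite /I; case: ifP => _; exact: segment_compact.
have : compact (P @` [set v : V | forall i, I i (v ord0 i)]).
  apply: continuous_compact cI; apply: continuous_in_subspaceT => z; rewrite inE/= => Iz.
  apply: solproj_continuous; have := Iz 1; rewrite /I eqxx/= in_itv/= => /andP[+ _].
  exact: lt_le_trans.
congr compact; apply/seteqP; split=> // p _.
have [z [/andP[w1 w2] /andP[r1 r2] /andP[s1 s2]] <-] := solproj_surj_fundom p.
exists z => // i; rewrite /I; case: ifPn => [/eqP->|i1]; first by rewrite /= in_itv/= w1 ltW.
have rl : (latr n (z 0 0) (ycoord z)) * (lam - lam^-1) = z 0 0 - ycoord z.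
  by rewrite /latr divfK// lamBV_neq0.
move: s1 s2 r1 r2 rl; rewrite /lats; set r := latr _ _ _ => s1 s2 r1 r2 rl.
have rl0 : 0 <= r * lam by rewrite mulr_ge0// ltW.
have rl1 : r * lam <= lam by rewrite ler_piMl// ltW.
have rv0 : 0 <= r * lam^-1 by rewrite mulr_ge0// ltW.
have rv1 : r * lam^-1 <= lam^-1 by rewrite ler_piMl// ltW.
rewrite mulrBr in rl.
rewrite /= in_itv/=; case: i i1 => [[|[|[|i]]] Hi]//= _.
  rewrite (_ : Ordinal Hi = 0); last exact/val_inj.
  by apply/andP; split; lra.
rewrite (_ : z ord0 (Ordinal Hi) = ycoord z); last by congr (z _ _); exact/val_inj.
by apply/andP; split; lra.
Qed.

Definition cell (c : V) (r a b : R) : set V := [set z : V |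
  [/\ `|z 0 0 - c 0 0| < a, c 0 1 / r < z 0 1 < c 0 1 * r &
      `|ycoord z - ycoord c| < b]].

Lemma open_cell c r a b : open (cell c r a b).
Proof.
have oc (i : 'I_3) l m : open [set z : V | l < z 0 i < m].
  rewrite (_ : [set _ | _] = (fun z : V => z 0 i) @^-1` `]l, m[%classic).
    by apply: open_comp; [move=> z _; exact: coord_continuous|exact: interval_open].
  by apply/seteqP; split=> z /=; rewrite in_itv.
rewrite (_ : cell c r a b = [set z : V | c 0 0 - a < z 0 0 < c 0 0 + a] `&`
   [set z : V | c 0 1 / r < z 0 1 < c 0 1 * r] `&`
   [set z : V | ycoord c - b < z 0 ord_max < ycoord c + b]).
  by apply: openI; [apply: openI|].
apply/seteqP; split=> z; rewrite /cell/= !ltr_distl.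
  by move=> [h1 h2 h3]; split; [split|].
by move=> [[h1 h2] h3].
Qed.

Lemma open_box (c : V) (X : R) : open (box c X).
Proof. exact: (@open_cell c 2 X (4 * X)^-1). Qed.

(** Proper discontinuity, in the form needed to separate orbits: at most one deck
    transformation takes a point of [U] into [U']. If [g y1] and [h y2] are in
    [U'], then [g y2] is close to [g y1], and therefore both [g y2] and [h y2] are
    in a box around [z'], where the projection is injective. *)
Lemma deck_locally_finite z z' : half z -> half z' ->
  exists U U' : set V, [/\ open U, U z, open U', U' z' &
    U' `<=` half /\ forall g h y1 y2, U y1 -> U y2 -> U' (act g y1) -> U' (act h y2) ->
      g = h].
Proof.
move=> hz hz'; have W0 : 0 < z 0 1 := hz; have W0' : 0 < z' 0 1 := hz'.
(* bounds on the scaling factor of [g] and on its inverse, where [25 / 16] is the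
   square of the factor [5 / 4] by which the heights in the cells vary *)
pose m := 25 / 16 * (z 0 1 / z' 0 1); pose m' := 25 / 16 * (z' 0 1 / z 0 1).
have m0 : 0 < m by rewrite mulr_gt0 ?divr_gt0.
have m0' : 0 < m' by rewrite mulr_gt0 ?divr_gt0.
have a0 : 0 < (4 * m)^-1 by rewrite invr_gt0 pmulr_rgt0.
have b0 : 0 < (16 * m')^-1 by rewrite invr_gt0 pmulr_rgt0.
exists (cell z (5 / 4) (4 * m)^-1 (16 * m')^-1), (cell z' (5 / 4) 2^-1 8^-1).
split; [exact: open_cell| |exact: open_cell| |].
- split; rewrite ?subrr ?normr0//.
  by apply/andP; split; rewrite ?invf_div; lra.
- split; rewrite ?subrr ?normr0 ?invr_gt0//.
  by apply/andP; split; rewrite ?invf_div; lra.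
split; first by move=> y [_ /andP[+ _] _]; apply: lt_trans; rewrite divr_gt0.
move=> g h y1 y2 [x1 w1 t1] [x2 w2 t2] [gx gw gt] Uh.
have hy2 : half y2 by have /andP[+ _] := w2; apply: lt_trans; rewrite divr_gt0.
have box_h : box z' 1 (act h y2).
  case: Uh => hx; rewrite invf_div => /andP[hw1 hw2] ht; split.
  - by apply: lt_trans hx _; lra.
  - by apply/andP; split; lra.
  - by apply: lt_trans ht _; rewrite mulr1; lra.
suff box_g : box z' 1 (act g y2).
  have [g' [E _]] := @act_inv R n g; have [k Ek] := @act_comp R n h g'.
  have /(_ k (act g y2) box_g) := @box_deck_injective R n z' 1 hz' ltr01.
  rewrite Ek E => /(_ box_h) Eh; apply/esym; exact: (@act_free R n _ _ _ hy2 Eh).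
have d0 := @dscale_gt0 R n g; have dv : dscale n g * (dscale n g)^-1 = 1 :> R.
  by rewrite mulfV// gt_eqF.
move: gx gw gt; rewrite act_w act_x ycoord_act /acty => gx gw gt.
rewrite /box/= act_w act_x ycoord_act /acty.
have v0 : 0 < (dscale n g)^-1 :> R by rewrite invr_gt0.
move: d0 dv v0 gx gw gt; move: (dscale n g) (lat1 _ _) (lat2 _ _) => s l l'.
move: (s^-1) => v s0 sv v0 gx /andP[gw1 gw2] gt.
rewrite !invf_div in w1 w2 gw1; move: w1 w2 => /andP[w11 w12] /andP[w21 w22].
have vm : v < m'.
  rewrite /m' mulrA ltr_pdivlMr//.
  suff : v * (z 0 1 * (4 / 5)) < v * y1 0 1 by lra.
  by rewrite ltr_pM2l.
have sm : s < m.
  rewrite /m mulrA ltr_pdivlMr//.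
  have : s * (z' 0 1 * (4 / 5)) < s * (v * y1 0 1) by rewrite ltr_pM2l.
  have -> : s * (v * y1 0 1) = y1 0 1 by rewrite mulrA sv mul1r.
  lra.
have xy : `|s * (y2 0 0 - y1 0 0)| < 2^-1.
  have x12 : `|y2 0 0 - y1 0 0| < 2 * (4 * m)^-1.
    by move: x1 x2; rewrite !ltr_norml => /andP[? ?] /andP[? ?]; apply/andP; split; lra.
  rewrite normrM gtr0_norm//.
  apply: (@le_lt_trans _ _ (s * (2 * (4 * m)^-1))); first by rewrite ler_pM2l// ltW.
  have -> : 2^-1 = m * (2 * (4 * m)^-1) by field; rewrite gt_eqF.
  by rewrite ltr_pM2r// mulr_gt0// invr_gt0 mulr_gt0.
have ty : `|v * (ycoord y2 - ycoord y1)| < 8^-1.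
  have t12 : `|ycoord y2 - ycoord y1| < 2 * (16 * m')^-1.
    by move: t1 t2; rewrite !ltr_norml => /andP[? ?] /andP[? ?]; apply/andP; split; lra.
  rewrite normrM gtr0_norm//.
  apply: (@le_lt_trans _ _ (v * (2 * (16 * m')^-1))); first by rewrite ler_pM2l// ltW.
  have -> : 8^-1 = m' * (2 * (16 * m')^-1) by field; rewrite gt_eqF.
  by rewrite ltr_pM2r// mulr_gt0// invr_gt0 mulr_gt0.
split.
- move: gx xy; rewrite !ltr_norml => /andP[? ?] /andP[? ?]; apply/andP; split; lra.
- have : v * y2 0 1 < v * (y1 0 1 * (25 / 16)) by rewrite ltr_pM2l//; lra.
  have : v * y1 0 1 < v * (y2 0 1 * (25 / 16)) by rewrite ltr_pM2l//; lra.
  by move=> ? ?; apply/andP; split; lra.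
- rewrite mulr1; move: gt ty; rewrite !ltr_norml => /andP[? ?] /andP[? ?].
  by apply/andP; split; lra.
Qed.

(** Near [z] and [z'] a single deck transformation [g] has to be taken into
    account, and the points [g z] and [z'] are separated in the half space. *)
Lemma sol_hausdorff : hausdorff_space sol.
Proof.
rewrite open_hausdorff => p q pq.
have [z hz Ez] := solproj_surj p; have [z' hz' Ez'] := solproj_surj q.
have [U [U' [oU Uz oU' Uz' [Uh' UU']]]] := deck_locally_finite hz hz'.
(* it suffices to shrink [U] and [U'] so that no translate of [U] meets [U'] *)
suff [D [D' [oD Dz oD' Dz' DD']]] : exists D D' : set V, [/\ open D, D z, open D', D' z' &
    forall g y, D y -> U y -> ~ (D' (act g y) /\ U' (act g y))].
  exists (P @` (D `&` U `&` half), P @` (D' `&` U' `&` half)); rewrite /= ?inE.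
    by split; [exists z|exists z'].
  have oh := @half_open R.
  split; [apply: solproj_open => [|y []//]; exact: openI (openI oD oU) oh|
    apply: solproj_open => [|y []//]; exact: openI (openI oD' oU') oh|].
  rewrite -subset0 => r [[y [[Dy Uy] hy] <-] [y' [[Dy' Uy'] hy'] Eyy']].
  have [g Eg] := (@solproj_eq R n _ _ hy hy').1 (esym Eyy').
  by apply: (DD' g y Dy Uy); rewrite Eg.
have [[g [y [Uy Ugy]]]|noU] := pselect (exists g y, U y /\ U' (act g y)); last first.
  exists setT, setT; split=> //; try exact: openT.
  by move=> g y _ Uy [_ Ugy]; apply: noU; exists g, y.
have zz' : act g z != z'.
  by apply: contra_neq pq => Eg; rewrite -Ez -Ez'; apply/solproj_eq => //; exists g.
have := @norm_hausdorff R V; rewrite open_hausdorff => /(_ _ _ zz').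
move=> [[B B'] /= [/[!inE] Bz Bz'] [oB oB' BB']].
exists (act g @^-1` B), B'; split=> //.
  by apply: open_comp oB => y' _; exact: act_continuous.
move=> h y' By' Uy' [Bhy Uhy].
have Eh : g = h by exact: (UU' g h y y').
have : (B `&` B') (act h y') by split=> //; rewrite -Eh.
by rewrite BB'.
Qed.

End SolTopology.

(** * The manifold and its foliation *)

Section Charts.
Context {R : realType} (n : nat).
Local Notation V := 'rV[R]_3.
Local Notation half := (@half R).
Local Notation act := (@act R n).
Local Notation sol := (@sol R n).
Local Notation P := (@solproj R n).

Lemma near_open (T : topologicalType) (x : T) (Q : T -> Prop) :
  (\forall y \near x, Q y) -> exists W, [/\ open W, W x & forall y, W y -> Q y].
Proof.
move=> H; have : nbhs x [set y | Q y] by [].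
by rewrite nbhsE => -[W [oW Wx] WQ]; exists W.
Qed.

(** The inverse on the box of the projection. *)
Definition box_coord (c : V) (X : R) (p : sol) : V :=
  xget c (box c X `&` P @^-1` [set p]).

Section BoxChart.
Context (c : V) (X : R) (hc : half c) (X0 : 0 < X).

Lemma box_coordK z : box c X z -> box_coord c X (P z) = z.
Proof.
move=> bz; apply: xget_unique => //= y [By /= Py].
have [g Eg] := (@solproj_eq R n _ _ (box_half hc bz) (box_half hc By)).1 (esym Py).
by have /(_ g z bz) := @box_deck_injective R n c X hc X0; rewrite Eg => ->.
Qed.

Lemma box_image_coord : box_coord c X @` (P @` box c X) = box c X.
Proof.
apply/seteqP; split=> [_ [_ [z bz <-] <-]|z bz]; first by rewrite box_coordK.
by exists (P z); [exists z|rewrite box_coordK].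
Qed.

Let bdom_open : open (P @` box c X).
Proof. exact: solproj_open (@open_box R c X) (@box_half R c X hc). Qed.

Let bimg_open : open (box_coord c X @` (P @` box c X)).
Proof. rewrite box_image_coord; exact: open_box. Qed.

Let bK p : (P @` box c X) p -> P (box_coord c X p) = p.
Proof. by move=> [z bz <-]; rewrite box_coordK. Qed.

Let bcoord_continuous : {within P @` box c X, continuous (box_coord c X)}.
Proof.
apply: continuous_in_subspaceT => p; rewrite inE => -[z bz <-] A.
rewrite box_coordK// => Az; have hz := box_half hc bz.
suff : nbhs (P z) (box_coord c X @^-1` A) by [].
have zb : nbhs z (box c X) by apply: open_nbhs_nbhs; split => //; exact: open_box.
have zAb : nbhs z (A `&` box c X) by exact: filterI.
have PzN := @solproj_nbhs R n _ _ hz zAb.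
apply: filterS PzN.
by move=> _ [y [[Ay By] _] <-] /=; rewrite box_coordK.
Qed.

Let binv_continuous : {within box_coord c X @` (P @` box c X), continuous P}.
Proof.
rewrite box_image_coord; apply: continuous_in_subspaceT => z; rewrite inE => bz.
by apply: solproj_continuous; exact: (box_half hc bz).
Qed.

Definition box_chart : chart R sol 3 :=
  Chart bdom_open bimg_open bK bcoord_continuous binv_continuous.

Lemma cimg_box_chart : cimg box_chart = box c X.
Proof. exact: box_image_coord. Qed.

End BoxChart.

Definition sol_atlas : set (chart R sol 3) :=
  [set ch | exists c X (hc : half c) (X0 : 0 < X), ch = box_chart hc X0].

Lemma atlas_cinv c : sol_atlas c -> cinv c = P.
Proof. by move=> [? [? [? [? ->]]]]. Qed.

Lemma atlas_half c : sol_atlas c -> cimg c `<=` half.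
Proof. by move=> [c0 [X [hc [X0 ->]]]]; rewrite cimg_box_chart; exact: box_half. Qed.

Lemma atlas_cfunP c z : sol_atlas c -> cimg c z -> cfun c (P z) = z.
Proof. by move=> ac [p cp <-]; rewrite -(atlas_cinv ac) cfunK. Qed.

Lemma cimg_cdom (T : topologicalType) m (c : chart R T m) z : cimg c z ->
  cdom c (cinv c z).
Proof. by move=> [p cp <-]; rewrite cfunK. Qed.

Lemma cimg_cfun (T : topologicalType) m (c : chart R T m) z : cimg c z ->
  cfun c (cinv c z) = z.
Proof. by move=> [p cp <-]; rewrite cfunK. Qed.

Lemma cimg_near (T : topologicalType) m (c : chart R T m) z : cimg c z ->
  \forall y \near z, cimg c y.
Proof.
move=> cz; have : open_nbhs z (cimg c) by split; [exact: cimg_open|].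
exact: open_nbhs_nbhs.
Qed.

Lemma cdom_near (T : topologicalType) m (c : chart R T m) x : cdom c x ->
  \forall y \near x, cdom c y.
Proof.
move=> cx; have : open_nbhs x (cdom c) by split; [exact: cdom_open|].
exact: open_nbhs_nbhs.
Qed.

Lemma cinv_cts (T : topologicalType) m (c : chart R T m) z : cimg c z ->
  {for z, continuous (cinv c)}.
Proof.
move=> cz; have := cinv_continuous (c := c); rewrite continuous_open_subspace.
  by apply; rewrite inE.
exact: cimg_open.
Qed.

Lemma cfun_cts (T : topologicalType) m (c : chart R T m) x : cdom c x ->
  {for x, continuous (cfun c)}.
Proof.
move=> cx; have := cfun_continuous (c := c); rewrite continuous_open_subspace.
  by apply; rewrite inE.
exact: cdom_open.
Qed.

Lemma open_image_cfun (T : topologicalType) m (c : chart R T m) (A : set T) :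
  open A -> open (cfun c @` (cdom c `&` A)).
Proof.
move=> oA.
have -> : cfun c @` (cdom c `&` A) = cimg c `&` cinv c @^-1` A.
  apply/seteqP; split=> [_ [x [cx Ax] <-]|_ [[x cx <-] Ax]].
    by split; [exists x|rewrite /= cfunK].
  by exists x => //; split=> //; rewrite /= cfunK in Ax.
have cc : {in cimg c, continuous (cinv c)}.
  by move=> z; rewrite inE => cz; exact: cinv_cts.
exact: (iffLR (continuous_inP (cinv c) (@cimg_open _ _ _ c)) cc A oA).
Qed.

(** Changes of charts are locally deck transformations. These are affine and map
    planes [y = t] to such planes, which makes the atlas smooth and its charts
    foliated. *)
Lemma atlas_transition c d (x : sol) : sol_atlas c -> sol_atlas d -> cdom c x -> cdom d x ->
  exists g, \forall z \near cfun c x, [/\ cimg c z, cimg d (act g z) &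
    transition c d z = act g z].
Proof.
move=> ac ad cx dx; have ac' := ac; have ad' := ad.
have cz : cimg c (cfun c x) by exists x.
have dz : cimg d (cfun d x) by exists x.
have hc := atlas_half ac cz; have hd := atlas_half ad dz.
have Ec : P (cfun c x) = x by rewrite -(atlas_cinv ac) cfunK.
have Ed : P (cfun d x) = x by rewrite -(atlas_cinv ad) cfunK.
have [g Eg] := (@solproj_eq R n _ _ hc hd).1 (etrans Ec (esym Ed)); exists g.
have nc : \forall z \near cfun c x, cimg c z by exact: cimg_near.
have nd : \forall z \near cfun c x, cimg d (act g z).
  apply: (@act_continuous R n g); rewrite Eg.
  exact: cimg_near.
apply: filterS2 nc nd => z ncz ndz; split=> //.
rewrite /transition /= (atlas_cinv ac) -(@solproj_act R n g _ (atlas_half ac ncz)).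
by rewrite atlas_cfunP.
Qed.

Lemma act_coord g i (z : V) : act g z 0 i =
  (if i == 0 then dscale n g else (dscale n g)^-1) * z 0 i +
  (if i == 0 then lat1 n (dvec g) else if i == 1 then 0 else lat2 n (dvec g)).
Proof.
case: i => [[|[|[|i]]] Hi]//.
- have -> : Ordinal Hi = 0 by apply/val_inj.
  by rewrite act_x eqxx.
- have -> : Ordinal Hi = 1 by apply/val_inj.
  by rewrite act_w addr0.
- have -> : Ordinal Hi = ord_max by apply/val_inj.
  exact: ycoord_act.
Qed.

Lemma sol_atlas_smooth c d : sol_atlas c -> sol_atlas d -> smooth_transition c d.
Proof.
move=> ac ad i k; apply: Ck_on_local => z [x [cx dx] <-].
have [g /near_open[W [oW Wz Wg]]] := atlas_transition ac ad cx dx.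
exists W, (fun z => act g z 0 i); split=> //.
  by rewrite (funext (act_coord g i)); exact: Ck_on_affine.
by move=> y /Wg[_ _ ->].
Qed.

Lemma sol_atlas_cover (p : sol) : exists2 c, sol_atlas c & cdom c p.
Proof.
have [z hz <-] := solproj_surj p; exists (box_chart hz ltr01); first by exists z, 1, hz, ltr01.
by exists z => //; exact: box_center.
Qed.

Definition sol_manifold : manifold R 3 := Manifold (@sol_hausdorff R n)
  (@sol_second_countable R n) sol_atlas_cover sol_atlas_smooth.

Lemma sol_atlas_smooth_chart c : sol_atlas c -> smooth_chart (M := sol_manifold) c.
Proof. by move=> ac d ad; split; exact: sol_atlas_smooth. Qed.

Lemma sol_plaque c d (x : sol) : sol_atlas c -> sol_atlas d -> cdom c x -> cdom d x ->
  exists2 U : set sol, nbhs x U & forall y z, U y -> U z ->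
    transverse c y = transverse c z -> transverse d y = transverse d z.
Proof.
move=> ac ad cx dx; have [g Wg] := atlas_transition ac ad cx dx.
exists (cdom c `&` cfun c @^-1` [set z | [/\ cimg c z, cimg d (act g z) &
    transition c d z = act g z]]).
  have N1 : nbhs x (cdom c) by exact: (cdom_near cx).
  have N2 : nbhs x (cfun c @^-1` [set z | [/\ cimg c z, cimg d (act g z) &
    transition c d z = act g z]]) by exact: (cfun_cts cx Wg).
  exact: filterI.
have Et y : cdom c y -> transition c d (cfun c y) = act g (cfun c y) ->
    transverse d y = acty n g (transverse c y).
  by move=> cy; rewrite /transition /= cfunK// /transverse => ->; exact: ycoord_act.
by move=> y z [cy [_ _ Ty]] [cz [_ _ Tz]] E; rewrite !Et// E.
Qed.

Definition sol_foliation : foliation1 sol_manifold :=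
  @Foliation1 R 2 sol_manifold sol_atlas sol_atlas_smooth_chart sol_atlas_cover sol_plaque.

End Charts.

(** * Matrices of partial derivatives *)

Section PartialJacobian.
Context {R : realType}.

Lemma near_eq_differentiable n m (f g : 'rV[R]_n -> 'rV[R]_m) z :
  (\forall y \near z, f y = g y) -> differentiable g z -> differentiable f z.
Proof.
move=> fg dg; have Ez : f z = g z by exact: (nbhs_singleton fg).
have [cg lg] := (diff_locallyP _ _).1 dg.
have cf : continuous ('d g z : {linear 'rV[R]_n -> 'rV[R]_m}) by [].
have lf : f \o shift z = cst (f z) + 'd g z +o_ (0 : 'rV[R]_n) (id : 'rV[R]_n -> 'rV[R]_n).
  apply/eqaddoP => e e0; move/eqaddoP : lg => /(_ e e0).
  have fg0 : \forall h \near (0 : 'rV[R]_n), f (h + z) = g (h + z).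
    by move: fg; rewrite (near_shift 0 z); apply: filterS => h /=; rewrite subr0.
  by apply: filterS2 fg0 => h /= Eh; rewrite !fctE /= Eh Ez.
by apply/diff_locallyP; rewrite (diff_unique cf lf); split.
Qed.

(** The Jacobian matrix of [T] when [T] is differentiable at [z]. As it is defined
    by partial derivatives, the smoothness of its entries is immediate. *)
Definition pj n m (T : 'rV[R]_n -> 'rV[R]_m) (z : 'rV[R]_n) : 'M[R]_(n, m) :=
  \matrix_(i, k) 'D_(delta_mx 0 i) (fun y => T y 0 k) z.

Lemma pj_jacobian n m (T : 'rV[R]_n -> 'rV[R]_m) z :
  differentiable T z -> jacobian T z = pj T z.
Proof. by move=> dT; apply/matrixP => i k; rewrite jacobianE// mxE. Qed.

Lemma pj_near_eq n m (S T : 'rV[R]_n -> 'rV[R]_m) z :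
  (\forall y \near z, S y = T y) -> pj S z = pj T z.
Proof.
move=> ST; apply/matrixP => i k; rewrite !mxE; apply: near_eq_derive.
by apply: filterS ST => y ->.
Qed.

Lemma pj_comp n m p (T : 'rV[R]_n -> 'rV[R]_m) (S : 'rV[R]_m -> 'rV[R]_p) z :
  differentiable T z -> differentiable S (T z) ->
  pj (S \o T) z = pj T z *m pj S (T z).
Proof.
move=> dT dS; apply/matrixP => i k; rewrite !mxE.
have dSk : differentiable (fun y => S y 0 k) (T z).
  apply: (@differentiable_comp _ _ _ _ S (fun y : 'rV[R]_p => y 0 k)) => //.
  exact: differentiable_coord.
rewrite (derive_chain (h := fun y => S y 0 k) (delta_mx 0 i) dT dSk).
by apply: eq_bigr => j _; rewrite !mxE.
Qed.

Lemma pj_id n (z : 'rV[R]_n) : pj id z = 1%:M.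
Proof.
apply/matrixP => i k; rewrite !mxE.
have -> : (fun y : 'rV[R]_n => id y 0 k) = (fun y => 1 * y 0 k + 0).
  by apply/funext => y; rewrite mul1r addr0.
by have [_ ->] := is_derive_affine 1 0 k z (delta_mx 0 i); rewrite mul1r mxE eqxx eq_sym.
Qed.

End PartialJacobian.

(** * The metric *)

Section Metric.
Context {R : realType} (n : nat).
Local Notation V := 'rV[R]_3.
Local Notation act := (@act R n).
Local Notation M := (@sol_manifold R n).

(** The metric [w^2 dx^2 + w^-2 dw^2 + w^-2 dy^2], invariant under the deck group
    since [w] and [y] are scaled by the inverse of the factor of [x]. *)
Definition halfgram (z : V) : 'M[R]_3 :=
  diag_mx (\row_k (if k == 0 then z 0 1 ^+ 2 else z 0 1 ^- 2)).

Definition deck_lin (g : deck) : 'M[R]_3 :=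
  diag_mx (\row_k (if k == 0 then dscale n g else (dscale n g)^-1)).

Lemma pj_act g z : pj (act g) z = deck_lin g.
Proof.
apply/matrixP => i k; rewrite !mxE (funext (fun y => act_coord n g k y)).
set a := (if _ then _ else _); set b := (if _ then _ else _).
have [_ ->] := is_derive_affine a b k z (delta_mx 0 i).
by rewrite mxE eqxx /= mulr_natr (eq_sym k i); have [->|] := eqVneq i k.
Qed.

Lemma differentiable_act g z : differentiable (act g) z.
Proof.
apply: differentiable_rowP => j; rewrite (funext (fun y => act_coord n g j y)).
by apply: smooth_on_differentiable (openT) I _ => k; exact: Ck_on_affine.
Qed.

Lemma halfgram_act g z : deck_lin g *m halfgram (act g z) *m (deck_lin g)^T = halfgram z.
Proof.
rewrite tr_diag_mx /halfgram act_w !mulmx_diag; congr diag_mx; apply/rowP => k; rewrite !mxE.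
have m0 := @dscale_neq0 R n g; case: ifP => _; first by field.
by rewrite exprMn exprVn invfM invrK; move: (z 0 1 ^- 2) => u; field.
Qed.

(** The Gram matrix at [z] of the pullback of [halfgram] by [T]. *)
Definition pull (T : V -> V) (z : V) : 'M[R]_3 := pj T z *m halfgram (T z) *m (pj T z)^T.

(** Deck transformations are isometries. Hence the pullback of the metric to a
    chart does not depend on the chart of the atlas through which it is taken. *)
Lemma pull_act g (S T : V -> V) z : (\forall y \near z, S y = act g (T y)) ->
  differentiable T z -> pull S z = pull T z.
Proof.
move=> ST dT; have Ez : S z = act g (T z) by exact: (nbhs_singleton ST).
have EJ : pj S z = pj T z *m deck_lin g.
  rewrite -(pj_act g (T z)) -pj_comp//; last exact: differentiable_act.
  exact: pj_near_eq.
by rewrite /pull EJ Ez trmx_mul -(halfgram_act g (T z)) !mulmxA.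
Qed.

Definition chart_at (p : M) : chart R M 3 := s2val (cid2 (@sol_atlas_cover R n p)).

Lemma chart_at_atlas p : sol_atlas (chart_at p).
Proof. by rewrite /chart_at; case: cid2. Qed.

Lemma chart_at_dom p : cdom (chart_at p) p.
Proof. by rewrite /chart_at; case: cid2. Qed.

(** The metric is needed in all the charts of the maximal atlas, where it is pulled
    back by the change of coordinates to some chart of the atlas. *)
Definition solgram (c : chart R M 3) (z : V) : 'M[R]_3 :=
  pull (transition c (chart_at (cinv c z))) z.

Section SmoothChart.
Context (c : chart R M 3) (sc : smooth_chart c).

Lemma smooth_chart_near d z : sol_atlas d -> cimg c z -> cdom d (cinv c z) ->
  \forall y \near z, cimg c y /\ cdom d (cinv c y).
Proof.
move=> ad cz dz; have N2 : \forall y \near z, cdom d (cinv c y).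
  by apply: (cinv_cts cz); exact: (cdom_near dz).
exact: filterI (cimg_near cz) N2.
Qed.

Lemma smooth_chart_differentiable d z : sol_atlas d -> cimg c z -> cdom d (cinv c z) ->
  differentiable (transition c d) z.
Proof.
move=> ad cz dz; apply: differentiable_rowP => j.
apply: (@smooth_on_differentiable R 3 (cfun c @` (cdom c `&` cdom d))).
  by apply: open_image_cfun; exact: cdom_open.
  by exists (cinv c z); [split=> //; exact: cimg_cdom|exact: cimg_cfun].
by have [+ _] := sc ad; exact.
Qed.

Lemma smooth_chart_differentiable_inv d z : sol_atlas d -> cimg c z -> cdom d (cinv c z) ->
  differentiable (transition d c) (transition c d z).
Proof.
move=> ad cz dz; apply: differentiable_rowP => j.
apply: (@smooth_on_differentiable R 3 (cfun d @` (cdom d `&` cdom c))).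
  by apply: open_image_cfun; exact: cdom_open.
  by exists (cinv c z) => //; split=> //; exact: cimg_cdom.
by have [_ +] := sc ad; exact.
Qed.

Lemma transition_change d e z : sol_atlas d -> sol_atlas e -> cimg c z ->
  cdom d (cinv c z) -> cdom e (cinv c z) ->
  exists g, \forall y \near z, transition c e y = act g (transition c d y).
Proof.
move=> ad ae cz dz ez; have [g Wg] := atlas_transition ad ae dz ez; exists g.
pose S := [set v | [/\ cimg d v, cimg e (act g v) & transition d e v = act g v]].
have N : nbhs z (cinv c @^-1` (cfun d @^-1` S)).
  exact: (cinv_cts cz (cfun_cts dz Wg)).
apply: filterS2 (smooth_chart_near ad cz dz) N => y [cy dy] [_ _].
by rewrite /transition /= cfunK// => ->.
Qed.

Lemma solgramE d z : sol_atlas d -> cimg c z -> cdom d (cinv c z) ->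
  solgram c z = pull (transition c d) z.
Proof.
move=> ad cz dz.
have [g Eg] := transition_change ad (chart_at_atlas (cinv c z)) cz dz (chart_at_dom _).
exact: pull_act Eg (smooth_chart_differentiable ad cz dz).
Qed.

Lemma transition_half d z : sol_atlas d -> cimg c z -> cdom d (cinv c z) ->
  0 < transition c d z 0 1.
Proof. by move=> ad cz dz; apply: (atlas_half ad); exists (cinv c z). Qed.

Lemma solgram_smooth i j : smooth_on (cimg c) (fun z => solgram c z i j).
Proof.
move=> k; apply: Ck_on_local => z cz.
pose d := chart_at (cinv c z); have ad : sol_atlas d := chart_at_atlas _.
pose W := cfun c @` (cdom c `&` cdom d).
have oW : open W := @open_image_cfun R _ _ c _ (@cdom_open _ _ _ d).
have Wz : W z by exists (cinv c z); [split; [exact: cimg_cdom|exact: chart_at_dom]|exact: cimg_cfun].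
have WP y : W y -> cimg c y /\ cdom d (cinv c y).
  by move=> [x [cx dx] <-]; rewrite cfunK//; split=> //; exists x.
exists W, (fun y => pull (transition c d) y i j); split=> //; last first.
  by move=> y /WP[cy dy]; rewrite (solgramE ad cy dy).
have sT l : smooth_on W (fun y => transition c d y 0 l) by have [+ _] := sc ad; exact.
have sw : Ck_on k W (fun y => transition c d y 0 1) := sT 1 k.
have sw2 : Ck_on k W (fun y => transition c d y 0 1 ^+ 2).
  by apply: Ck_on_eq (Ck_onM oW sw sw) => // y _; rewrite expr2.
have sw2V : Ck_on k W (fun y => transition c d y 0 1 ^- 2).
  apply: Ck_onV => // y /WP[cy dy]; rewrite expf_neq0// gt_eqF//.
  exact: transition_half.
have -> : (fun y => pull (transition c d) y i j) = (fun y => \sum_l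
    (\sum_h 'D_(delta_mx 0 i) (fun y => transition c d y 0 h) y *
      ((if h == 0 then transition c d y 0 1 ^+ 2 else transition c d y 0 1 ^- 2) *+ (h == l)))
    * 'D_(delta_mx 0 j) (fun y => transition c d y 0 l) y).
  apply/funext => y; rewrite /pull mxE; apply: eq_bigr => l _.
  by rewrite !mxE; congr (_ * _); apply: eq_bigr => h _; rewrite !mxE.
apply: Ck_on_sum => // l; apply: Ck_onM => //; last exact: (Ck_on_derive j (sT l)).
apply: Ck_on_sum => // h; apply: Ck_onM => //; first exact: (Ck_on_derive i (sT h)).
case: (h == l); last by apply: Ck_on_eq (Ck_on_cst k W 0).
by case: (h == 0); [apply: Ck_on_eq sw2|apply: Ck_on_eq sw2V].
Qed.

Lemma solgram_sym z : cimg c z -> (solgram c z)^T = solgram c z.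
Proof. by move=> _; rewrite /solgram /pull !trmx_mul trmxK tr_diag_mx mulmxA. Qed.

Lemma solgram_pos z (v : V) : cimg c z -> v != 0 ->
  0 < (v *m solgram c z *m v^T) 0 0.
Proof.
move=> cz v0; pose d := chart_at (cinv c z); have ad : sol_atlas d := chart_at_atlas _.
have dz : cdom d (cinv c z) := chart_at_dom _.
pose T := transition c d; pose S := transition d c.
pose u : V := v *m pj T z.
(* the matrix of the reverse change of coordinates is inverse to [pj T z] *)
have u0 : u != 0.
  apply: contra_neq v0 => u0.
  have : v *m (pj T z *m pj S (T z)) = 0 by rewrite mulmxA -/u u0 mul0mx.
  rewrite -pj_comp; [|exact: smooth_chart_differentiable|exact: smooth_chart_differentiable_inv].
  have -> : pj (S \o T) z = pj id z.
    apply: pj_near_eq; apply: filterS (smooth_chart_near ad cz dz) => y [cy dy].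
    by rewrite /S /T /transition /= cfunK// cimg_cfun.
  by rewrite pj_id mulmx1.
have w0 := transition_half ad cz dz.
have -> : v *m solgram c z *m v^T = u *m halfgram (T z) *m u^T.
  by rewrite /solgram /pull -/d -/T trmx_mul !mulmxA.
rewrite mul_mx_diag mxE; clearbody u.
have pos k : 0 <= (if k == 0 then T z 0 1 ^+ 2 else T z 0 1 ^- 2 : R).
  by case: ifP => _; rewrite ?invr_ge0 exprn_ge0// ltW.
have pos' (k : 'I_3) : 0 < (if k == 0 then T z 0 1 ^+ 2 else T z 0 1 ^- 2 : R).
  by case: ifP => _; rewrite ?invr_gt0 exprn_gt0.
have /existsP[k uk] : [exists k, u 0 k != 0].
  apply: contraNT u0; rewrite negb_exists => /forallP H.
  by apply/eqP/rowP => k; have := H k; rewrite negbK => /eqP ->; rewrite mxE.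
rewrite (bigD1 k)//= ltr_wpDr//.
  by apply: sumr_ge0 => l _; rewrite !mxE mulrAC -expr2; apply: mulr_ge0; [exact: sqr_ge0|exact: pos].
rewrite !mxE mulrAC -expr2; apply: mulr_gt0; last exact: pos'.
by rewrite lt0r sqrf_eq0 uk sqr_ge0.
Qed.

End SmoothChart.

(** The chain rule for the changes from [c] to [d] and from [d] to a chart of the
    atlas around [x]. *)
Lemma solgram_transition (c d : chart R M 3) (x : M) :
  smooth_chart c -> smooth_chart d -> cdom c x -> cdom d x ->
  let J := jacobian (transition c d) (cfun c x) in
  solgram c (cfun c x) = J *m solgram d (cfun d x) *m J^T.
Proof.
move=> sc sd cx dx; pose e := chart_at x; have ae : sol_atlas e := chart_at_atlas _.
have ex : cdom e x := chart_at_dom _.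
have cz : cimg c (cfun c x) by exists x.
have dz : cimg d (cfun d x) by exists x.
have Ec : cinv c (cfun c x) = x by rewrite cfunK.
have Ed : cinv d (cfun d x) = x by rewrite cfunK.
have ce : cdom e (cinv c (cfun c x)) by rewrite Ec.
have de : cdom e (cinv d (cfun d x)) by rewrite Ed.
have Tx : transition c d (cfun c x) = cfun d x by rewrite /transition /= Ec.
have nz : \forall y \near cfun c x, [/\ cimg c y, cdom e (cinv c y) & cdom d (cinv c y)].
  have N : \forall y \near cfun c x, cdom d (cinv c y).
    by apply: (cinv_cts cz); rewrite Ec; exact: (cdom_near dx).
  by apply: filterS2 (smooth_chart_near ae cz ce) N => y [].
have dT : differentiable (transition c d) (cfun c x).
  apply: (@near_eq_differentiable _ _ _ _ (transition e d \o transition c e)).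
    by apply: filterS nz => y [cy ey dy]; rewrite /transition /= cfunK.
  apply: differentiable_comp; first exact: smooth_chart_differentiable.
  have -> : transition c e (cfun c x) = transition d e (cfun d x) by rewrite /transition /= Ec Ed.
  exact: smooth_chart_differentiable_inv.
move=> J; rewrite /J pj_jacobian// (solgramE sc ae cz ce) (solgramE sd ae dz de).
have -> : pull (transition c e) (cfun c x) = pull (transition d e \o transition c d) (cfun c x).
  rewrite /pull; congr (_ *m halfgram _ *m (_)^T).
  - by apply: pj_near_eq; apply: filterS nz => y [cy ey dy]; rewrite /transition /= cfunK.
  - by rewrite /transition /= Ec Ed.
  - by apply: pj_near_eq; apply: filterS nz => y [cy ey dy]; rewrite /transition /= cfunK.
rewrite /pull pj_comp//; last by rewrite Tx; exact: smooth_chart_differentiable.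
by rewrite /= Tx trmx_mul !mulmxA.
Qed.

Definition sol_metric : riemannian_metric M :=
  @RiemannianMetric R 3 M solgram
    (fun c i j sc => solgram_smooth sc i j) (fun c z sc => @solgram_sym c z)
    (fun c z v sc => @solgram_pos c sc z v) solgram_transition.

Lemma sol_metric_atlas (c : chart R M 3) z : sol_atlas c -> cimg c z ->
  sol_metric c z = halfgram z.
Proof.
move=> ac cz; rewrite [LHS](solgramE (sol_atlas_smooth_chart ac) ac cz (cimg_cdom cz)).
have E : \forall y \near z, transition c c y = id y.
  by apply: filterS (cimg_near cz) => y cy; exact: cimg_cfun.
by rewrite /pull (pj_near_eq E) pj_id (nbhs_singleton E) trmx1 mul1mx mulmx1.
Qed.

End Metric.

(** * The hyperbolic metric of the leaves *)

Section HyperbolicDistance.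
Context {R : realType}.
Local Notation V := 'rV[R]_3.

(** [cosh] of the distance from [u0] to [u] for the hyperbolic metric
    [w^2 dx^2 + w^-2 dw^2]. *)
Definition hcosh (u0 u : R * R) : R :=
  (u0.2 * u.2 * (u.1 - u0.1) ^+ 2 + u.2 / u0.2 + u0.2 / u.2) / 2.

Lemma hcosh_gt0 u0 u : 0 < u0.2 -> 0 < u.2 -> 0 < hcosh u0 u.
Proof.
move=> h0 h; apply: divr_gt0 => //; apply: ltr_wpDl; last exact: divr_gt0.
apply: addr_ge0; last by rewrite divr_ge0// ltW.
by apply: mulr_ge0; [rewrite mulr_ge0// ltW|exact: sqr_ge0].
Qed.

Lemma hcosh_refl u0 : 0 < u0.2 -> hcosh u0 u0 = 1.
Proof.
by move=> h0; rewrite /hcosh subrr expr0n mulr0 add0r mulfV ?gt_eqF// -[1 + 1]/2 mulfV.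
Qed.

Lemma hcosh_actu n g u0 u : 0 < u0.2 -> 0 < u.2 ->
  hcosh (actu n g u0) (actu n g u) = hcosh u0 u.
Proof.
move=> h0 h; have m0 := @dscale_neq0 R n g; rewrite /hcosh /actu /=.
by field; rewrite m0 !gt_eqF.
Qed.

(** The derivative of [hcosh u0] at [(x, w)] in the direction [(dx, dw)]. *)
Definition dhcosh (u0 : R * R) (x w dx dw : R) : R :=
  u0.2 * w * (x - u0.1) * dx +
  (u0.2 * (x - u0.1) ^+ 2 + u0.2^-1 - u0.2 / w ^+ 2) / 2 * dw.

Lemma is_derive_hcosh u0 (X W : R -> R) (s dx dw : R) : u0.2 != 0 -> W s != 0 ->
  is_derive s (1 : R) X dx -> is_derive s (1 : R) W dw ->
  is_derive s (1 : R) (fun s => hcosh u0 (X s, W s)) (dhcosh u0 (X s) (W s) dx dw).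
Proof.
move=> u00 W0 dX dW.
have dX0 : is_derive s (1 : R) (X - cst u0.1) (dx - 0) by exact: is_deriveB.
have dX2 := is_deriveM dX0 dX0.
have dXW := is_deriveM dW dX2.
have dV := is_deriveV W0 dW.
have D := is_deriveZ 2^-1 (is_deriveD (is_deriveD (is_deriveZ u0.2 dXW) (is_deriveZ u0.2^-1 dW))
   (is_deriveZ u0.2 dV)).
have -> : (fun s => hcosh u0 (X s, W s)) = 2^-1 \*: (u0.2 \*: (W * ((X - cst u0.1) * (X - cst u0.1)))
   + u0.2^-1 \*: W + u0.2 \*: (fun t => (W t)^-1)).
  apply/funext => t; rewrite /hcosh /= !fctE /= /GRing.scale /=; ring.
apply: (is_derive_eq D).
rewrite /dhcosh !fctE /= /GRing.scale /=; field.
by rewrite W0 u00.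
Qed.

(** The gradient of [cosh] of the distance has length [sinh], which is less than
    [cosh]. *)
Lemma dhcosh_le u0 x w dx dw : 0 < u0.2 -> 0 < w ->
  `|dhcosh u0 x w dx dw| <=
  hcosh u0 (x, w) * Num.sqrt (w ^+ 2 * dx ^+ 2 + w ^- 2 * dw ^+ 2).
Proof.
move=> h0 w0; have q0 : 0 < hcosh u0 (x, w) by exact: hcosh_gt0.
have n0 : 0 <= w ^+ 2 * dx ^+ 2 + w ^- 2 * dw ^+ 2.
  by rewrite addr_ge0// mulr_ge0 ?invr_ge0 ?sqr_ge0.
rewrite -[leLHS]sqrtr_sqr -[hcosh u0 _]gtr0_norm// -sqrtr_sqr -sqrtrM ?sqr_ge0//.
rewrite ler_wsqrtr//.
(* the components of the gradient in the orthonormal frame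
   [(w^-1 d/dx, w d/dw)] *)
pose A := u0.2 * (x - u0.1).
pose B := u0.2 * w * (x - u0.1) ^+ 2 / 2 + w / (2 * u0.2) - u0.2 / (2 * w).
have w_neq0 : w != 0 by rewrite gt_eqF.
have u_neq0 : u0.2 != 0 by rewrite gt_eqF.
have -> : dhcosh u0 x w dx dw = A * (w * dx) + B * (dw / w).
  by rewrite /dhcosh /A /B; field; rewrite w_neq0 u_neq0.
have -> : hcosh u0 (x, w) ^+ 2 = A ^+ 2 + B ^+ 2 + 1.
  by rewrite /hcosh /A /B /=; field; rewrite w_neq0 u_neq0.
have -> : w ^+ 2 * dx ^+ 2 + w ^- 2 * dw ^+ 2 = (w * dx) ^+ 2 + (dw / w) ^+ 2.
  by field.
move: A B (w * dx) (dw / w) => a b c d.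
rewrite -subr_ge0.
have -> : (a ^+ 2 + b ^+ 2 + 1) * (c ^+ 2 + d ^+ 2) - (a * c + b * d) ^+ 2 =
  (a * d - b * c) ^+ 2 + (c ^+ 2 + d ^+ 2) by ring.
by rewrite !addr_ge0 ?sqr_ge0.
Qed.

Lemma halfgram_speed (z v : V) : (v *m halfgram z *m v^T) 0 0 =
  z 0 1 ^+ 2 * v 0 0 ^+ 2 + z 0 1 ^- 2 * v 0 1 ^+ 2 + z 0 1 ^- 2 * v 0 ord_max ^+ 2.
Proof.
rewrite mul_mx_diag mxE !big_ord_recl big_ord0 !mxE /=.
rewrite (_ : lift ord0 ord0 = 1 :> 'I_3); last exact/val_inj.
rewrite (_ : lift ord0 (lift ord0 ord0) = ord_max :> 'I_3); last exact/val_inj.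
by rewrite addr0 addrA /=; congr (_ + _ + _); rewrite mulrAC -expr2 mulrC.
Qed.

(** The function [ln cosh] of the distance is 1-Lipschitz, and it differs from the
    distance by at most [ln 2]. It thus bounds lengths from below up to a constant,
    which is all that is needed, and it does so without geodesics. *)
Lemma ln_hcosh_curve u0 (gamma : R -> V) : 0 < u0.2 ->
  C1_curve gamma -> (forall s, `[0, 1]%classic s -> 0 < gamma s 0 1) ->
  ln (hcosh u0 (leafc (gamma 1))) - ln (hcosh u0 (leafc (gamma 0))) <=
  \int[lebesgue_measure]_(s in `[0, 1])
    Num.sqrt ((derive1 gamma s *m halfgram (gamma s) *m (derive1 gamma s)^T) 0 0).
Proof.
move=> h0 [dg cg] gpos.
pose X (s : R) : R := gamma s 0 0; pose W (s : R) : R := gamma s 0 1.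
pose dX (s : R) : R := derive1 gamma s 0 0; pose dW (s : R) : R := derive1 gamma s 0 1.
pose f (s : R) : R := ln (hcosh u0 (X s, W s)).
pose df (s : R) : R := dhcosh u0 (X s) (W s) (dX s) (dW s) / hcosh u0 (X s, W s).
pose sp (s : R) : R := Num.sqrt ((derive1 gamma s *m halfgram (gamma s) *m (derive1 gamma s)^T) 0 0).
have dcoord (s : R) i : is_derive s (1 : R) (fun t => gamma t 0 i) (derive1 gamma s 0 i).
  have dgi : derivable (fun t => gamma t 0 i) s 1 by move: (dg s) => /derivable_mxP.
  split => //; rewrite derive1E derive_mx; last exact: dg.
  by rewrite mxE.
have ccoord i : continuous (fun t => gamma t 0 i).
  by move=> s; apply/differentiable_continuous/derivable1_diffP; have [] := dcoord s i.
have cdcoord i : continuous (fun t => derive1 gamma t 0 i).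
  by move=> s; exact: (continuous_comp (cg s) (@coord_continuous R 1 3 0 i _)).
have q0 (s : R) : `[0, 1]%classic s -> 0 < hcosh u0 (X s, W s).
  by move=> s01; apply: hcosh_gt0 => //; exact: gpos.
have fD (s : R) : `[0, 1]%classic s -> is_derive s (1 : R) f (df s).
  move=> s01; rewrite /df mulrC.
  apply: (is_derive1_comp (f := @ln R) (g := fun s => hcosh u0 (X s, W s))).
    exact/is_derive1_ln/q0.
  apply: is_derive_hcosh; [by rewrite gt_eqF|by rewrite gt_eqF//; exact: gpos].
have cX : continuous X := ccoord 0. have cW : continuous W := ccoord 1.
have cdX : continuous dX := cdcoord 0. have cdW : continuous dW := cdcoord 1.
have cWV (s : R) : `[0, 1]%classic s -> {for s, continuous (fun t => (W t)^-1)}.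
  by move=> s01; apply: continuousV; [rewrite gt_eqF//; exact: gpos|exact: cW].
have cq (s : R) : `[0, 1]%classic s -> {for s, continuous (fun t => hcosh u0 (X t, W t))}.
  move=> s01; apply/differentiable_continuous/derivable1_diffP.
  have [] // := @is_derive_hcosh u0 X W s _ _ _ _ (dcoord s 0) (dcoord s 1).
    by rewrite gt_eqF.
  by rewrite gt_eqF//; exact: gpos.
have cdf : {within `[0, 1], continuous df}.
  apply: continuous_in_subspaceT => s; rewrite inE => s01.
  rewrite /continuous_at /df /dhcosh.
  apply: cvgM; last by apply: cvgV; [rewrite gt_eqF//; exact: q0|exact: cq].
  have cXu : {for s, continuous (fun t => X t - u0.1)}.
    by apply: cvgB; [exact: cX|exact: cvg_cst].
  apply: cvgD.
    apply: cvgM; last exact: cdX.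
    apply: cvgM; last exact: cXu.
    by apply: cvgM; [exact: cvg_cst|exact: cW].
  apply: cvgM; last exact: cdW.
  apply: cvgM; last exact: cvg_cst.
  suff : {for s, continuous (fun t => u0.2 * (X t - u0.1) ^+ 2 + u0.2^-1 - u0.2 / W t ^+ 2)} by [].
  have -> : (fun t => u0.2 * (X t - u0.1) ^+ 2 + u0.2^-1 - u0.2 / W t ^+ 2) =
    (fun t => u0.2 * ((X t - u0.1) * (X t - u0.1)) + u0.2^-1 - u0.2 * ((W t)^-1 * (W t)^-1)).
    by apply/funext => t; rewrite expr2 -exprVn expr2.
  apply: cvgB.
    apply: cvgD; last exact: cvg_cst.
    by apply: cvgM; [exact: cvg_cst|apply: cvgM; exact: cXu].
  by apply: cvgM; [exact: cvg_cst|apply: cvgM; exact: cWV].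
pose sp2 (t : R) : R := W t * W t * (dX t * dX t) +
    (W t)^-1 * (W t)^-1 * (dW t * dW t) +
    (W t)^-1 * (W t)^-1 * (derive1 gamma t 0 ord_max * derive1 gamma t 0 ord_max).
have spE : sp = Num.sqrt \o sp2.
  by apply/funext => t; rewrite /sp halfgram_speed -exprVn !expr2.
have csp : {within `[0, 1], continuous sp}.
  apply: continuous_in_subspaceT => s; rewrite inE => s01; rewrite spE.
  apply: (@continuous_comp _ _ _ sp2 Num.sqrt s); last exact: sqrt_continuous.
  rewrite /continuous_at /sp2.
  apply: cvgD; [apply: cvgD|]; apply: cvgM; apply: cvgM;
    try exact: cWV; by [exact: cW|exact: cdX|exact: cdW|exact: cdcoord].
have idf := continuous_compact_integrable (@segment_compact R 0 1) cdf.
have isp := continuous_compact_integrable (@segment_compact R 0 1) csp.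
have F01 : f 1 - f 0 = \int[lebesgue_measure]_(s in `[0, 1]) df s.
  rewrite /Rintegral (@continuous_FTC2 _ _ f)//.
    split.
    - by move=> s s01; have [] // := fD s; exact: subset_itv_oo_cc.
    - apply: cvg_at_right_filter; apply/differentiable_continuous/derivable1_diffP.
      by have [] // := fD 0; rewrite /= in_itv/= lexx ler01.
    - apply: cvg_at_left_filter; apply/differentiable_continuous/derivable1_diffP.
      by have [] // := fD 1; rewrite /= in_itv/= lexx ler01.
  by move=> s s01; rewrite derive1E; have [] // := fD s; exact: subset_itv_oo_cc.
rewrite -[X in X <= _]/(f 1 - f 0) F01; apply: le_Rintegral => // s s01.
rewrite /df ler_pdivrMr ?q0// mulrC; apply: le_trans (ler_norm _) _.
apply: le_trans (dhcosh_le _ _ _ h0 (gpos s s01)) _.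
rewrite ler_pM2l ?q0// ler_wsqrtr// halfgram_speed lerDl mulr_ge0 ?sqr_ge0//.
by rewrite invr_ge0 sqr_ge0.
Qed.

End HyperbolicDistance.

(** * Lengths of paths in the leaves *)

Section LeafPaths.
Context {R : realType} (n : nat).
Local Notation V := 'rV[R]_3.
Local Notation half := (@half R).
Local Notation act := (@act R n).
Local Notation P := (@solproj R n).
Local Notation M := (@sol_manifold R n).
Local Notation F := (@sol_foliation R n).
Local Notation g := (@sol_metric R n).

(** The outcome of lifting to the half space a path of length [l] from the
    projection of [z] to [p']. The bound is required for all the centres [u0]
    because the lifts of the successive arcs are fitted together by deck
    transformations, which move the centre. *)
Definition lifts (z : V) (p' : M) (l : R) := exists z', [/\ half z', P z' = p',
  ycoord z' = ycoord z & forall u0, 0 < u0.2 ->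
  ln (hcosh u0 (leafc z')) - ln (hcosh u0 (leafc z)) <= l].

Lemma arc_lifts (z : V) (p' : M) l : half z -> leaf_arc F g (P z) p' l -> lifts z p' l.
Proof.
move=> hz [c [gamma [[ac' cgamma] g01 Ez Ep' El]]]; have ac : sol_atlas c := ac'.
rewrite (atlas_cinv ac) in Ez Ep'.
have in0 : `[0, 1]%classic (0 : R) by rewrite /= in_itv/= lexx ler01.
have in1 : `[0, 1]%classic (1 : R) by rewrite /= in_itv/= lexx ler01.
have hg s : `[0, 1]%classic s -> half (gamma s) by move=> /g01[/(atlas_half ac)].
have [h Eh] := (@solproj_eq R n _ _ (hg 0 in0) hz).1 (esym Ez).
exists (act h (gamma 1)); split.
- by apply: act_half; exact: hg.
- by rewrite solproj_act ?Ep'//; exact: hg.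
- by rewrite -Eh !ycoord_act; have [_] := g01 1 in1; rewrite /ycoord => ->.
move=> u0 u00; have [h' [E1 _ E2 _]] := @deck_inv R n h.
have h'0 : 0 < (actu n h' u0).2 by exact: actu_gt0.
rewrite -Eh !leafc_act -(E2 u0) !(@hcosh_actu _ _ _ (actu n h' u0))//; last 2 first.
  exact: (hg 0 in0).
  exact: (hg 1 in1).
apply: le_trans (@ln_hcosh_curve R _ gamma h'0 cgamma hg) _.
rewrite El le_eqVlt; apply/orP; left; apply/eqP; apply: eq_Rintegral => s; rewrite inE => s01.
by rewrite sol_metric_atlas//; have [] := g01 s s01.
Qed.

Lemma path_lifts (z : V) (p p' : M) l : half z -> P z = p -> leaf_path F g p p' l ->
  lifts z p' l.
Proof.
move=> + + pth; elim: pth z => {p p' l} [p z hz Ez|p q p' l l' pq _ IH z hz Ez].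
  by exists z; split => // u0 _; rewrite subrr.
rewrite -Ez in pq.
have [z1 [hz1 Pz1 tz1 L1]] := arc_lifts hz pq.
have [z2 [hz2 Pz2 tz2 L2]] := IH z1 hz1 Pz1.
exists z2; split=> //; first by rewrite tz2.
by move=> u0 u00; have := L1 u0 u00; have := L2 u0 u00; lra.
Qed.

Lemma path_cat (p q r : M) l l' : leaf_path F g p q l -> leaf_path F g q r l' ->
  leaf_path F g p r (l + l').
Proof.
elim=> {p q l} [p|p q s l l1 pq _ IH] H; first by rewrite add0r.
by rewrite -addrA; apply: leaf_path_cons pq (IH H).
Qed.

Lemma arc_path (p q : M) l : leaf_arc F g p q l -> leaf_path F g p q l.
Proof. by move=> a; rewrite -[l]addr0; apply: leaf_path_cons a (leaf_path_nil _ _ _). Qed.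

(** The speed is constant, which makes the integral for the length trivial. *)
Lemma box_arc (c : V) X (hc : half c) (X0 : 0 < X) (x w dx dw : R -> R) (t l : R) :
  (forall s, is_derive s (1 : R) x (dx s)) -> (forall s, is_derive s (1 : R) w (dw s)) ->
  continuous dx -> continuous dw -> 0 <= l ->
  (forall s, 0 <= s <= 1 -> box c X (coord3 (x s, w s) t) /\
     w s ^+ 2 * dx s ^+ 2 + w s ^- 2 * dw s ^+ 2 = l ^+ 2) ->
  leaf_path F g (P (coord3 (x 0, w 0) t)) (P (coord3 (x 1, w 1) t)) l.
Proof.
move=> Dx Dw cx cw l0 xw; apply: arc_path.
pose gamma (s : R) : V := coord3 (x s, w s) t.
have Dg s : derivable gamma s 1 /\ derive1 gamma s = coord3 (dx s, dw s) 0.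
  have De i j : is_derive s (1 : R) (fun s => gamma s i j) (coord3 (dx s, dw s) 0 i j : R).
    have E : (fun s => gamma s i j) = (fun s => [:: x s; w s; t]`_j).
      by apply/funext => s'; rewrite /gamma mxE.
    rewrite mxE E; case: j {E} => [[|[|[|j]]] Hj] //=.
    exact: is_derive_cst.
  have dg : derivable gamma s 1 by apply/derivable_mxP => i j; have [] := De i j.
  split=> //; rewrite derive1E derive_mx//; apply/matrixP => i j.
  by rewrite mxE; have [_ ->] := De i j.
exists (box_chart n hc X0), gamma; split.
- split; first by exists c, X, hc, X0.
  split; first by move=> s; have [] := Dg s.
  have -> : derive1 gamma = (fun s => coord3 (dx s, dw s) 0) by apply/funext => s; have [] := Dg s.
  by move=> s; apply: continuous_coord3; [exact: cx|exact: cw|exact: cst_continuous].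
- move=> s; rewrite /= in_itv/= => s01; rewrite cimg_box_chart; split; first by have [] := xw s s01.
  by rewrite !mxE.
- by [].
- by [].
- rewrite -[LHS]mulr1 -[X in _ * X](_ : fine (@lebesgue_measure R `[0, 1]%classic) = 1); last first.
    by rewrite lebesgue_measure_itv /= lte_fin ltr01 oppr0 adde0.
  rewrite -Rintegral_cst//; apply: eq_Rintegral => s; rewrite inE/= in_itv/= => s01.
  have [bs sp] := xw s s01.
  have -> : solgram (box_chart n hc X0) (gamma s) = halfgram (gamma s).
    by apply: sol_metric_atlas; [exists c, X, hc, X0|rewrite cimg_box_chart].
  rewrite halfgram_speed; have [_ ->] := Dg s.
  by rewrite !mxE/= expr0n mulr0 addr0 sp sqrtr_sqr ger0_norm.
Qed.

(** A single chart suffices, since boxes are as wide as desired along the leaves. *)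
Lemma horizontal_path (x x' w t : R) : 0 < w ->
  leaf_path F g (P (coord3 (x, w) t)) (P (coord3 (x', w) t)) (w * `|x' - x|).
Proof.
move=> w0; pose c : V := coord3 (x, w) t.
have hc : half c by rewrite /half/= mxE.
pose X := `|x' - x| + 1; have X0 : 0 < X by rewrite ltr_wpDl.
have H := @box_arc c X hc X0 (fun s => x + s * (x' - x)) (fun=> w) (fun=> x' - x) (fun=> 0)
  t (w * `|x' - x|).
rewrite mul0r addr0 mul1r [x + (x' - x)]addrC subrK in H; apply: H.
- move=> s; have D := is_deriveD (is_derive_cst x s 1) (is_deriveM (is_derive_id s 1) (is_derive_cst (x' - x) s 1)).
  by apply: (is_derive_eq D); rewrite add0r scaler0 add0r [_ *: 1]mulr1.
- by move=> s; exact: cst_continuous.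
- by move=> s; exact: cst_continuous.
- by rewrite mulr_ge0// ltW.
move=> s /andP[s0 s1]; split.
  split; rewrite /c ?mxE/= ?ycoord_coord3.
  - rewrite addrAC subrr add0r normrM ger0_norm// /X.
    by apply: (@le_lt_trans _ _ `|x' - x|); [rewrite ler_piMl|rewrite ltrDl].
  - by apply/andP; split; lra.
  - by rewrite subrr normr0 invr_gt0 mulr_gt0.
by rewrite expr0n mulr0 addr0 exprMn real_normK ?num_real.
Qed.

(** A box spans a factor 2 of heights above and below its centre, and
    [expR (1 / 4) < 2]. *)
Lemma vertical_arc (x w t a : R) : 0 < w -> `|a| <= 4^-1 ->
  leaf_path F g (P (coord3 (x, w) t)) (P (coord3 (x, w * expR a) t)) `|a|.
Proof.
move=> w0 a2; pose c : V := coord3 (x, w) t.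
have hc : half c by rewrite /half/= mxE.
have H := @box_arc c 1 hc ltr01 (fun=> x) (fun s => w * expR (s * a)) (fun=> 0)
  (fun s => a * (w * expR (s * a))) t `|a|.
rewrite mul0r mul1r expR0 mulr1 in H.
have Dw s : is_derive s (1 : R) (fun s => w * expR (s * a)) (a * (w * expR (s * a))).
  have D1 := is_deriveM (is_derive_id s (1 : R)) (is_derive_cst a s (1 : R)).
  have D2 := @is_derive1_comp R expR (fun s => s * a) s _ _ (is_derive_expR (s * a)) D1.
  have D := is_deriveZ w D2.
  apply: (is_derive_eq D); rewrite /GRing.scale /=; ring.
apply: H => //.
- by move=> s; exact: cst_continuous.
- move=> s; have cws : {for s, continuous (fun t : R => w * expR (t * a))}.
    by apply/differentiable_continuous/derivable1_diffP; have [] := Dw s.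
  by apply: cvgM; [exact: cvg_cst|exact: cws].
move=> s /andP[s0 s1]; split.
  have e2 : expR 4^-1 < 2 :> R.
    have := expR_ge1Dx (- 4^-1 : R); rewrite expRN => e1.
    have e0 : 0 < expR (4^-1 : R) := expR_gt0 _.
    rewrite -ltf_pV2 ?posrE//; lra.
  have sa : `|s * a| <= 4^-1 by rewrite normrM ger0_norm// (le_trans _ a2)// ler_piMl.
  split; rewrite /c ?mxE/= ?ycoord_coord3 ?subrr ?normr0 ?invr_gt0 ?mulr_gt0//.
  move: sa; rewrite ler_norml => /andP[sa1 sa2].
  apply/andP; split; last first.
    by rewrite ltr_pM2l// (le_lt_trans _ e2)// ler_expR.
  rewrite ltr_pM2l//; apply: (@lt_le_trans _ _ (expR (- 4^-1))); last by rewrite ler_expR.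
  by rewrite expRN ltf_pV2 ?posrE ?expR_gt0.
have e0 : w * expR (s * a) != 0 by rewrite gt_eqF// mulr_gt0// expR_gt0.
rewrite expr0n mulr0 add0r real_normK ?num_real//.
by move: (w * expR (s * a)) e0 => e e0; field.
Qed.

Lemma vertical_path (x w t a : R) : 0 < w ->
  leaf_path F g (P (coord3 (x, w) t)) (P (coord3 (x, w * expR a) t)) `|a|.
Proof.
move=> w0; have step (b : R) k w' : `|b| <= 4^-1 -> 0 < w' ->
    leaf_path F g (P (coord3 (x, w') t)) (P (coord3 (x, w' * expR (k%:R * b)) t)) (k%:R * `|b|).
  move=> b4; elim: k w' => [|k IH] w' w'0.
    by rewrite !mul0r expR0 mulr1; exact: leaf_path_nil.
  have -> : k.+1%:R * `|b| = `|b| + k%:R * `|b| by rewrite -natr1 mulrDl mul1r addrC.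
  apply: path_cat (vertical_arc x t w'0 b4) _.
  have -> : w' * expR (k.+1%:R * b) = w' * expR b * expR (k%:R * b).
    by rewrite -mulrA -expRD -natr1 mulrDl mul1r addrC.
  by apply: IH; rewrite mulr_gt0// expR_gt0.
pose k := (Num.truncn (4 * `|a|)).+1.
have k0 : 0 < k%:R :> R by rewrite ltr0n.
have E1 : k%:R * (a / k%:R) = a by rewrite mulrC divfK ?gt_eqF.
have E2 : k%:R * `|a / k%:R| = `|a|.
  by rewrite normrM normfV (ger0_norm (ltW k0)) mulrC divfK ?gt_eqF.
have := @step (a / k%:R) k w; rewrite E1 E2; apply=> //.
rewrite -(ler_pM2l k0) E2 ler_pdivlMr// mulrC; apply: ltW.
exact: truncnS_gt.
Qed.

Lemma leaf_path_exists (u u' : R * R) (t : R) : 0 < u.2 -> 0 < u'.2 ->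
  leaf_path F g (P (coord3 u t)) (P (coord3 u' t))
    (u.2 * `|u'.1 - u.1| + `|ln u'.2 - ln u.2|).
Proof.
case: u u' => [x w] [x' w'] /= w0 w'0.
apply: path_cat (horizontal_path x x' t w0) _.
have := vertical_path x' t (ln w' - ln w) w0.
by rewrite expRD expRN !lnK ?posrE// mulrC divfK// gt_eqF.
Qed.

Lemma leafP z (p : M) : half z ->
  leaf F g (P z) p <-> exists z', [/\ half z', ycoord z' = ycoord z & P z' = p].
Proof.
move=> hz; split=> [[l /(path_lifts hz erefl)[z' [hz' Pz' tz' _]]]|[z' [hz' tz' <-]]].
  by exists z'.
rewrite -(coord3K z) -(coord3K z') tz'; eexists; exact: leaf_path_exists.
Qed.

(** At the centre [hcosh] is 1, so that at the end of a path of length [l] from the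
    centre it is at most [expR l]. *)
Lemma leaf_ball_hcosh z r (p : M) : half z -> leaf_ball F g (P z) r p ->
  exists z', [/\ half z', ycoord z' = ycoord z, P z' = p &
    hcosh (leafc z) (leafc z') < expR r].
Proof.
move=> hz; rewrite /leaf_ball /= /leaf_dist => /ereal_inf_lt[_ [l pl <-]].
rewrite lte_fin => lr; have [z' [hz' Pz' tz' L]] := path_lifts hz erefl pl.
exists z'; split => //; have := L (leafc z) hz; rewrite hcosh_refl// ln1 subr0 => lnl.
rewrite -[ltLHS]lnK ?posrE ?hcosh_gt0// ltr_expR; exact: le_lt_trans lr.
Qed.

Lemma leaf_ball_path (p q : M) l r : leaf_path F g p q l -> l < r ->
  leaf_ball F g p r q.
Proof.
move=> pq lr; rewrite /leaf_ball /= /leaf_dist.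
by apply: (@le_lt_trans _ _ l%:E); [apply: ereal_inf_lbound; exists l|rewrite lte_fin].
Qed.

End LeafPaths.

(** * Sums of measures and areas of plane sets *)

Section CountableSums.
Context {R : realType}.
Local Open Scope ereal_scope.

Lemma esum_exchange (I J : choiceType) (a : I -> J -> \bar R) :
  (forall i j, 0 <= a i j) ->
  \esum_(i in [set: I]) \esum_(j in [set: J]) a i j =
  \esum_(j in [set: J]) \esum_(i in [set: I]) a i j.
Proof.
move=> a0; rewrite !esum_esum//.
rewrite (reindex_esum ([set: J] `*`` (fun=> [set: I])) _ (fun p => (p.2, p.1)))//.
split; first by move=> [j i] _; split.
  by move=> [j i] [j' i'] _ _ [-> ->].
by move=> [i j] _; exists (j, i).
Qed.

Lemma esum_reindexT (I J : choiceType) (f : I -> J) (h : J -> I) (a : J -> \bar R) :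
  cancel f h -> cancel h f ->
  \esum_(j in [set: J]) a j = \esum_(i in [set: I]) a (f i).
Proof.
move=> fh hf; apply: reindex_esum; split=> //.
  by move=> i i' _ _ /(congr1 h); rewrite !fh.
by move=> j _; exists (h j).
Qed.

Section CountableUnion.
Context d (T : measurableType d) (mu : {measure set T -> \bar R}) (I : countType).
Context (X : I -> set T) (mX : forall i, measurable (X i)).

(** Transfers the family to the index set [nat] of sigma-additivity. *)
Let Xn (k : nat) : set T := if pickle_inv k is Some i then X i else set0.

Let mXn k : measurable (Xn k).
Proof. by rewrite /Xn; case: pickle_inv. Qed.

Let bigcup_Xn : \bigcup_k Xn k = \bigcup_i X i.
Proof.
apply/seteqP; split=> x [].
  by move=> k _; rewrite /Xn; case: pickle_inv => // i Xi; exists i.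
by move=> i _ Xi; exists (pickle i) => //; rewrite /Xn pickleK_inv.
Qed.

Let sum_Xn : \sum_(0 <= k <oo) mu (Xn k) = \esum_(i in [set: I]) mu (X i).
Proof.
rewrite nneseries_esumT//.
have -> : \esum_(i in [set: I]) mu (X i) = \esum_(k in range (@pickle I)) mu (Xn k).
  rewrite (@reindex_esum _ I nat [set: I] _ pickle).
    by apply: eq_esum => i _; rewrite /Xn pickleK_inv.
  split; [|by move=> i j _ _; exact: (pcan_inj pickleK)|].
    by move=> i _; exists i.
  by move=> k [i _ <-]; exists i.
rewrite [RHS]esum_mkcond; apply: eq_esum => k _.
case: ifPn => // /negP kI; rewrite /Xn; case E: pickle_inv => [i|]; last exact: measure0.
by exfalso; apply: kI; rewrite inE; exists i => //; have := @pickle_invK I k; rewrite E.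
Qed.

Lemma measure_le_esum : mu (\bigcup_i X i) <= \esum_(i in [set: I]) mu (X i).
Proof.
rewrite -sum_Xn -bigcup_Xn; apply: measure_sigma_subadditive => //.
exact: bigcupT_measurable.
Qed.

Lemma esum_measure_trivIset : trivIset setT X ->
  \esum_(i in [set: I]) mu (X i) = mu (\bigcup_i X i).
Proof.
move=> tX; rewrite -sum_Xn -bigcup_Xn measure_semi_bigcup//; last exact: bigcupT_measurable.
move=> k l _ _; rewrite /Xn.
case Ek: pickle_inv => [i|]; last by rewrite set0I => -[].
case El: pickle_inv => [j|]; last by rewrite setI0 => -[].
move=> /(tX i j Logic.I Logic.I) ij.
by have := @pickle_invK I k; have := @pickle_invK I l; rewrite Ek El /= ij => <-.
Qed.

End CountableUnion.
End CountableSums.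

Section Area.
Context {R : realType}.
Local Notation R2 := (measurableTypeR R * measurableTypeR R)%type.
Local Open Scope ereal_scope.

Definition area : set R2 -> \bar R :=
  (@lebesgue_measure R \x @lebesgue_measure R)%E.

HB.instance Definition _ := Measure.on area.

Lemma measurable_affine (a b : R) :
  measurable_fun setT (fun x : measurableTypeR R => (a * x + b)%R : measurableTypeR R).
Proof.
by apply: measurable_funD => //; exact: measurable_funM.
Qed.

Lemma lebesgue_affine (a b : R) (A : set (measurableTypeR R)) : (0 < a)%R -> measurable A ->
  lebesgue_measure ((fun x => (a * x + b)%R) @^-1` A) = a^-1%:E * lebesgue_measure A.
Proof.
move=> a0 mA; have a0' : (0 <= a)%R by exact: ltW.
pose f := fun x : measurableTypeR R => (a * x + b)%R : measurableTypeR R.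
have mf : measurable_fun setT f := measurable_affine a b.
pose m := mscale (NngNum a0') (measure_function_pushforward__canonical__measure_function_Measure (@lebesgue_measure R) mf).
have H : lebesgue_measure A = m A.
  apply: (lebesgue_measure_unique (mu := m)) => // _ [[x y] _ <-].
  change (lebesgue_measure `]x, y]%classic = a%:E * lebesgue_measure (f @^-1` `]x, y]%classic)).
  have -> : f @^-1` `]x, y]%classic = `]((x - b) / a)%R, ((y - b) / a)%R]%classic.
    apply/seteqP; split=> z /=; rewrite !in_itv/= ltr_pdivrMr// ler_pdivlMr//;
     by rewrite ltrBlDr lerBrDr mulrC.
  rewrite !lebesgue_measure_itv/= !lte_fin ltr_pM2r ?invr_gt0// ltrD2r.
  case: ifP => _; last by rewrite mule0.
  by rewrite -EFinB -EFinM -mulrBl opprB addrA subrK mulrC divfK ?gt_eqF.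
rewrite H; have -> : m A = a%:E * lebesgue_measure (f @^-1` A) by [].
rewrite muleA -EFinM mulVf ?gt_eqF// mul1e.
by [].
Qed.

Lemma measurable_actu n g :
  measurable_fun setT (actu n g : R2 -> R2).
Proof.
pose fx (x : measurableTypeR R) : measurableTypeR R := (dscale n g * x + lat1 n (dvec g))%R.
pose fw (w : measurableTypeR R) : measurableTypeR R := ((dscale n g)^-1 * w + 0)%R.
have m1 : measurable_fun setT (fx \o @fst (measurableTypeR R) (measurableTypeR R)).
  exact: (measurableT_comp (measurable_affine _ _) measurable_fst).
have m2 : measurable_fun setT (fw \o @snd (measurableTypeR R) (measurableTypeR R)).
  exact: (measurableT_comp (measurable_affine _ _) measurable_snd).
have -> : actu n g = (fun u : R2 => (fx u.1, fw u.2)).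
  by apply/funext => u; rewrite /actu /fx /fw addr0.
exact: (measurable_fun_pair m1 m2).
Qed.

Lemma measurable_preimage_actu n g (S : set R2) : measurable S ->
  measurable (actu n g @^-1` S).
Proof. by move=> mS; rewrite -[X in measurable X]setTI; exact: measurable_actu. Qed.

(** The factors of [x] and [w] are inverse to each other. *)
Lemma area_actu n g (S : set R2) : measurable S -> area (actu n g @^-1` S) = area S.
Proof.
move=> mS; have m0 := @dscale_gt0 R n g.
apply/esym/(product_measure_unique (m' :=
  measure_function_pushforward__canonical__measure_function_Measure area
    (measurable_actu n g))) => // A B mA mB.
pose fx (x : measurableTypeR R) : measurableTypeR R := (dscale n g * x + lat1 n (dvec g))%R.
pose fw (w : measurableTypeR R) : measurableTypeR R := ((dscale n g)^-1 * w + 0)%R.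
rewrite /= /pushforward (_ : actu n g @^-1` (A `*` B) = (fx @^-1` A) `*` (fw @^-1` B)); last first.
  by apply/seteqP; split=> u; rewrite /actu /fx /fw/= addr0.
rewrite /area product_measure1E.
- have v0 : (0 < (dscale n g)^-1 :> R)%R by rewrite invr_gt0.
  have Ex : lebesgue_measure (fx @^-1` A) = _ := lebesgue_affine (lat1 n (dvec g)) m0 mA.
  have Ew : lebesgue_measure (fw @^-1` B) = _ := lebesgue_affine 0 v0 mB.
  change (lebesgue_measure (fx @^-1` A) * lebesgue_measure (fw @^-1` B) =
    lebesgue_measure A * lebesgue_measure B).
  by rewrite Ex Ew invrK muleACA -EFinM mulVf ?gt_eqF// mul1e.
- by rewrite -[X in measurable X]setTI; exact: (measurable_affine _ _ measurableT).
- by rewrite -[X in measurable X]setTI; exact: (measurable_affine _ _ measurableT).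
Qed.

End Area.

(** * Areas of sets cut along the leaves *)

Section Slices.
Context {R : realType} (n : nat).
Local Notation V := 'rV[R]_3.
Local Notation half := (@half R).
Local Notation act := (@act R n).
Local Notation sol := (@sol R n).
Local Notation P := (@solproj R n).
Local Notation R2 := (measurableTypeR R * measurableTypeR R)%type.

Definition slice (B : set V) (t : R) : set R2 := [set u | B (coord3 u t)].

Lemma rat_ball_slice_measurable q t : measurable (slice (rat_ball q) t).
Proof.
have ballE u : slice (rat_ball q) t u =
    (0 < ratr q.2 :> R /\ forall i j, ball (rat_center q i j) (ratr q.2) (coord3 u t i j)) by [].
have [h|h] := pselect (`|ratr q.1.2 - t| < (ratr q.2 : R)); last first.
  rewrite (_ : slice _ _ = set0)//; apply/seteqP; split=> // u; rewrite ballE => -[_ bu]; apply: h.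
  by have := bu 0 ord_max; rewrite !mxE.
rewrite (_ : slice _ _ = ball (ratr q.1.1.1 : R) (ratr q.2) `*` ball (ratr q.1.1.2 : R) (ratr q.2)).
  by apply: measurableX; exact: measurable_ball.
apply/seteqP; split=> [u|[x w] [bx bw]].
  by rewrite ballE => -[_ bu]; split; [have := bu 0 0|have := bu 0 1]; rewrite !mxE.
rewrite ballE; split=> [|i j]; first by apply: le_lt_trans h.
by rewrite (ord1 i) !mxE; case: j => [[|[|[|j]]] Hj].
Qed.

Lemma open_slice_measurable (W : set V) t : open W -> measurable (slice W t).
Proof.
move=> oW.
pose X (q : rat_code) : set R2 := if `[< rat_cball q `<=` W >] then slice (rat_ball q) t else set0.
have -> : slice W t = \bigcup_q X q.
  apply/seteqP; split=> [u Wu|u [q _]].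
    have [q [qu qW]] := rat_ball_nbhs (open_nbhs_nbhs (conj oW Wu)).
    by exists q => //; rewrite /X asboolT.
  by rewrite /X; case: asboolP => // qW /rat_ball_sub/qW.
apply: countable_bigcupT_measurable; first exact: countableP.
by move=> q; rewrite /X; case: ifP => _ //; exact: rat_ball_slice_measurable.
Qed.

(** The measurability that the areas require. Besides Borel sets, the leaves have
    this property, as their preimages are unions of planes [y = t]. *)
Definition slice_measurable (A : set sol) :=
  forall t, measurable (slice (half `&` P @^-1` A) t).

Lemma borel_slice_measurable (A : set (borel sol)) : measurable A -> slice_measurable A.
Proof.
move=> mA t.
have mD : measurable (slice half t) by apply: open_slice_measurable; exact: half_open.
have mf : measurable_fun (slice half t) (fun u : R2 => P (coord3 u t) : borel sol).
  apply: (@measurability _ _ R2 (borel sol) (slice half t) (fun u : R2 => P (coord3 u t)) (@open sol)).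
    by [].
  by move=> _ [B oB <-]; exact: (@open_slice_measurable (half `&` P @^-1` B) t oB).
exact: mf.
Qed.

Lemma fundom_slice_measurable t : measurable (slice (fundom n) t).
Proof.
have cr : continuous (fun x : R => latr n x t).
  by move=> x; apply: cvgM; [apply: cvgB; [exact: cvg_id|exact: cvg_cst]|exact: cvg_cst].
have cs : continuous (fun x : R => lats n x t).
  by move=> x; apply: cvgB; [exact: cvg_id|apply: cvgM; [exact: cr|exact: cvg_cst]].
have mc (f : R -> R) : continuous f -> measurable ([set x : measurableTypeR R | 0 <= f x < 1]).
  move=> cf; have mf : measurable_fun setT (f : measurableTypeR R -> measurableTypeR R).
    exact: continuous_measurable_fun.
  have := mf measurableT `[0, 1[%classic (measurable_itv _); rewrite setTI.
  by congr measurable; apply/seteqP; split=> x /=; rewrite in_itv.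
rewrite (_ : slice _ _ = ([set x : measurableTypeR R | 0 <= latr n x t < 1] `&`
   [set x : measurableTypeR R | 0 <= lats n x t < 1]) `*` `[1, lam n[%classic).
  by apply: measurableX; [apply: measurableI; exact: mc|exact: measurable_itv].
apply/seteqP; split=> [[x w] []|[x w] [[h1 h2] h3]]; rewrite ?ycoord_coord3 ?mxE/=.
  by move=> h1 h2 h3; split => //=; rewrite in_itv.
by split; rewrite ?ycoord_coord3 ?mxE//=; move: h3; rewrite /= in_itv.
Qed.

Lemma slice_over_measurable (B : set V) (A : set sol) t : B `<=` half ->
  measurable (slice B t) -> slice_measurable A -> measurable (slice (B `&` P @^-1` A) t).
Proof.
move=> Bh mB mA; rewrite (_ : slice _ _ = slice B t `&` slice (half `&` P @^-1` A) t).
  by apply: measurableI; [exact: mB|exact: mA].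
apply/seteqP; split=> [u [Bu Au]|u [Bu [_ Au]]]; last by [].
by split=> //; split=> //; exact: Bh.
Qed.

Let act_slice g u t : act g (coord3 u t) = coord3 (actu n g u) (acty n g t).
Proof. by rewrite /act leafc_coord3 ycoord_coord3. Qed.

Local Open Scope ereal_scope.

(** The area of [A] along the leaves, if each point of [A] has one representative
    in [B]. *)
Definition sliced_area (B : set V) (A : set sol) : \bar R :=
  \esum_(t in [set: R]) area (slice (B `&` P @^-1` A) t).

(** Two sets that meet the orbits over [A] at most once, resp. at least once,
    are compared by cutting the first one along the translates of the second: the
    translates back to the second set of the pieces are disjoint, and they have
    the same areas. In particular the area does not depend on the choice of the
    representatives. *)
Lemma sliced_area_le (B1 B2 : set V) (A : set sol) :
  B1 `<=` half -> B2 `<=` half -> deck_injective n B1 ->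
  (forall t, measurable (slice B1 t)) -> (forall t, measurable (slice B2 t)) ->
  slice_measurable A -> A `<=` P @` B2 ->
  sliced_area B1 A <= sliced_area B2 A.
Proof.
move=> B1h B2h inj1 mB1 mB2 mA AB2.
have [inv invP] : exists inv : deck -> deck, forall g,
    [/\ forall u, actu n (inv g) (actu n g u) = u :> R * R,
    forall t, acty n (inv g) (acty n g t) = t :> R,
    forall u, actu n g (actu n (inv g) u) = u :> R * R &
    forall t, acty n g (acty n (inv g) t) = t :> R].
  by exists (fun g => sval (cid (@deck_inv R n g))) => g; case: cid.
pose Y g t : set R2 := slice (B2 `&` (half `&` P @^-1` A)) t `&`
  actu n (inv g) @^-1` slice B1 (acty n (inv g) t).
have mY g t : measurable (Y g t).
  apply: measurableI; last exact: measurable_preimage_actu.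
  by apply: measurableI; [exact: mB2|exact: mA].
have cover t : slice (B1 `&` P @^-1` A) t `<=`
    \bigcup_g actu n g @^-1` Y g (acty n g t).
  move=> u [B1u Au]; have hu := B1h _ B1u.
  have [z B2z Pz] := AB2 _ Au.
  have [g Eg] := (@solproj_eq R n _ _ hu (B2h _ B2z)).1 (esym Pz).
  exists g => //; rewrite /Y /slice /=; have [E1 E2 _ _] := invP g.
  rewrite E1 E2 -act_slice; split=> //; rewrite Eg; split=> //.
  by split; [exact: B2h|rewrite Pz].
apply: (@le_trans _ _ (\esum_(t in [set: R]) \esum_(g in [set: deck]) area (Y g (acty n g t)))).
  apply: le_esum => t _.
  apply: (@le_trans _ _ (area (\bigcup_g actu n g @^-1` Y g (acty n g t)))).
    apply: le_measure; rewrite ?inE//; first exact: slice_over_measurable.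
    apply: countable_bigcupT_measurable; first exact: countableP.
    by move=> g; exact: measurable_preimage_actu.
  apply: le_trans (measure_le_esum _ _) _; first by move=> g; exact: measurable_preimage_actu.
  apply: le_esum => g _; rewrite le_eqVlt; apply/orP; left; apply/eqP.
  exact: area_actu.
rewrite esum_exchange; last by move=> t g; exact: measure_ge0.
rewrite (_ : \esum_(g in _) _ = \esum_(g in [set: deck]) \esum_(t in [set: R]) area (Y g t)); last first.
  apply: eq_esum => g _; have [_ E1 _ E2] := invP g.
  by rewrite (esum_reindexT (fun t => area (Y g t)) E1 E2).
rewrite esum_exchange; last by move=> g t; exact: measure_ge0.
apply: le_esum => t _; rewrite esum_measure_trivIset//.
  apply: le_measure; rewrite ?inE//.
  - by apply: countable_bigcupT_measurable => //; exact: countableP.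
  - exact: slice_over_measurable.
  - by move=> u [g _ [[B2u [_ Au]] _]].
move=> g h _ _ [u [[[B2u _] B1g] [_ B1h']]].
have hu := B2h _ B2u.
pose zg := act (inv g) (coord3 u t); pose zh := act (inv h) (coord3 u t).
have B1zg : B1 zg by rewrite /zg act_slice.
have B1zh : B1 zh by rewrite /zh act_slice.
have [k Ek] := @act_comp R n (inv h) g.
have Ezh : act k zg = zh.
  rewrite Ek /zg /zh [X in act g X]act_slice (act_slice g); have [_ _ -> ->] := invP g.
  by [].
have Eact : act k zg = zg by apply: inj1 => //; rewrite Ezh.
have Einv : inv g = inv h.
  by apply: (@act_free R n _ _ _ hu); rewrite -/zg -/zh -Ezh Eact.
have [_ _ Eu Et] := invP g; have [_ _ Eu' Et'] := invP h.
apply: (@act_free R n _ _ zg); first exact: B1h.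
rewrite /zg {2}Einv !act_slice Eu Et.
by rewrite Eu' Et'.
Qed.

End Slices.

(** * The volume of the leaves *)

Section LeafVolume.
Context {R : realType} (n : nat).
Local Notation V := 'rV[R]_3.
Local Notation half := (@half R).
Local Notation act := (@act R n).
Local Notation sol := (@sol R n).
Local Notation P := (@solproj R n).
Local Notation M := (@sol_manifold R n).
Local Notation F := (@sol_foliation R n).
Local Notation g := (@sol_metric R n).
Local Notation R2 := (measurableTypeR R * measurableTypeR R)%type.
Local Notation sliced_area := (@sliced_area R n).
Local Notation fundom := (@fundom R n).
Local Open Scope ereal_scope.

Lemma half_coord3 (u : R * R) (t : R) : half (coord3 u t) = (0 < u.2)%R :> Prop.
Proof. by rewrite /half/= mxE. Qed.

Lemma leaf_coord3 z (u : R * R) t : half z -> (0 < u.2)%R ->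
  leaf F g (P z) (P (coord3 u t)) <-> exists h, acty n h (ycoord z) = t.
Proof.
move=> hz u0; rewrite leafP//; split.
  move=> [z' [hz' tz' Pz']]; have hu : half (coord3 u t) by rewrite half_coord3.
  have [h Eh] := (@solproj_eq R n _ _ hz' hu).1 Pz'.
  by exists h; rewrite -tz' -ycoord_act Eh ycoord_coord3.
move=> [h Eh]; have [h' [_ _ E1 _]] := @deck_inv R n h.
exists (coord3 (actu n h' u) (ycoord z)); split.
- by rewrite half_coord3; exact: actu_gt0.
- by rewrite ycoord_coord3.
rewrite -(@solproj_act R n h) ?half_coord3; last exact: actu_gt0.
by rewrite /act leafc_coord3 ycoord_coord3 E1 Eh.
Qed.

Lemma slice_measurable_leaf (p : sol) (A : set sol) : slice_measurable A ->
  slice_measurable (A `&` leaf F g p).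
Proof.
move=> mA t; have [z hz <-] := solproj_surj p.
have [h|h] := pselect (exists h, acty n h (ycoord z) = t).
  rewrite (_ : slice _ t = slice (half `&` P @^-1` A) t)//.
  apply/seteqP; split=> [u [hu [Au _]]|u [hu Au]]; first by [].
  by split=> //; split=> //; apply/leaf_coord3 => //; rewrite half_coord3 in hu.
rewrite (_ : slice _ t = set0)//; apply/seteqP; split=> // u [hu [_ lu]].
by apply/h/(leaf_coord3 (u := u)) => //; rewrite half_coord3 in hu.
Qed.

(** The area element of the leaves is [dx dw]. *)
Lemma det_halfgram_leaf (u : R * R) t : (0 < u.2)%R ->
  (\det (row' ord_max (col' ord_max (halfgram (coord3 u t)))) = 1)%R.
Proof.
move=> u0; pose d : 'rV[R]_2 := (\row_k (if k == 0 then u.2 ^+ 2 else u.2 ^- 2))%R.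
transitivity (\det (diag_mx d)); last first.
  by rewrite det_diag !big_ord_recl big_ord0 !mxE/= mulr1 mulfV// expf_neq0// gt_eqF.
congr (\det _); apply/matrixP => i j; rewrite !mxE.
rewrite (inj_eq lift_inj); congr (_ *+ _)%R.
by case: i => [[|[|i]] Hi].
Qed.

Definition leaf_vol (p : sol) (A : set (borel sol)) : \bar R :=
  sliced_area fundom (A `&` leaf F g p).

Section LeafVolMeasure.
Context (p : sol).

Let leaf_vol0 : leaf_vol p set0 = 0.
Proof.
rewrite /leaf_vol /sliced_area esum1// => t _.
by rewrite set0I preimage_set0 setI0 (_ : slice _ _ = set0) ?measure0.
Qed.

Let leaf_vol_ge0 A : 0 <= leaf_vol p A.
Proof. by apply: esum_ge0 => t _; exact: measure_ge0. Qed.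

Let leaf_vol_sigma_additive : semi_sigma_additive (leaf_vol p).
Proof.
move=> X mX tX mUX.
have E : leaf_vol p (\bigcup_k X k) = \sum_(0 <= k <oo) leaf_vol p (X k).
  have Et t : area (slice (fundom `&` P @^-1` (\bigcup_k X k `&` leaf F g p)) t) =
      \esum_(k in [set: nat]) area (slice (fundom `&` P @^-1` (X k `&` leaf F g p)) t).
    have mXk k : measurable (slice (fundom `&` P @^-1` (X k `&` leaf F g p)) t).
      apply: slice_over_measurable (@fundom_half R n) (fundom_slice_measurable n t) _.
      apply: slice_measurable_leaf.
      by apply: borel_slice_measurable; exact: mX.
    rewrite -nneseries_esumT//.
    rewrite -measure_semi_bigcup//; last exact: bigcupT_measurable.
      congr area; apply/seteqP; split=> [u [Fu [[k _ Xu] lu]]|u [k _ [Fu [Xu lu]]]].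
        by exists k.
      by split=> //; split=> //; exists k.
    by move=> i j _ _ [u [[_ [Xi _]] [_ [Xj _]]]]; apply: (tX i j) => //; eexists; split; [exact: Xi|exact: Xj].
  rewrite /leaf_vol /sliced_area (eq_esum (fun t _ => Et t)) esum_exchange; last first.
    by move=> t k; exact: measure_ge0.
  by rewrite nneseries_esumT// => k; exact: leaf_vol_ge0.
by rewrite E; apply: is_cvg_nneseries => k _ _; exact: leaf_vol_ge0.
Qed.

HB.instance Definition _ := isMeasure.Build _ _ _ (leaf_vol p)
  leaf_vol0 leaf_vol_ge0 leaf_vol_sigma_additive.

End LeafVolMeasure.

Definition leaf_volume (p : M) : {measure set (borel M) -> \bar R} := leaf_vol p.

(** Over a subset of the domain of a chart, the box of the chart provides
    representatives as well as the fundamental domain does. *)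
Lemma leaf_volumeP (p : M) : is_leaf_volume F g p (leaf_volume p).
Proof.
move=> _ A [c [X [hc [X0 ->]]]] mA AD.
pose A' := A `&` leaf F g p.
have mA' : slice_measurable A'.
  by apply: slice_measurable_leaf; exact: borel_slice_measurable.
have mbox t : measurable (slice (box c X) t) by apply: open_slice_measurable; exact: open_box.
have bh : box c X `<=` half by exact: box_half.
have fh := @fundom_half R n.
transitivity (sliced_area (box c X) A').
  apply/eqP; rewrite eq_le; apply/andP; split.
    apply: sliced_area_le => //; [exact: fundom_deck_injective|exact: fundom_slice_measurable|].
    by move=> q [/AD].
  apply: sliced_area_le => //; [exact: box_deck_injective|exact: fundom_slice_measurable|].
  by move=> q _; have [z Fz Pz] := solproj_surj_fundom q; exists z.
apply: eq_esum => t _.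
rewrite (_ : [set u | _] = slice (box c X `&` P @^-1` A') t); last first.
  by rewrite /slice cimg_box_chart.
set S := slice _ t.
have mS : measurable S by exact: slice_over_measurable.
transitivity (\int[area]_(u in S) 1); first by rewrite integral_cst// mul1e.
apply: eq_integral => u; rewrite inE => -[bu _]; congr EFin.
have hu : (0 < u.2)%R by have := bh _ bu; rewrite half_coord3.
rewrite /leaf_density (_ : sol_metric n _ _ = halfgram (coord3 u t)); last first.
  by apply: sol_metric_atlas; [exists c, X, hc, X0|rewrite cimg_box_chart].
by rewrite det_halfgram_leaf// sqrtr1.
Qed.

(** A leaf of the quotient may be a quotient of a plane, in which case the
    projection does not preserve areas globally. *)
Lemma leaf_vol_image z (S : set R2) (A := P @` [set z' | ycoord z' = ycoord z /\ S (leafc z')]) :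
  half z -> measurable S -> S `<=` [set u | (0 < u.2)%R] -> slice_measurable A ->
  leaf_vol (P z) A <= area S /\
  (deck_injective n [set z' | ycoord z' = ycoord z /\ S (leafc z')] -> leaf_vol (P z) A = area S).
Proof.
move=> hz mS S0 mA; pose B := [set z' : V | ycoord z' = ycoord z /\ S (leafc z')].
have Bh : B `<=` half by move=> z' [_ /S0].
have sB t : slice B t = if t == ycoord z then S else set0.
  apply/seteqP; split=> u; rewrite /slice /B/= ycoord_coord3 leafc_coord3.
    by move=> [-> ?]; rewrite eqxx.
  by case: eqP => // ->.
have mB t : measurable (slice B t) by rewrite sB; case: ifP.
have Al : A `&` leaf F g (P z) = A.
  apply/seteqP; split=> [p []//|p Ap]; split=> //.
  case: Ap => z' [tz' Sz'] <-; apply/leafP => //; exists z'; split=> //; exact: Bh.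
have EB : sliced_area B A = area S.
  have Et t : area (slice (B `&` P @^-1` A) t) = if t \in [set ycoord z] then area S else 0.
    rewrite (_ : slice _ _ = slice B t); last first.
      by apply/seteqP; split=> [u []//|u Bu]; split=> //; exists (coord3 u t).
    rewrite sB; case: eqP => [->|tz]; first by rewrite mem_set.
    by rewrite memNset ?measure0.
  rewrite /sliced_area (eq_esum (fun t _ => Et t)) -esum_mkcond esum_set1//.
have mf := @fundom_slice_measurable R n; have fh := @fundom_half R n.
have le1 : leaf_vol (P z) A <= area S.
  rewrite /leaf_vol Al -EB; apply: sliced_area_le => //.
  exact: fundom_deck_injective.
split=> // injB; apply/eqP; rewrite eq_le le1 /=.
rewrite /leaf_vol Al -EB; apply: sliced_area_le => //.
by move=> q _; have [z' Fz Pz] := solproj_surj_fundom q; exists z'.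
Qed.

End LeafVolume.

(** * Averages and leaf balls *)

Section Average.
Context {R : realType}.

Lemma bounded_integrable d (T : measurableType d) (mu : {measure set T -> \bar R})
    (B : set T) (h : T -> R) M :
  measurable B -> (mu B < +oo)%E -> measurable_fun B h -> (forall x, `|h x| <= M) ->
  mu.-integrable B (EFin \o h).
Proof.
move=> mB Boo mh hM; apply: measurable_bounded_integrable => //.
exists M; split; first exact: num_real.
by move=> M' MM' x _; exact: le_trans (hM x) (ltW MM').
Qed.

(** On [B] the function is at least [1 / 2 - 3 / 2 * \1_L], and [L] has at most a
    quarter of the measure. *)
Lemma average_ge d (T : measurableType d) (mu : {measure set T -> \bar R})
    (B L : set T) (f : T -> R) :
  measurable B -> measurable L -> (0 < mu B < +oo)%E -> measurable_fun B f ->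
  (forall x, `|f x| <= 1) -> (forall x, B x -> ~ L x -> 2^-1 <= f x) ->
  (4%:E * mu L <= mu B)%E ->
  8^-1 <= (\int[mu]_(x in B) f x) / fine (mu B).
Proof.
move=> mB mL /andP[B0 Boo] mf f1 fB LB.
have iN h M := @bounded_integrable _ T mu B h M mB Boo.
have if_ := iN f 1 mf f1.
have m1 : measurable_fun B (\1_L : T -> R) by exact: measurable_indic.
have i1 : mu.-integrable B (EFin \o (\1_L : T -> R)).
  by apply: (iN _ 1) => // x; rewrite indicE; case: (_ \in _); rewrite ?normr1 ?normr0.
have ic (c : R) : mu.-integrable B (EFin \o cst c).
  by apply: (iN _ `|c|).
have iz : mu.-integrable B (EFin \o (fun x => 3 / 2 * (\1_L x : R))).
  apply: (iN _ (3 / 2)); first by apply: measurable_funM.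
  move=> x; rewrite indicE; case: (_ \in _); rewrite ?mulr1 ?mulr0 ?normr0; last by lra.
  by rewrite ger0_norm; lra.
have ih : mu.-integrable B (EFin \o (fun x => 2^-1 - 3 / 2 * (\1_L x : R))).
  apply: (iN _ 2); first by apply: measurable_funB => //; exact: measurable_funM.
  move=> x; rewrite indicE; case: (_ \in _); rewrite ?mulr1 ?mulr0 ler_norml; lra.
pose b := fine (mu B); pose l := fine (mu (L `&` B)).
have bE : mu B = b%:E by rewrite fineK// ge0_fin_numE.
have b0 : 0 < b by rewrite -lte_fin -bE.
have LBle : (mu (L `&` B) <= mu L)%E.
  by apply: le_measure; rewrite ?inE//; exact: measurableI.
have LBoo : (mu (L `&` B) < +oo)%E.
  apply: le_lt_trans Boo; apply: le_measure; rewrite ?inE//.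
  exact: measurableI.
have lE : mu (L `&` B) = l%:E by rewrite fineK// ge0_fin_numE.
have lb : 4 * l <= b.
  rewrite -lee_fin -bE EFinM -lE; apply: le_trans LB.
  by apply: lee_wpmul2l => //; rewrite lee_fin.
have : \int[mu]_(x in B) (2^-1 - 3 / 2 * (\1_L x : R)) <= \int[mu]_(x in B) f x.
  apply: le_Rintegral => // x Bx; rewrite indicE.
  have [Lx|/negP nLx] := boolP (x \in L).
    by have := f1 x; rewrite mulr1 ler_norml; lra.
  by rewrite mulr0 subr0; apply: fB => // Lx; apply: nLx; rewrite inE.
rewrite RintegralB// ?RintegralZl// ?Rintegral_cst//; last exact: (ic 2^-1).
have -> : \int[mu]_(x in B) \1_L x = l by rewrite /Rintegral integral_indic.
rewrite -/b => fl; rewrite ler_pdivlMr//; lra.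
Qed.

Lemma average_le d (T : measurableType d) (mu : {measure set T -> \bar R})
    (B L : set T) (f : T -> R) :
  measurable B -> measurable L -> (0 < mu B < +oo)%E -> measurable_fun B f ->
  (forall x, `|f x| <= 1) -> (forall x, B x -> ~ L x -> f x <= - 2^-1) ->
  (4%:E * mu L <= mu B)%E ->
  (\int[mu]_(x in B) f x) / fine (mu B) <= - 8^-1.
Proof.
move=> mB mL B0 mf f1 fB LB; have /andP[_ Boo] := B0.
have := @average_ge _ T mu B L (fun x => -1 * f x) mB mL B0.
rewrite RintegralZl//; last exact: (@bounded_integrable _ T mu B f 1).
rewrite mulN1r mulNr lerNr; apply=> //.
- exact: measurable_funM.
- by move=> x; rewrite normrM normrN1 mul1r.
- by move=> x Bx Lx; rewrite mulN1r lerNr; exact: fB.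
Qed.

End Average.

Section LeafSets.
Context {R : realType} (n : nat).
Local Notation V := 'rV[R]_3.
Local Notation half := (@half R).
Local Notation sol := (@sol R n).
Local Notation P := (@solproj R n).
Local Notation F := (@sol_foliation R n).
Local Notation g := (@sol_metric R n).

Definition plane_part (W : set V) (t : R) : set V := [set z | ycoord z = t /\ W z].

Lemma ycoord_continuous : continuous (ycoord : V -> R).
Proof. by move=> z; exact: coord_continuous. Qed.

(** The set is a countable union of images of compact sets. *)
Lemma plane_part_measurable (W : set V) t : open W -> W `<=` half ->
  measurable (P @` plane_part W t : set (borel sol)).
Proof.
move=> oW Wh.
pose X (q : rat_code) : set (borel sol) := if `[< rat_cball q `<=` W >]
  then P @` (rat_cball q `&` [set z | ycoord z = t]) else set0.
have -> : P @` plane_part W t = \bigcup_q X q.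
  apply/seteqP; split=> [_ [z [tz Wz] <-]|p [q _]].
    have [q [qz qW]] := rat_ball_nbhs (open_nbhs_nbhs (conj oW Wz)).
    by exists q => //; rewrite /X asboolT//; exists z => //; split=> //; exact: rat_ball_sub.
  by rewrite /X; case: asboolP => // qW [z [/qW Wz tz] <-]; exists z.
apply: countable_bigcupT_measurable; first exact: countableP.
move=> q; rewrite /X; case: asboolP => // qW.
have cq : closed (P @` (rat_cball q `&` [set z | ycoord z = t]) : set sol).
  apply: compact_closed; first exact: sol_hausdorff.
  apply: continuous_compact.
    apply: continuous_in_subspaceT => z; rewrite inE => -[/qW/Wh hz _].
    exact: solproj_continuous.
  apply: compact_closedI; first exact: rat_cball_compact.
  rewrite (_ : [set z | _] = ycoord @^-1` [set t]); last by [].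
  by apply: closed_comp; [move=> z _; exact: ycoord_continuous|exact: closed_eq].
rewrite -[X in measurable X]setCK; apply: measurableC.
by apply: sub_sigma_algebra; exact: closed_openC.
Qed.

Lemma plane_part_area z (W : set V) : half z -> open W -> W `<=` half ->
  let A := P @` plane_part W (ycoord z) in
  let S := slice W (ycoord z) in
  (leaf_volume (P z) A <= area S)%E /\
  (deck_injective n (plane_part W (ycoord z)) -> leaf_volume (P z) A = area S).
Proof.
move=> hz oW Wh A S; have mA := plane_part_measurable (ycoord z) oW Wh.
have E : plane_part W (ycoord z) = [set z' | ycoord z' = ycoord z /\ S (leafc z')].
  apply/seteqP; split=> z' [tz']; rewrite /S /slice/= -tz' coord3K; by split.
have := @leaf_vol_image R n z S hz.
rewrite -E; apply.
- exact: open_slice_measurable.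
- by move=> u Su; have := Wh _ Su; rewrite half_coord3.
- exact: borel_slice_measurable.
Qed.

(** The lifts of the ball form an open subset of a plane, because a path can be
    extended by a short path to any point near its end. *)
Lemma leaf_ball_plane z r : half z ->
  exists W, [/\ open W, W `<=` half & leaf_ball F g (P z) r = P @` plane_part W (ycoord z)].
Proof.
move=> hz; pose W := [set z' | half z' /\ leaf_ball F g (P z) r (P (coord3 (leafc z') (ycoord z)))].
exists W; split; last 1 first.
- apply/seteqP; split=> [p bp|_ [z' [tz' [hz' bz']] <-]]; last by rewrite -tz' coord3K in bz'.
  have [z' [hz' tz' Pz' _]] := leaf_ball_hcosh hz bp.
  by exists z' => //; split=> //; split=> //; rewrite -tz' coord3K Pz'.
- rewrite openE => z' [hz' bz'].
  move: bz'; rewrite /leaf_ball /= /leaf_dist => /ereal_inf_lt[_ [l pl <-]].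
  rewrite lte_fin => lr.
  have w0 : 0 < z' 0 1 := hz'.
  pose dl (y : V) : R := z' 0 1 * `|y 0 0 - z' 0 0| + `|ln (y 0 1) - ln (z' 0 1)|.
  have cdl : {for z', continuous dl}.
    apply: continuousD.
      apply: continuousM; first exact: cst_continuous.
      apply: (@continuous_comp _ _ _ (fun y : V => y 0 0 - z' 0 0) Num.norm); last exact: norm_continuous.
      by apply: continuousB; [exact: coord_continuous|exact: cst_continuous].
    apply: (@continuous_comp _ _ _ (fun y : V => ln (y 0 1) - ln (z' 0 1)) Num.norm); last exact: norm_continuous.
    apply: continuousB; last exact: cst_continuous.
    apply: (@continuous_comp _ _ _ (fun y : V => y 0 1) (@ln R)); first exact: coord_continuous.
    exact: continuous_ln.
  have dl0 : dl z' = 0 by rewrite /dl !subrr !normr0 mulr0 addr0.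
  have N1 : \forall y \near z', dl y < r - l.
    have := cvgr_lt (dl z') cdl; apply; rewrite dl0 subr_gt0//.
  have N2 : \forall y \near z', half y by apply: open_nbhs_nbhs; split => //; exact: half_open.
  apply: filterS2 N1 N2 => y dly hy; split => //.
  have hy0 : 0 < y 0 1 := hy.
  have py := @leaf_path_exists R n (leafc z') (leafc y) (ycoord z) hz' hy.
  apply: leaf_ball_path (path_cat pl py) _; rewrite /= -/(dl y); lra.
- by move=> z' [].
Qed.

End LeafSets.

(** * Where the area of a large leaf ball lies *)

Section Window.
Context {R : realType} (n : nat).
Local Notation lam := (@lam R n).
Local Notation V := 'rV[R]_3.
Local Notation half := (@half R).
Local Notation P := (@solproj R n).
Local Notation M := (@sol_manifold R n).
Local Notation F := (@sol_foliation R n).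
Local Notation g := (@sol_metric R n).
Local Notation R2 := (measurableTypeR R * measurableTypeR R)%type.

Lemma open_lt_cst (f : V -> R) c : continuous f -> open [set z | f z < c].
Proof.
move=> cf; rewrite (_ : [set z | _] = f @^-1` [set x | x < c])//.
by apply: open_comp => [z _|]; [exact: cf|exact: open_lt].
Qed.

Lemma open_gt_cst (f : V -> R) c : continuous f -> open [set z | c < f z].
Proof.
move=> cf; rewrite (_ : [set z | _] = f @^-1` [set x | c < x])//.
by apply: open_comp => [z _|]; [exact: cf|exact: open_gt].
Qed.

Lemma sqr_lt_norm (a b : R) : 0 < b -> a ^+ 2 < b ^+ 2 -> `|a| < b.
Proof.
move=> b0; rewrite -[a ^+ 2]real_normK ?num_real//.
by rewrite ltr_pXn2r// nnegrE ltW.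
Qed.

Lemma area_rect (s1 s2 s3 s4 : bool) (a b c d : R) : a <= b -> c <= d ->
  area ([set` Interval (BSide s1 a) (BSide s2 b)] `*`
        [set` Interval (BSide s3 c) (BSide s4 d)] : set R2) = ((b - a) * (d - c))%:E.
Proof.
move=> ab cd; rewrite /area product_measure1E//; try exact: measurable_itv.
change ((lebesgue_measure [set` Interval (BSide s1 a) (BSide s2 b)] *
  lebesgue_measure [set` Interval (BSide s3 c) (BSide s4 d)])%E = ((b - a) * (d - c))%:E).
have len s s' (x y : R) : x <= y ->
    lebesgue_measure [set` Interval (BSide s x) (BSide s' y)] = (y - x)%:E.
  rewrite lebesgue_measure_itv/= lte_fin; have [xy _|yx xy] := ltP x y; first by rewrite EFinB.
  by rewrite (_ : y - x = 0)//; apply/eqP; rewrite subr_eq0 eq_le yx xy.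
by rewrite !len.
Qed.

(** With [E] the exponential of the radius, this contains the part of the ball
    around [(x0, w0)] that is lower than a small fraction of its top: the last
    condition is a consequence of [hcosh < E]. *)
Definition low_part (x0 w0 E : R) : set V := [set z |
  [/\ 0 < z 0 1, z 0 1 < w0 * E / 256 ^+ 2 & z 0 1 * (z 0 0 - x0) ^+ 2 < 2 * E / w0]].

Lemma open_low_part x0 w0 E : open (low_part x0 w0 E).
Proof.
rewrite (_ : low_part x0 w0 E = [set z : V | 0 < z 0 1] `&` [set z | z 0 1 < w0 * E / 256 ^+ 2] `&`
    [set z | z 0 1 * ((z 0 0 - x0) * (z 0 0 - x0)) < 2 * E / w0]).
  have cx : continuous (fun z : V => z 0 0 - x0).
    by move=> z; apply: continuousB; [exact: coord_continuous|exact: cst_continuous].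
  apply: openI; [apply: openI; [apply: open_gt_cst|apply: open_lt_cst]|apply: open_lt_cst].
  - exact: coord_continuous.
  - exact: coord_continuous.
  - have c3 (z : V) : {for z, continuous (fun z : V => z 0 1 * ((z 0 0 - x0) * (z 0 0 - x0)))}.
      by apply: continuousM; [exact: coord_continuous|apply: continuousM; exact: cx].
    exact: c3.
by apply/seteqP; split=> z; rewrite /low_part/= expr2; [move=> []|move=> [[]]].
Qed.

(** Cut at the heights [W / 4 ^ j], where [W] is the greatest height. The width of
    the [j]-th slab is of the order of [2 ^ j], so that its area is of the order of
    [2 ^- j] and the first slab dominates. *)
Lemma low_part_area x0 w0 E t : 0 < w0 -> 0 < E ->
  (area (slice (low_part x0 w0 E) t) <= (9 * E / 256)%:E)%E.
Proof.
move=> w0_gt0 E0; pose W : R := w0 * E / 256 ^+ 2.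
have W0 : 0 < W by rewrite divr_gt0 ?mulr_gt0// exprn_gt0.
(* half the width of the slabs; [3 / 2] is an upper bound of [sqrt 2] *)
pose rho j : R := 3 / 2 * 256 * 2 ^+ j.+1 / w0.
have rho0 j : 0 < rho j by rewrite divr_gt0// mulr_gt0// exprn_gt0.
pose T j : set R2 := `]x0 - rho j, x0 + rho j[%classic `*` `[W / 4 ^+ j.+1, W / 4 ^+ j[%classic.
have four (j : nat) : 0 < 4 ^+ j :> R by rewrite exprn_gt0.
have pow4 (j : nat) : 4 ^+ j = (2 ^+ j) ^+ 2 :> R.
  by rewrite -exprM mulnC exprM; congr (_ ^+ _); rewrite -natrX.
have mT j : measurable (T j) by apply: measurableX; exact: measurable_itv.
have aT j : area (T j) = (0 + (9 * E / 256 / (2 ^ j.+1)%:R)%:E)%E.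
  have h2 : 2 ^+ j != 0 :> R by rewrite expf_neq0.
  rewrite area_rect; last 2 first.
    by have := rho0 j; lra.
    by rewrite ler_pM2l// lef_pV2 ?posrE// ler_eXn2l// ltr1n.
  rewrite add0e; congr EFin; rewrite /rho /W natrX.
  rewrite [4 ^+ j.+1]exprS pow4.
  rewrite !exprS; move: (2 ^+ j) h2 => a a0; field.
  by rewrite a0 gt_eqF.
have cover : slice (low_part x0 w0 E) t `<=` \bigcup_j T j.
  move=> [x w]; rewrite /slice /low_part/= !mxE/= => -[w_gt0 wW xw].
  have exj : exists j, W / 4 ^+ j.+1 <= w.
    exists (Num.truncn (W / w)); rewrite ler_pdivrMr// mulrC -ler_pdivrMr//.
    apply: (@le_trans _ _ (Num.truncn (W / w)).+1%:R); first by apply: ltW; exact: truncnS_gt.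
    by rewrite -natrX ler_nat ltnW// ltn_expl.
  case: (ex_minnP exj) => j wj minj; exists j => //; rewrite /T; split; rewrite /= in_itv/=; last first.
    rewrite wj /=; case: j minj {wj} => [|j] minj; first by rewrite expr0 divr1.
    by rewrite ltNge; apply/negP => /minj; rewrite ltnn.
  have : (x - x0) ^+ 2 < rho j ^+ 2.
    apply: (@lt_le_trans _ _ (2 * E / w0 / w)); first by rewrite ltr_pdivlMr// mulrC.
    apply: (@le_trans _ _ (2 * E / w0 / (W / 4 ^+ j.+1))).
      by rewrite ler_pM2l ?divr_gt0 ?mulr_gt0// lef_pV2 ?posrE// divr_gt0.
    have -> : 2 * E / w0 / (W / 4 ^+ j.+1) = 2 * (256 * 2 ^+ j.+1 / w0) ^+ 2.
      rewrite pow4.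
      have h2 : 2 ^+ j.+1 != 0 :> R by rewrite expf_neq0.
      rewrite /W; move: (2 ^+ j.+1) h2 => a a0; field.
      by rewrite ?a0 ?gt_eqF.
    have -> : rho j = 3 / 2 * (256 * 2 ^+ j.+1 / w0) by rewrite /rho; ring.
    by move: (256 * 2 ^+ j.+1 / w0) => a; have := sqr_ge0 a; rewrite !expr2; lra.
  by move=> /(sqr_lt_norm (rho0 j)); rewrite ltr_norml => /andP[? ?]; apply/andP; split; lra.
apply: (@le_trans _ _ (\sum_(0 <= j <oo) area (T j))%E).
  apply: measure_sigma_subadditive => //.
  by apply: open_slice_measurable; exact: open_low_part.
rewrite (eq_eseriesr (g := fun j => (0 + (9 * E / 256 / (2 ^ j.+1)%:R)%:E)%E)); last by move=> j _; exact: aT.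
apply: le_trans (epsilon_trick xpredT _ _) _ => //; first by rewrite divr_ge0// mulr_ge0// ltW.
by rewrite eseries0 ?add0e.
Qed.

(** For [E >= 8], a rectangle in the ball of radius [ln E]: its points are reached by a
    horizontal path of length at most 1 from the centre, followed by a vertical
    path of length less than [ln E - 1]. *)
Definition high_part (x0 w0 E : R) : set V := [set z |
  `|z 0 0 - x0| < w0^-1 /\ w0 * E / 8 < z 0 1 < w0 * E / 4].

(** A rectangle around the ball, which shows that its area is finite. *)
Definition big_part (x0 w0 E : R) : set V := [set z |
  `|z 0 0 - x0| < 2 * E / w0 /\ 0 < z 0 1 < 2 * w0 * E].

Lemma open_rect (x0 a b c : R) : open [set z : V | `|z 0 0 - x0| < a /\ b < z 0 1 < c].
Proof.
rewrite (_ : [set z | _] = [set z : V | x0 - a < z 0 0] `&` [set z | z 0 0 < x0 + a] `&`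
  ([set z | b < z 0 1] `&` [set z | z 0 1 < c])).
  by apply: openI; apply: openI; (apply: open_gt_cst || apply: open_lt_cst);
    exact: coord_continuous.
apply/seteqP; split=> z /=; rewrite ltr_distl.
  by move=> [/andP[? ?] /andP[? ?]].
by move=> [[? ?] [? ?]]; split; apply/andP.
Qed.

Lemma rect_area (x0 a b c : R) t : 0 < a -> b <= c ->
  area (slice [set z : V | `|z 0 0 - x0| < a /\ b < z 0 1 < c] t) = (2 * a * (c - b))%:E.
Proof.
move=> a0 bc; rewrite (_ : slice _ t = `]x0 - a, x0 + a[%classic `*` `]b, c[%classic).
  by rewrite area_rect//; [congr EFin; ring|lra].
apply/seteqP; split=> [[x w]|[x w]]; rewrite /slice/= !mxE/= ltr_distl !in_itv/=; by [].
Qed.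

(** The heights vary by a factor 2 only, which leaves the translations, and a
    translation that preserves the plane has a lattice vector of norm 0. *)
Lemma high_part_injective x0 w0 E t : 0 < w0 -> 0 < E ->
  deck_injective n (plane_part (high_part x0 w0 E) t).
Proof.
move=> w0_gt0 E0 h z [tz [_ /andP[w1 w2]]] [].
rewrite ycoord_act tz /acty => tE [_ /andP[]]; rewrite act_w => w3 w4.
have WE : 0 < w0 * E by rewrite mulr_gt0.
have l4 := @lam_ge4 R n; have l0 := @lam_gt0 R n.
have d0 := @dscale_gt0 R n h; have dv0 : 0 < (dscale n h)^-1 :> R by rewrite invr_gt0.
have dv1 : (dscale n h)^-1 < 2 :> R.
  have : (dscale n h)^-1 * (w0 * E / 8) < 2 * (w0 * E / 8).
    by apply: lt_trans (_ : _ < (dscale n h)^-1 * z 0 1) _; [rewrite ltr_pM2l|lra].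
  by rewrite ltr_pM2r// divr_gt0.
have dv2 : 2^-1 < (dscale n h)^-1 :> R.
  have : 2^-1 * (w0 * E / 4) < (dscale n h)^-1 * (w0 * E / 4).
    by apply: lt_trans (_ : _ < (dscale n h)^-1 * z 0 1) _; [lra|rewrite ltr_pM2l].
  by rewrite ltr_pM2r// divr_gt0.
have hs : lam^-1 < dscale n h < lam.
  apply/andP; split; first by rewrite invf_plt ?posrE//; lra.
  by rewrite -ltf_pV2 ?posrE//; apply: lt_trans dv2; rewrite ltf_pV2 ?posrE//; lra.
have d1 : dscale n h = 1 :> R by rewrite /dscale (@dscale_eq1 R n h hs) expr0z.
have l2 : lat2 n (dvec h) = 0 :> R by move: tE; rewrite d1 invr1 mul1r; lra.
have dv : dvec h = 0 by apply: (@lat_eq0 R n); rewrite l2 mulr0.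
have l1 : lat1 n (dvec h) = 0 :> R by rewrite dv /lat1 /= mul0r addr0.
by apply: (deck_small hs (X := 1)); rewrite ?l1 ?l2 ?normr0 ?invr1.
Qed.

(** Hyperbolic area concentrates near the boundary of a ball and, in these
    coordinates, near its top. The constant [256 ^ 2] is such that the area
    [9 E / 256] of the part [L] below the window is less than a quarter of the area
    [E / 4] of the rectangle [high_part]. *)
Lemma leaf_ball_window z r : half z -> 3 <= r ->
  let mu := leaf_volume (P z) in let B := leaf_ball F g (P z) r in
  exists L : set (borel M), [/\ measurable (B : set (borel M)), measurable L,
    (0 < mu B < +oo)%E, (4%:E * mu L <= mu B)%E &
    forall p, B p -> ~ L p -> exists z', [/\ half z', P z' = p &
      z 0 1 * expR r / 256 ^+ 2 <= z' 0 1 < 2 * z 0 1 * expR r]].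
Proof.
move=> hz r3 mu B; set x0 := z 0 0; set w0 := z 0 1; set E := expR r.
have w0_gt0 : 0 < w0 := hz. have E0 : 0 < E := expR_gt0 _.
have WE : 0 < w0 * E by rewrite mulr_gt0.
have e2 : 2 <= expR 1 :> R by have := expR_ge1Dx (1 : R); lra.
have e4 : expR 1 <= 4 :> R.
  have h1 := expR_ge1Dx (- 2^-1 : R); have h2 : expR 1 = (expR (- 2^-1) ^+ 2)^-1 :> R.
    by rewrite expr2 -expRD -expRN; congr expR; lra.
  by rewrite h2 -[leRHS]invrK lef_pV2 ?posrE ?exprn_gt0 ?expR_gt0// expr2; nra.
have E8 : 8 <= E.
  apply: (@le_trans _ _ (expR 3)); last by rewrite ler_expR.
  have -> : expR 3 = expR 1 ^+ 3 :> R by rewrite -expRM_natl mulr1.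
  by rewrite !exprS expr0 mulr1; nra.
have [WB [oWB WBh EB]] := @leaf_ball_plane R n z r hz.
have mB : measurable (B : set (borel M)).
  by rewrite /B EB; exact: plane_part_measurable.
have lowh : low_part x0 w0 E `<=` half by move=> y [].
have highh : high_part x0 w0 E `<=` half.
  by move=> y [_ /andP[+ _]]; apply: lt_trans; rewrite divr_gt0.
have bigh : big_part x0 w0 E `<=` half by move=> y [_ /andP[]].
pose L : set (borel M) := P @` plane_part (low_part x0 w0 E) (ycoord z).
pose U : set (borel M) := P @` plane_part (high_part x0 w0 E) (ycoord z).
pose G : set (borel M) := P @` plane_part (big_part x0 w0 E) (ycoord z).
have olow := @open_low_part x0 w0 E.
have ohigh : open (high_part x0 w0 E) by exact: open_rect.
have obig : open (big_part x0 w0 E) by exact: open_rect.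
have mL : measurable L by exact: plane_part_measurable.
have mU : measurable U by exact: plane_part_measurable.
have mG : measurable G by exact: plane_part_measurable.
have ballE p : B p -> exists z', [/\ half z', ycoord z' = ycoord z, P z' = p &
    z' 0 1 < 2 * w0 * E /\ z' 0 1 * (z' 0 0 - x0) ^+ 2 < 2 * E / w0] /\ w0 < 2 * E * z' 0 1.
  move=> /(leaf_ball_hcosh hz)[z' [hz' tz' Pz' q]]; exists z'.
  have w'0 : 0 < z' 0 1 := hz'.
  have : w0 * z' 0 1 * (z' 0 0 - x0) ^+ 2 + z' 0 1 / w0 + w0 / z' 0 1 < 2 * E.
    by move: q; rewrite /hcosh /leafc /= -/E -/x0 -/w0 ltr_pdivrMr// mulrC [E * 2]mulrC; lra.
  have t1 : 0 <= w0 * z' 0 1 * (z' 0 0 - x0) ^+ 2 by rewrite mulr_ge0 ?sqr_ge0// ltW// mulr_gt0.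
  have t2 : 0 < z' 0 1 / w0 by rewrite divr_gt0.
  have t3 : 0 < w0 / z' 0 1 by rewrite divr_gt0.
  move=> sum.
  have h1 : z' 0 1 < 2 * w0 * E.
    have : z' 0 1 / w0 < 2 * E by lra.
    by rewrite ltr_pdivrMr// mulrAC.
  have h2 : z' 0 1 * (z' 0 0 - x0) ^+ 2 < 2 * E / w0.
    rewrite ltr_pdivlMr//.
    have -> : z' 0 1 * (z' 0 0 - x0) ^+ 2 * w0 = w0 * z' 0 1 * (z' 0 0 - x0) ^+ 2 by ring.
    lra.
  have h3 : w0 < 2 * E * z' 0 1.
    have : w0 / z' 0 1 < 2 * E by lra.
    by rewrite ltr_pdivrMr.
  by split.
have UB : U `<=` B.
  move=> _ [y [ty [hx /andP[hw1 hw2]]] <-].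
  have y0 : 0 < y 0 1 by apply: lt_trans hw1; rewrite divr_gt0.
  have := @leaf_path_exists R n (leafc z) (leafc y) (ycoord z) hz y0.
  rewrite -{2}ty !coord3K => py; apply: leaf_ball_path py _; rewrite /= -/x0 -/w0.
  have d1 : w0 * `|y 0 0 - x0| < 1 by rewrite -ltr_pdivlMl// mulr1.
  have d2 : ln (y 0 1) - ln w0 < r - 1.
    rewrite -ln_div ?posrE// -[ltRHS]expRK ltr_ln ?posrE ?divr_gt0 ?expR_gt0//.
    rewrite ltr_pdivrMr// expRD expRN -/E; apply: lt_le_trans hw2 _.
    have v4 : 4^-1 <= (expR 1)^-1 :> R by rewrite lef_pV2 ?posrE ?expR_gt0.
    by have := ler_wpM2l (ltW WE) v4; lra.
  have d3 : 0 <= ln (y 0 1) - ln w0.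
    rewrite subr_ge0 ler_ln ?posrE//; apply: le_trans (ltW hw1).
    by rewrite ler_pdivlMr// ler_pM2l.
  by rewrite (ger0_norm d3); lra.
have muU : mu U = (E / 4)%:E.
  have [_ /(_ (@high_part_injective x0 w0 E (ycoord z) w0_gt0 E0)) HU] :=
    @plane_part_area R n z (high_part x0 w0 E) hz ohigh highh.
  rewrite /mu HU /high_part rect_area ?invr_gt0//; last by lra.
  by congr EFin; field; rewrite gt_eqF.
have muL : (mu L <= (9 * E / 256)%:E)%E.
  have [HL _] := @plane_part_area R n z (low_part x0 w0 E) hz olow lowh.
  by apply: le_trans HL _; exact: low_part_area.
have muUB : ((E / 4)%:E <= mu B)%E.
  by rewrite -muU; apply: le_measure; rewrite ?inE.
have BG : B `<=` G.
  move=> q Bq; have [z' [[hz' tz' Pz' [h1 h2]] h3]] := ballE q Bq; exists z' => //; split=> //.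
  have w'0 : 0 < z' 0 1 := hz'.
  split; last by apply/andP.
  apply: sqr_lt_norm; first by rewrite divr_gt0// mulr_gt0.
  have : z' 0 1 * (z' 0 0 - x0) ^+ 2 < z' 0 1 * (2 * E / w0) ^+ 2.
    apply: lt_trans h2 _.
    have -> : z' 0 1 * (2 * E / w0) ^+ 2 = 2 * E / w0 * (2 * E * z' 0 1 / w0).
      by field; rewrite gt_eqF.
    by rewrite ltr_pMr ?divr_gt0 ?mulr_gt0// ltr_pdivlMr// mul1r.
  by rewrite ltr_pM2l.
exists L; split=> //.
- apply/andP; split; first by apply: lt_le_trans muUB; rewrite lte_fin divr_gt0.
  apply: (@le_lt_trans _ _ (mu G)); first by apply: le_measure; rewrite ?inE.
  have [HG _] := @plane_part_area R n z (big_part x0 w0 E) hz obig bigh.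
  apply: le_lt_trans HG _; rewrite /big_part rect_area ?ltry//.
    by rewrite divr_gt0// mulr_gt0.
  by rewrite mulr_ge0 ?mulr_ge0// ltW.
- apply: le_trans muUB; apply: (@le_trans _ _ (4%:E * (9 * E / 256)%:E)%E).
    by apply: lee_wpmul2l => //; rewrite lee_fin.
  by rewrite -EFinM lee_fin; lra.
move=> p Bp Lp; have [z' [[hz' tz' Pz' [h1 h2]] h3]] := ballE p Bp.
exists z'; split=> //; apply/andP; split=> //.
rewrite leNgt; apply/negP => h4; apply: Lp; exists z' => //.
Qed.

End Window.

(** * The oscillating function *)

Section HeightFunction.
Context {R : realType} (n : nat).
Local Notation lam := (@lam R n).
Local Notation V := 'rV[R]_3.
Local Notation half := (@half R).
Local Notation P := (@solproj R n).
Local Notation M := (@sol_manifold R n).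

Lemma cos_period_int (x : R) (k : int) : cos (x + k%:~R * (pi *+ 2)) = cos x.
Proof.
have per (m : nat) (y : R) : cos (y + m%:R * (pi *+ 2)) = cos y.
  by rewrite mulr_natl; exact: (periodicn (@cosD2pi R)).
case: k => m; first exact: per.
by rewrite NegzE -[RHS](per m.+1) rmorphN/= mulNr -pmulrn -{2}[x](subrK (m.+1%:R * (pi *+ 2))) per per.
Qed.

Definition phase (w : R) : R := pi *+ 2 * (ln w / ln lam).

(** The heights of the representatives of [p] differ by powers of [lam], which
    shift the phase by multiples of [2 pi]. *)
Definition height_cos (p : M) : R := cos (phase (xget (coord3 (0, 1) 0 : V) (half `&` P @^-1` [set p]) 0 1)).

Lemma height_cosE z : half z -> height_cos (P z) = cos (phase (z 0 1)).
Proof.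
move=> hz; rewrite /height_cos; set y := xget _ _.
have [hy Py] : (half `&` P @^-1` [set P z]) y by apply: xgetPex; exists z.
have [h Eh] := (@solproj_eq R n _ _ hz hy).1 (esym Py).
rewrite -Eh act_w /phase lnM ?posrE ?invr_gt0 ?dscale_gt0// lnV ?posrE ?dscale_gt0//.
rewrite /dscale ln_lamX -(cos_period_int _ (h.1.1)); congr cos.
have l0 := @ln_lam_gt0 R n; field; exact: lt0r_neq0.
Qed.

Lemma height_cos_continuous : continuous height_cos.
Proof.
move=> p; have [z hz <-] := solproj_surj p.
have cz : {for z, continuous (fun y : V => cos (phase (y 0 1)))}.
  apply: (@continuous_comp _ _ _ (fun y : V => phase (y 0 1)) cos); last exact: continuous_cos.
  apply: continuousM; first exact: cst_continuous.
  apply: continuousM; last exact: cst_continuous.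
  apply: (@continuous_comp _ _ _ (fun y : V => y 0 1) (@ln R)); first exact: coord_continuous.
  exact: continuous_ln.
move=> A; rewrite height_cosE// => /cz zA.
have PA := @solproj_nbhs R n _ _ hz zA.
suff : nbhs (P z) (height_cos @^-1` A) by [].
apply: filterS PA => _ [y [Ay hy] <-].
by rewrite /= height_cosE.
Qed.

Lemma continuous_borel_measurable (f : M -> R) (B : set (borel M)) : measurable B ->
  continuous f -> measurable_fun B (f : borel M -> R).
Proof.
move=> mB cf; apply: (measurability _ (RGenOInfty.measurableE R)) => //.
move=> _ [_ [a ->] <-]; apply: measurableI => //.
apply: sub_sigma_algebra; apply: open_comp; first by move=> x _; exact: cf.
exact: interval_open.
Qed.

(** In the window, [ln w] differs by at most [ln (256 ^ 2)] from the value
    [r + ln w0] at the top of the ball, and this is a small part of the period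
    [ln lam] of the function. *)
Lemma height_cos_window z r eta : half z ->
  (forall x : R, `|x| < eta -> 2^-1 <= cos x) ->
  pi *+ 2 * ln (256 ^+ 2) < eta * ln lam ->
  forall z', half z' -> z 0 1 * expR r / 256 ^+ 2 <= z' 0 1 < 2 * z 0 1 * expR r ->
  exists2 x, 2^-1 <= cos x & phase (z' 0 1) = pi *+ 2 * ((r + ln (z 0 1)) / ln lam) + x.
Proof.
move=> hz eta_cos eta_lam z' hz' /andP[w1 w2].
have w0 : 0 < z 0 1 := hz. have w'0 : 0 < z' 0 1 := hz'.
have l0 := @ln_lam_gt0 R n; have p0 : 0 < (pi *+ 2 : R) by rewrite mulrn_wgt0 ?pi_gt0.
have e0 := expR_gt0 r.
pose d := ln (z' 0 1) - (r + ln (z 0 1)).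
exists (pi *+ 2 * (d / ln lam)); last first.
  by rewrite /phase /d; field; exact: lt0r_neq0.
apply: eta_cos.
have k0 : 0 < 256 ^+ 2 :> R by rewrite exprn_gt0.
have dle : `|d| <= ln (256 ^+ 2).
  have Er : r + ln (z 0 1) = ln (z 0 1 * expR r) by rewrite lnM ?posrE// expRK addrC.
  have W0 : 0 < z 0 1 * expR r by rewrite mulr_gt0.
  have h1 : ln (z 0 1 * expR r) - ln (256 ^+ 2) <= ln (z' 0 1).
    by rewrite -ln_div ?posrE// ler_ln ?posrE// divr_gt0.
  have h2 : ln (z' 0 1) <= ln (256 ^+ 2) + ln (z 0 1 * expR r).
    rewrite -lnM ?posrE// ler_ln ?posrE ?mulr_gt0//; apply: le_trans (ltW w2) _.
    rewrite -mulrA ler_pM2r//; lra.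
  by rewrite /d Er ler_norml; apply/andP; split; lra.
rewrite normrM gtr0_norm// normrM normfV (gtr0_norm l0) mulrA ltr_pdivrMr//.
by apply: le_lt_trans eta_lam; rewrite ler_pM2l.
Qed.

End HeightFunction.

Lemma cos_near0 (R : realType) : exists2 eta : R, 0 < eta &
  forall x, `|x| < eta -> 2^-1 <= cos x.
Proof.
have : cos x @[x --> (0 : R)] --> cos (0 : R) by exact: continuous_cos.
move=> /cvgrPdist_lt /(_ 2^-1); rewrite cos0 invr_gt0 ltr0n => /(_ isT).
move=> /nbhs_ballP[e /= e0 He]; exists e => // x xe.
have := He x; rewrite /ball /= sub0r normrN => /(_ xe).
by rewrite ltr_norml; lra.
Qed.

Theorem theorem2 (R : realType) :
  exists (M : manifold R 3) (g : riemannian_metric M) (F : foliation1 M)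
         (vol : M -> {measure set (borel M) -> \bar R}) (phi : M -> R),
    [/\ compact [set: M],
        continuous phi,
        forall x, is_leaf_volume F g x (vol x) &
        exists U : set M,
          [/\ open U, U !=set0 &
              forall x, U x ->
                ~ exists l : R, length_average F g (vol x) phi x l]].
Proof.
have [eta eta0 eta_cos] := cos_near0 R.
(* a unit so large that the window is short compared with the period *)
have [n eta_lam] : exists n, pi *+ 2 * ln (256 ^+ 2) < eta * ln (@lam R n).
  pose c : R := pi *+ 2 * ln (256 ^+ 2) / eta.
  exists (Num.truncn (expR c)).
  suff : c < ln (@lam R (Num.truncn (expR c))) by rewrite /c ltr_pdivrMr// [X in _ < X]mulrC.
  rewrite -[ltLHS]expRK ltr_ln ?posrE ?expR_gt0 ?lam_gt0//.
  apply: lt_le_trans (truncnS_gt _) _.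
  apply: le_trans (@lam_geN R _); rewrite lerBrDr natr1 ler_nat /utrace; set k := Num.truncn _; move: (k); lia.
exists (@sol_manifold R n), (@sol_metric R n), (@sol_foliation R n),
  (@leaf_volume R n), (@height_cos R n).
split; [exact: sol_compact|exact: height_cos_continuous|exact: leaf_volumeP|].
exists setT; split; [exact: openT|by exists point|move=> p _ [l]].
have [z hz <-] := solproj_surj p.
move=> /cvgrPdist_lt /(_ 8^-1); rewrite invr_gt0 ltr0n => /(_ isT).
move=> [A [_ HA]].
have l0 := @ln_lam_gt0 R n.
have large c : exists j : nat, forall r : R, j%:R * ln (@lam R n) + c <= r -> 3 <= r /\ A < r.
  pose b := `|3| + `|A| + `|c|.
  exists (Num.truncn (b / ln (@lam R n))).+1 => r.
  have : b < (Num.truncn (b / ln (@lam R n))).+1%:R * ln (@lam R n).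
    by rewrite -ltr_pdivrMr//; exact: truncnS_gt.
  rewrite /b; have := ler_norm A; have := ler_norm (- c); have := normr_ge0 A.
  rewrite normrN (ger0_norm (ler0n _ 3)); lra.
have mphi B : measurable B -> measurable_fun B (@height_cos R n : borel _ -> R).
  by move=> mB; apply: continuous_borel_measurable => //; exact: height_cos_continuous.
have p0 : pi *+ 2 != 0 :> R by rewrite mulrn_eq0/= gt_eqF ?pi_gt0.
have [j Hj] := large (- ln (z 0 1)).
(* at the radii where the top of the ball is at phase 0 the average is positive *)
have avg1 : 0 < l.
  pose r := j%:R * ln (@lam R n) - ln (z 0 1).
  have [r3 Ar] := Hj r (lexx _).
  have [L [mB mL B0 LB win]] := @leaf_ball_window R n _ _ hz r3.
  have := fun H => average_ge mB mL B0 (mphi _ mB) (fun x => cos_max _) H LB.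
  have H1 p' : leaf_ball (@sol_foliation R n) (@sol_metric R n) (solproj n z) r p' -> ~ L p' ->
      2^-1 <= height_cos p'.
    move=> Bp' Lp'; have [z' [hz' <- w]] := win p' Bp' Lp'.
    have [x cx Ex] := height_cos_window hz eta_cos eta_lam hz' w.
    rewrite height_cosE// Ex /r subrK mulfK ?gt_eqF// addrC mulrC.
    by rewrite -[j%:R]/(Posz j)%:~R cos_period_int.
  move=> /(_ H1) avg; have := HA r Ar.
  by rewrite /= /ball_average ltr_norml; lra.
(* half a period later it is negative *)
have avg2 : l < 0.
  pose r := (j%:R + 2^-1) * ln (@lam R n) - ln (z 0 1).
  have [|r3 Ar] := Hj r; first by rewrite /r; lra.
  have [L [mB mL B0 LB win]] := @leaf_ball_window R n _ _ hz r3.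
  have := fun H => average_le mB mL B0 (mphi _ mB) (fun x => cos_max _) H LB.
  have H1 p' : leaf_ball (@sol_foliation R n) (@sol_metric R n) (solproj n z) r p' -> ~ L p' ->
      height_cos p' <= - 2^-1.
    move=> Bp' Lp'; have [z' [hz' <- w]] := win p' Bp' Lp'.
    have [x cx Ex] := height_cos_window hz eta_cos eta_lam hz' w.
    rewrite height_cosE// Ex /r subrK mulfK ?gt_eqF//.
    have -> : pi *+ 2 * (j%:R + 2^-1) + x = (x + pi) + (Posz j)%:~R * (pi *+ 2).
      by rewrite -pmulrn -mulr_natr; field.
    by rewrite cos_period_int cosDpi lerN2.
  move=> /(_ H1) avg; have := HA r Ar.
  by rewrite /= /ball_average ltr_norml; lra.
by have := lt_trans avg1 avg2; rewrite ltxx.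
Qed.
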